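(* Let $\tau\in\mathbb R$, let $d$ be a nonzero real number and let $J$ be an integer. Let $\Phi=\{\phi^1,\dots,\phi^r\}$, $\Psi=\{\psi^1,\dots,\psi^s\}$, $\tilde\Phi=\{\tilde\phi^1,\dots,\tilde\phi^r\}$, $\tilde\Psi=\{\tilde\psi^1,\dots,\tilde\psi^s\}$ be sets of tempered distributions on $\mathbb R$. Define $$\hat\Phi:=\{\hat\phi:\phi\in\Phi\},\quad\hat\Psi:=\{\hat\psi:\psi\in\Psi\},\quad\hat{\tilde\Phi}:=\{\hat{\tilde\phi}:\tilde\phi\in\tilde\Phi\},\quad\hat{\tilde\Psi}:=\{\hat{\tilde\psi}:\tilde\psi\in\tilde\Psi\}.$$ Then $(WS_J(\Phi;\Psi),WS_J(\tilde\Phi;\tilde\Psi))$ forms a pair of nonhomogeneous dual wavelet frames in the pair of dual Sobolev spaces $(H^\tau(\mathbb R),H^{-\tau}(\mathbb R))$ if and only if (i) there exists a positive constant $C$ such that $$\big\|\{\langle f,h\rangle\}_{h\in FWS_J(\hat\Phi;\hat\Psi)}\big\|_{\mathfrak b_{H^\tau(\mathbb R)}}\le C\|f\|_{\widehat{H^{-\tau}(\mathbb R)}},\qquad f\in\mathscr D(\mathbb R),$$ and $$\big\|\{\langle f,\tilde h\rangle\}_{\tilde h\in FWS_J(\hat{\tilde\Phi};\hat{\tilde\Psi})}\big\|_{\mathfrak b_{H^{-\tau}(\mathbb R)}}\le C\|f\|_{\widehat{H^{\tau}(\mathbb R)}},\qquad f\in\mathscr D(\mathbb R);$$ (ii) the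 pair $(FWS_J(\hat\Phi;\hat\Psi),FWS_J(\hat{\tilde\Phi};\hat{\tilde\Psi}))$, which is the image of $(WS_J(\Phi;\Psi),WS_J(\tilde\Phi;\tilde\Psi))$ under the Fourier transform, forms a pair of frequency-based nonhomogeneous dual wavelet frames in the distribution space $\mathscr D'(\mathbb R)$.
   Context: Fourier transform: $\hat f(\xi)=\int_{\mathbb R}f(x)e^{-ix\xi}dx$, extended to tempered distributions. $\mathscr D(\mathbb R)$ is the space of compactly supported $C^\infty$ functions, $\mathscr D'(\mathbb R)$ its dual. For $f\in\mathscr D(\mathbb R)$ and a distribution $\eta$, $\langle f,\eta\rangle:=\overline{\langle\eta,f\rangle}:=\overline{\eta(\overline f)}$ (so $\langle f,\eta\rangle=\int f\overline\eta$ if $\eta$ is a locally integrable function). Dilation, translation and modulation: $f_{\lambda;k}(x):=|\lambda|^{1/2}f(\lambda x-k)$ and $f_{\lambda;0,k}(x):=|\lambda|^{1/2}e^{-ik\lambda x}f(\lambda x)$ for $\lambda\neq0$, extended to distributions by duality (thus $\langle f,\eta_{\lambda;0,k}\rangle=\langle|\lambda|^{-1/2}e^{ik\cdot}f(\lambda^{-1}\cdot),\eta\rangle$ for $f\in\mathscr D(\mathbb R)$). ''Sets'' of generators are finite families whose elements need not be distinct; sums run over them with multiplicity. Systems: $$WS_J(\Phi;\Psi):=\{\phi_{d^J;k}:k\in\mathbb Z,\phi\in\Phi\}\cup\{\psi_{d^j;k}:j\ge J,k\in\mathbb Z,\psi\in\Psi\},$$ and, for finite sets $A,B$ of distributions,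 $$FWS_J(A;B):=\{\alpha_{d^{-J};0,k}:k\in\mathbb Z,\alpha\in A\}\cup\{\beta_{d^{-j};0,k}:j\ge J,k\in\mathbb Z,\beta\in B\}.$$ Sobolev spaces: $H^\tau(\mathbb R)$ is the space of tempered distributions $f$ with $\|f\|_{H^\tau(\mathbb R)}^2:=\frac1{2\pi}\int_{\mathbb R}|\hat f(\xi)|^2(1+|\xi|^2)^\tau d\xi<\infty$. $H^{-\tau}(\mathbb R)$ is the dual of $H^\tau(\mathbb R)$ through $\langle f,g\rangle=\frac1{2\pi}\int\hat f(\xi)\overline{\hat g(\xi)}d\xi$. Also $\widehat{H^\tau(\mathbb R)}:=\{\hat f:f\in H^\tau(\mathbb R)\}$ with $\|\hat f\|_{\widehat{H^\tau(\mathbb R)}}:=\|f\|_{H^\tau(\mathbb R)}$. Weighted sequence norm, for a sequence indexed by $WS_J(\Phi;\Psi)$: $$\|\{w_h\}\|_{\mathfrak b_{H^\tau(\mathbb R)}}^2:=\sum_{\phi\in\Phi}\sum_{k\in\mathbb Z}|d|^{-2\tau J}|w_{\phi_{d^J;k}}|^2+\sum_{j=J}^\infty\sum_{\psi\in\Psi}\sum_{k\in\mathbb Z}|d|^{-2\tau j}|w_{\psi_{d^j;k}}|^2;$$ for sequences indexed by $FWS_J(A;B)$ the same formula is used, with weight $|d|^{-2\tau J}$ on the entries for $\alpha_{d^{-J};0,k}$ and $|d|^{-2\tau j}$ on the entries for $\beta_{d^{-j};0,k}$. For $\mathfrak b_{H^{-\tau}(\mathbb R)}$ replace $\tau$ by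 $-\tau$. Stability: for $\Phi,\Psi\subseteq H^\tau(\mathbb R)$, $WS_J(\Phi;\Psi)$ has stability in $H^\tau(\mathbb R)$ with respect to $\mathfrak b_{H^\tau(\mathbb R)}$ if there are positive constants $C_1,C_2$ with $C_1\|f\|_{H^{-\tau}(\mathbb R)}^2\le\|\{\langle f,h\rangle\}_{h\in WS_J(\Phi;\Psi)}\|_{\mathfrak b_{H^\tau(\mathbb R)}}^2\le C_2\|f\|_{H^{-\tau}(\mathbb R)}^2$ for all $f\in H^{-\tau}(\mathbb R)$. $(WS_J(\Phi;\Psi),WS_J(\tilde\Phi;\tilde\Psi))$ forms a pair of nonhomogeneous dual wavelet frames in $(H^\tau(\mathbb R),H^{-\tau}(\mathbb R))$ if: (1) $\Phi,\Psi\subseteq H^\tau(\mathbb R)$ and $WS_J(\Phi;\Psi)$ has stability in $H^\tau(\mathbb R)$ with respect to $\mathfrak b_{H^\tau(\mathbb R)}$; (2) $\tilde\Phi,\tilde\Psi\subseteq H^{-\tau}(\mathbb R)$ and $WS_J(\tilde\Phi;\tilde\Psi)$ has stability in $H^{-\tau}(\mathbb R)$ with respect to $\mathfrak b_{H^{-\tau}(\mathbb R)}$; (3) for all $f\in H^{-\tau}(\mathbb R)$, $g\in H^\tau(\mathbb R)$, $$\langle f,g\rangle=\sum_{\ell=1}^r\sum_{k\in\mathbb Z}\langle f,\phi^\ell_{d^J;k}\rangle\langle\tilde\phi^\ell_{d^J;k},g\rangle+\sum_{j=J}^\infty\sum_{\ell=1}^s\sum_{k\in\mathbb Z}\langle f,\psi^\ell_{d^j;k}\rangle\langle\tilde\psi^\ell_{d^j;k},g\rangle$$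 with the series on the right converging absolutely. For finite sets $A=\{\alpha^1,\dots,\alpha^r\}$, $B=\{\beta^1,\dots,\beta^s\}$, $\tilde A=\{\tilde\alpha^1,\dots,\tilde\alpha^r\}$, $\tilde B=\{\tilde\beta^1,\dots,\tilde\beta^s\}$ of distributions, $(FWS_J(A;B),FWS_J(\tilde A;\tilde B))$ forms a pair of frequency-based nonhomogeneous dual wavelet frames in $\mathscr D'(\mathbb R)$ if for all $f,g\in\mathscr D(\mathbb R)$ the series $\sum_{k}\langle f,\alpha^\ell_{d^{-J};0,k}\rangle\langle\tilde\alpha^\ell_{d^{-J};0,k},g\rangle$ and $\sum_k\langle f,\beta^{\ell'}_{d^{-j};0,k}\rangle\langle\tilde\beta^{\ell'}_{d^{-j};0,k},g\rangle$ converge absolutely for all $j\ge J$, $1\le\ell\le r$, $1\le\ell'\le s$, and $$\lim_{J'\to+\infty}\Big(\sum_{\ell=1}^r\sum_{k\in\mathbb Z}\langle f,\alpha^\ell_{d^{-J};0,k}\rangle\langle\tilde\alpha^\ell_{d^{-J};0,k},g\rangle+\sum_{j=J}^{J'-1}\sum_{\ell=1}^s\sum_{k\in\mathbb Z}\langle f,\beta^\ell_{d^{-j};0,k}\rangle\langle\tilde\beta^\ell_{d^{-j};0,k},g\rangle\Big)=2\pi\langle f,g\rangle$$ (the limit existing). *)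

(* Defs.v *)
From mathcomp Require Import all_boot all_order all_algebra.
From mathcomp Require Import all_classical all_reals all_analysis.
From mathcomp Require Import complex.

Set Implicit Arguments.
Unset Strict Implicit.
Unset Printing Implicit Defensive.
Import Order.TTheory GRing.Theory Num.Theory.
Import numFieldNormedType.Exports.

Local Open Scope classical_set_scope.
Local Open Scope complex_scope.
Local Open Scope ring_scope.

(* The modulus as a real number; the library norm on R[i] takes values in R[i]. *)
Notation cabs := ComplexField.Normc.normc.

Section Functions.
Variable R : realType.
Implicit Types (f g : R -> R[i]) (tau : R).

Definition expi (t : R) : R[i] := cos t +i* sin t.

Definition cintegral f : R[i] :=
  Rintegral (@lebesgue_measure R) setT (fun x => complex.Re (f x)) +i*
  Rintegral (@lebesgue_measure R) setT (fun x => complex.Im (f x)).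

Definition conjf f : R -> R[i] := fun x => conjc (f x).

Definition cderiv (n : nat) f : R -> R[i] := fun x =>
  derive1n n (fun y => complex.Re (f y)) x +i*
  derive1n n (fun y => complex.Im (f y)) x.

Definition smooth f : Prop := forall (n : nat) (x : R),
  derivable (derive1n n (fun y => complex.Re (f y))) x 1 /\
  derivable (derive1n n (fun y => complex.Im (f y))) x 1.

Definition testfun f : Prop :=
  smooth f /\ compact (closure [set x | f x != 0]).

Definition schwartz_values (m n : nat) f : set R :=
  range (fun x : R => `|x| ^+ m * cabs (cderiv n f x)).

Definition schwartz f : Prop :=
  smooth f /\ forall m n : nat, has_ubound (schwartz_values m n f).

Definition schwartz_seminorm (m n : nat) f : R := sup (schwartz_values m n f).

Definition fourier f : R -> R[i] := fun xi =>
  cintegral (fun x => f x * expi (- (x * xi))).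

(* Square of the norm of the function f in the Fourier image of H^tau. *)
Definition hat_sobolev_sqnorm tau f : \bar R :=
  (((2 * pi)^-1)%:E * \int[@lebesgue_measure R]_x
     (cabs (f x) ^+ 2 * (1 + x ^+ 2) `^ tau)%:E)%E.

Definition hat_sobolev_norm tau f : \bar R :=
  (hat_sobolev_sqnorm tau f `^ 2^-1)%E.

(* Sum of an absolutely convergent family of real, resp. complex, numbers. *)
Definition rsumZ (u : int -> R) : R :=
  fine (\esum_(k in [set: int]) maxe (u k)%:E 0) -
  fine (\esum_(k in [set: int]) maxe (- u k)%:E 0).

Definition csumZ (u : int -> R[i]) : R[i] :=
  rsumZ (fun k => complex.Re (u k)) +i* rsumZ (fun k => complex.Im (u k)).

Definition abs_summable (I : choiceType) (u : I -> R[i]) : Prop :=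
  (\esum_(i in [set: I]) (cabs (u i))%:E < +oo)%E.

Definition ccvg_to (u : nat -> R[i]) (l : R[i]) : Prop :=
  cabs (u N - l) @[N --> \oo] --> (0 : R).

End Functions.

(* A distribution is carried by a functional on all functions; only its values
   on test functions (Schwartz functions in the tempered case) are meaningful,
   and linearity and continuity are only ever required there. *)
Definition distr (R : realType) := (R -> R[i]) -> R[i].

Section Distributions.
Variable R : realType.
Implicit Types (T U : distr R) (f g : R -> R[i]) (tau lambda : R).

Definition tempered T : Prop :=
  (forall (a : R[i]) f g, schwartz f -> schwartz g ->
     T (fun x => a * f x + g x) = a * T f + T g) /\
  (exists (C : R) (N : nat), forall f, schwartz f ->
     cabs (T f) <=
       C * \sum_(m < N) \sum_(n < N) schwartz_seminorm m n f).

Definition fourier_dist T : distr R := fun f => T (fourier f).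

(* <f, T> and <T, f> for a test function f *)
Definition pairl f T : R[i] := conjc (T (conjf f)).
Definition pairr T f : R[i] := T (conjf f).

(* T_{lambda;k} : x |-> |lambda|^(1/2) T (lambda x - k), by the change of
   variables y = lambda x - k in its integral against f *)
Definition dilate_translate lambda (k : int) T : distr R := fun f =>
  T (fun y => ((`|lambda| `^ (- 2^-1))%:C * f (lambda^-1 * (y + k%:~R)))).

(* T_{lambda;0,k} : x |-> |lambda|^(1/2) e^(-i k lambda x) T (lambda x) *)
Definition dilate_modulate lambda (k : int) T : distr R := fun f =>
  T (fun y => ((`|lambda| `^ (- 2^-1))%:C * expi (- (k%:~R * y)) *
               f (lambda^-1 * y))).

Definition represents F T : Prop :=
  [/\ locally_integrable setT (fun x : R => complex.Re (F x)),
      locally_integrable setT (fun x : R => complex.Im (F x)) &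
      forall g, testfun g -> T g = cintegral (fun x => F x * g x)].

(* The function (unique up to a null set, if any) equal to the Fourier
   transform of T. *)
Definition hatfun T : R -> R[i] :=
  xget (fun=> 0) [set F | represents F (fourier_dist T)].

Definition sobolev_sqnorm tau T : \bar R := hat_sobolev_sqnorm tau (hatfun T).

Definition sobolev tau T : Prop :=
  [/\ tempered T, exists F, represents F (fourier_dist T) &
      (sobolev_sqnorm tau T < +oo)%E].

(* The duality pairing between H^tau and H^(-tau), in either order. *)
Definition sobolev_pair T U : R[i] :=
  ((2 * pi)^-1)%:C * cintegral (fun xi => hatfun T xi * conjc (hatfun U xi)).

End Distributions.

(* Entries of a system at level J: [inl (l, k)] is the entry of the l-th
   generator of the first family at scale J, and [inr (l, n, k)] the entry of
   the l-th generator of the second family at scale j = J + n.  Indexing by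
   generator number rather than by element accounts for multiplicities. *)
Definition sysidx (r s : nat) : Type := ('I_r * int + 'I_s * nat * int)%type.

Section Systems.
Variables (R : realType) (d : R) (J : int) (r s : nat).
Implicit Types (tau : R) (f g : R -> R[i]).
Implicit Types (Phi Phit A At : 'I_r -> distr R).
Implicit Types (Psi Psit B Bt : 'I_s -> distr R).

Definition WS Phi Psi (i : sysidx r s) : distr R :=
  match i with
  | inl (l, k) => dilate_translate (d ^ J) k (Phi l)
  | inr (l, n, k) => dilate_translate (d ^ (J + n%:Z)) k (Psi l)
  end.

Definition FWS A B (i : sysidx r s) : distr R :=
  match i with
  | inl (l, k) => dilate_modulate (d ^ (- J)) k (A l)
  | inr (l, n, k) => dilate_modulate (d ^ (- (J + n%:Z))) k (B l)
  end.

(* The square of the norm b_{H^tau}. *)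
Definition bsqnorm tau (w : sysidx r s -> R[i]) : \bar R :=
  (\sum_(l < r) \esum_(k in [set: int])
      (`|d| `^ (- (2 * tau * J%:~R)) * cabs (w (inl (l, k))) ^+ 2)%:E +
   \sum_(0 <= n <oo) \sum_(l < s) \esum_(k in [set: int])
      (`|d| `^ (- (2 * tau * (J + n%:Z)%:~R)) *
         cabs (w (inr (l, n, k))) ^+ 2)%:E)%E.

Definition bnorm tau w : \bar R := (bsqnorm tau w `^ 2^-1)%E.

(* Sum of u over the entries at scale J of the first family and at the scales
   J <= j < J + N of the second one. *)
Definition partial_sys_sum (u : sysidx r s -> R[i]) (N : nat) : R[i] :=
  \sum_(l < r) csumZ (fun k => u (inl (l, k))) +
  \sum_(n < N) \sum_(l < s) csumZ (fun k => u (inr (l, n : nat, k))).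

Definition stability tau Phi Psi : Prop :=
  exists C1 C2 : R, [/\ 0 < C1, 0 < C2 &
    forall T : distr R, sobolev (- tau) T ->
      (C1%:E * sobolev_sqnorm (- tau) T
         <= bsqnorm tau (fun i => sobolev_pair T (WS Phi Psi i)))%E /\
      (bsqnorm tau (fun i => sobolev_pair T (WS Phi Psi i))
         <= C2%:E * sobolev_sqnorm (- tau) T)%E].

Definition sobolev_dual_frames tau Phi Psi Phit Psit : Prop :=
  [/\ (forall l, sobolev tau (Phi l)) /\ (forall l, sobolev tau (Psi l)),
      stability tau Phi Psi,
      (forall l, sobolev (- tau) (Phit l)) /\
      (forall l, sobolev (- tau) (Psit l)),
      stability (- tau) Phit Psit &
      forall T U : distr R, sobolev (- tau) T -> sobolev tau U ->
        let u i := sobolev_pair T (WS Phi Psi i) *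
                   sobolev_pair (WS Phit Psit i) U in
        abs_summable u /\
        ccvg_to (partial_sys_sum u) (sobolev_pair T U)].

Definition freq_dual_frames A B At Bt : Prop :=
  forall f g, testfun f -> testfun g ->
    let u i := pairl f (FWS A B i) * pairr (FWS At Bt i) g in
    [/\ forall l : 'I_r, abs_summable (fun k : int => u (inl (l, k))),
        forall (n : nat) (l : 'I_s),
          abs_summable (fun k : int => u (inr (l, n, k))) &
        ccvg_to (partial_sys_sum u)
          ((2 * pi)%:C * cintegral (fun x => f x * conjc (g x)))].

End Systems.

(* Main.v *)
From HB Require Import structures.
Require Import Defs.
From mathcomp Require Import all_boot all_order all_algebra.
From mathcomp Require Import all_classical all_reals all_analysis.
From mathcomp Require Import measurable_realfun complex ring lra.

(** Under the Fourier transform, H^tau becomes the weighted space L^2 of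
    (1 + xi^2)^tau d xi, the pairing becomes the integral of F times the
    conjugate of G, and the translates of dilates of a generator become
    modulated dilates of its transform ([fourier_dist_dilate]).  Both sides of
    the equivalence thus speak of the same coefficients.  They differ in that
    the frequency side only tests against smooth functions of compact support,
    does not presuppose that the generators lie in Sobolev spaces, and only asks
    for upper bounds.

    From Sobolev to frequency, every test function is the Fourier transform of a
    distribution that lies in all Sobolev spaces ([inv_fourier_sobolev], which
    rests on Fourier inversion).  Feeding these distributions to the stability
    inequalities and to the duality identity gives the upper bounds and the
    identity on the frequency side.

    Conversely, the upper bounds hold for each entry of the systems separately.
    An entry with trivial modulation is a dilate of its generator, and dilations
    are bounded and invertible on the weighted spaces, so the transform of the
    generator is a continuous functional on test functions for the norm of the
    dual weighted space.  By the Riesz representation theorem ([riesz]) it is a function of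
    the weighted space: the generator lies in the Sobolev space
    ([bound_sobolev]).  The coefficients of F are now integrals against
    functions of the weighted space, hence continuous in F, and the upper bounds
    extend from test functions to all F by density ([coef_bound_dense]).  By
    Cauchy-Schwarz with the reciprocal weights of orders tau and -tau, the
    products of coefficients are summable, and their partial sums are bounded by
    a constant times the product of the norms of F and G, uniformly in the
    number of scales; so the identity also extends by density
    ([dual_identity_dense]).  Lower bounds are a consequence of the identity:
    take for G the Riesz dual of F, so that the pairing is the squared norm of F
    and Cauchy-Schwarz bounds it by the coefficients of F times the norm of G
    ([dual_lower]).

    The representation theorem is obtained from Radon-Nikodym, density from the
    generation of the Borel sets by open rays ([test_class]), and the inversion
    formula by Abel summation ([abel_mean]). *)

Set SsrOldRewriteGoalsOrder.
Set Implicit Arguments.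
Unset Strict Implicit.
Unset Printing Implicit Defensive.
Import Order.TTheory GRing.Theory Num.Theory.
Import numFieldNormedType.Exports.

Local Open Scope classical_set_scope.
Local Open Scope complex_scope.
Local Open Scope ring_scope.

(** * Integrals of real functions on the line *)

Section RealIntegral.
Context {R : realType}.
Implicit Types (f g : R -> R).
Local Notation mu := (@lebesgue_measure R).

Definition rint f : R := Rintegral mu setT f.
Definition intg f : Prop := mu.-integrable setT (EFin \o f).

Lemma intg_meas f : intg f -> measurable_fun setT f.
Proof. by move=> /integrableP[/measurable_EFinP]. Qed.

Lemma intg_le f g : measurable_fun setT f -> intg g ->
  (forall x, `|f x| <= g x) -> intg f.
Proof.
move=> mf ig fg; apply: le_integrable ig => //; first exact/measurable_EFinP.
by move=> x _ /=; rewrite lee_fin (le_trans (fg x)) ?ler_norm.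
Qed.

Lemma intgD f g : intg f -> intg g -> intg (fun x => f x + g x).
Proof. by move=> fi gi; exact: (integrableD measurableT fi gi). Qed.

Lemma intgZ (k : R) f : intg f -> intg (fun x => k * f x).
Proof. by move=> fi; exact: (integrableZl measurableT k fi). Qed.

Lemma intgN f : intg f -> intg (fun x => - f x).
Proof. by move=> fi; exact: (integrableN fi). Qed.

Lemma intgB f g : intg f -> intg g -> intg (fun x => f x - g x).
Proof. by move=> fi gi; exact: (integrableB measurableT fi gi). Qed.

Lemma intg_abs f : intg f -> intg (fun x => `|f x|).
Proof. by move=> fi; exact: (integrable_norm fi). Qed.

Lemma rintD f g : intg f -> intg g ->
  rint (fun x => f x + g x) = rint f + rint g.
Proof. by move=> *; rewrite /rint RintegralD. Qed.

Lemma rintB f g : intg f -> intg g ->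
  rint (fun x => f x - g x) = rint f - rint g.
Proof. by move=> *; rewrite /rint RintegralB. Qed.

Lemma rintZ (k : R) f : intg f -> rint (fun x => k * f x) = k * rint f.
Proof. by move=> *; rewrite /rint RintegralZl. Qed.

Lemma rintN f : intg f -> rint (fun x => - f x) = - rint f.
Proof.
move=> fi; rewrite -mulN1r -rintZ//; congr rint.
by apply/funext => x; rewrite mulN1r.
Qed.

Lemma rint0 : rint (fun=> 0) = 0.
Proof. by rewrite /rint Rintegral_cst// mul0r. Qed.

Lemma rint_le f g : intg f -> intg g -> (forall x, f x <= g x) ->
  rint f <= rint g.
Proof. by move=> *; apply: le_Rintegral. Qed.

Lemma rint_ge0 f : (forall x, 0 <= f x) -> 0 <= rint f.
Proof. by move=> *; apply: Rintegral_ge0. Qed.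

Lemma rint_norm f : intg f -> `|rint f| <= rint (fun x => `|f x|).
Proof. by move=> *; apply: le_normr_Rintegral. Qed.

Lemma rint_bound f g : intg f -> intg g -> (forall x, `|f x| <= g x) ->
  `|rint f| <= rint g.
Proof.
move=> fi gi fg; apply: (le_trans (rint_norm fi)).
by apply: rint_le => //; exact: intg_abs.
Qed.

Lemma integral_EFin f : intg f -> (\int[mu]_x (f x)%:E = (rint f)%:E)%E.
Proof. by move=> fi; rewrite /rint /Rintegral fineK//; exact: integrable_fin_num. Qed.

Lemma intg_ge0P f : measurable_fun setT f -> (forall x, 0 <= f x) ->
  (intg f <-> (\int[mu]_x (f x)%:E < +oo)%E).
Proof.
move=> mf f0; split.
  by move=> /integral_EFin ->; rewrite ltry.
move=> fy; apply/integrableP; split; first exact/measurable_EFinP.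
by under eq_integral do rewrite /= ger0_norm//.
Qed.

(** Dominated convergence for a pointwise bounded sequence of real functions;
    the integrability of the limit is part of the conclusion. *)
Lemma rint_dct (u : nat -> R -> R) f g :
  (forall n, measurable_fun setT (u n)) ->
  (forall x, u n x @[n --> \oo] --> f x) ->
  intg g -> (forall n x, `|u n x| <= g x) ->
  intg f /\ rint (u n) @[n --> \oo] --> rint f.
Proof.
move=> mu_ uf ig ug.
have mf : measurable_fun setT f.
  by apply: (measurable_fun_cvg (h := u)) => // x _; exact: uf.
have uf' : {ae mu, forall x, setT x -> (u n x)%:E @[n --> \oo] --> (f x)%:E}.
  by apply: aeW => x _; apply: cvg_EFin; [exact: nearW|exact: uf].
have ug' : {ae mu, forall x n, setT x -> (`|(u n x)%:E| <= (g x)%:E)%E}.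
  by apply: aeW => x n _; rewrite lee_fin.
have [_ _ cv] := @dominated_convergence _ _ _ mu setT measurableT
   (fun n x => (u n x)%:E) (fun x => (f x)%:E) (fun x => (g x)%:E)
   (fun n => (measurable_EFinP _ _).2 (mu_ n)) ((measurable_EFinP _ _).2 mf)
   uf' ig ug'.
have If : intg f.
  apply: (intg_le mf ig) => x.
  have /cvg_norm fx := uf x.
  by apply: (ler_cvg_to fx (cvg_cst (g x))); exact: nearW.
split => //.
have ui n : intg (u n) by apply: intg_le (ug n).
by apply: fine_cvg => /=; rewrite -integral_EFin.
Qed.

End RealIntegral.

(** * Affine changes of variables *)

Section Affine.
Context {R : realType}.
Local Notation mu := (@lebesgue_measure R).

Definition affine (a b : R) : measurableTypeR R -> measurableTypeR R := fun x => a * x + b.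

Lemma measurable_affine a b : measurable_fun setT (affine a b).
Proof. by apply: measurable_funD => //; exact: measurable_funM. Qed.

(** Lebesgue measure is determined by its values on half-open intervals, and
    the image of Lebesgue measure by an affine map, rescaled, has the right
    ones. A negative slope exchanges the open and the closed end, which have
    measure zero. *)
Lemma lebesgue_affine (a b : R) : a != 0 -> forall A, measurable A ->
  mu A = (`|a|%:E * mu (affine a b @^-1` A))%E.
Proof.
move=> a0; have maf := measurable_affine a b.
apply: (lebesgue_measure_unique (mu := mscale (NngNum (normr_ge0 a)) (pushforward mu (affine a b)))) => _ [[c e]] _ <-.
change (mu `]c, e]%classic = `|a|%:E * mu (affine a b @^-1` `]c, e]))%E.
have /orP[an|ap] : (a < 0) || (0 < a) by rewrite -neq_lt.
- have -> : affine a b @^-1` `]c, e] = `[((e - b) / a), ((c - b) / a)[%classic.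
    apply/seteqP; split => x /=; rewrite !in_itv/= /affine ltr_ndivlMr//;
    by rewrite ler_ndivrMr// lerBrDr ltrBlDr [x * a]mulrC andbC.
  rewrite !lebesgue_measure_itv/= !lte_fin ltr_nM2r ?invr_lt0// ltrD2r.
  case: ifPn => _; last by rewrite mule0.
  rewrite -!EFinB -EFinM; congr EFin; rewrite ltr0_norm//.
  by field; rewrite lt_eqF.
- have -> : affine a b @^-1` `]c, e] = `]((c - b) / a), ((e - b) / a)]%classic.
    apply/seteqP; split => x /=; rewrite !in_itv/= /affine ltr_pdivrMr//;
    by rewrite ler_pdivlMr// ltrBlDr lerBrDr [x * a]mulrC.
  rewrite !lebesgue_measure_itv/= !lte_fin ltr_pM2r ?invr_gt0// ltrD2r.
  case: ifPn => _; last by rewrite mule0.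
  rewrite -!EFinB -EFinM; congr EFin; rewrite gtr0_norm//.
  by field; rewrite gt_eqF.
Qed.

Lemma ge0_integral_affine (a b : R) (f : R -> \bar R) : a != 0 ->
  measurable_fun setT f -> (forall x, (0 <= f x)%E) ->
  (\int[mu]_x f x = `|a|%:E * \int[mu]_x f (a * x + b)%R)%E.
Proof.
move=> a0 mf f0; have maf := measurable_affine a b.
rewrite (eq_measure_integral (mscale (NngNum (normr_ge0 a)) (pushforward mu (affine a b)))); last first.
  by move=> A mA _; exact: lebesgue_affine.
by rewrite ge0_integral_mscale//= ge0_integral_pushforward.
Qed.

Lemma intg_affine (a b : R) (f : R -> R) : a != 0 ->
  intg f -> intg (fun x => f (a * x + b)).
Proof.
move=> a0 fi; have mf := intg_meas fi.
have mfa : measurable_fun setT (fun x => f (a * x + b)).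
  exact: (measurableT_comp mf (measurable_affine a b)).
have /integrableP[_ fy] := fi.
apply/integrableP; split; first exact/measurable_EFinP.
rewrite (@ge0_integral_affine a b _ a0) in fy => //; last first.
  exact/measurable_EFinP/measurableT_comp.
move: fy; rewrite muleC; apply: contraTT; rewrite -!leNgt !leye_eq.
by move=> /eqP ->; rewrite gt0_mulye// lte_fin normr_gt0.
Qed.

(** The nonnegative case is the transport of the measure; the general case
    splits f into its positive and negative parts. *)
Lemma rint_affine (a b : R) (f : R -> R) : a != 0 -> intg f ->
  rint f = `|a| * rint (fun x => f (a * x + b)).
Proof.
move=> a0 fi.
pose p x := Num.max (f x) 0; pose n x := Num.max (- f x) 0.
have fpn x : f x = p x - n x.
  rewrite /p /n; have [f0|f0] := leP 0 (f x).
    by rewrite max_r ?oppr_le0// subr0.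
  by rewrite max_l ?oppr_ge0 ?ltW// opprK add0r.
have mp : measurable_fun setT p by apply: measurable_maxr => //; exact: intg_meas.
have mn : measurable_fun setT n.
  by apply: measurable_maxr => //; exact: measurableT_comp (intg_meas fi).
have ip : intg p.
  apply: intg_le mp (intg_abs fi) _ => x.
  rewrite ger0_norm ?le_max ?lexx ?orbT//.
  by rewrite ge_max ler_norm normr_ge0.
have inn : intg n.
  apply: intg_le mn (intg_abs fi) _ => x.
  rewrite ger0_norm ?le_max ?lexx ?orbT//.
  by rewrite ge_max -normrN ler_norm normr_ge0.
have E g : intg g -> (forall x, 0 <= g x) ->
    rint g = `|a| * rint (fun x => g (a * x + b)).
  move=> gi g0; apply: EFin_inj.
  rewrite EFinM -!integral_EFin//; last exact: intg_affine.
  have mg : measurable_fun setT (EFin \o g).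
    by apply/measurable_EFinP; exact: intg_meas.
  by rewrite (ge0_integral_affine b a0 mg).
have -> : f = fun x => p x - n x by exact/funext.
rewrite rintB// rintB; [|exact: intg_affine..].
by rewrite mulrBr -!E// => x; rewrite le_max lexx orbT.
Qed.

End Affine.

(** * Almost everywhere equality and complex integrals *)

Notation re := complex.Re.
Notation im := complex.Im.

Section AlmostEverywhere.
Context {R : realType}.
Implicit Types (f g : R -> R).
Local Notation mu := (@lebesgue_measure R).

(** Monotone convergence in the form that is used to prove integrability: a
    uniform bound on the integrals bounds the integral of the limit. *)
Lemma rint_mono (u : nat -> R -> R) f (M : R) :
  (forall n, intg (u n)) -> (forall n x, 0 <= u n x) ->
  (forall x, {homo u ^~ x : m n / (m <= n)%N >-> m <= n}) ->
  (forall x, u n x @[n --> \oo] --> f x) ->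
  (forall n, rint (u n) <= M) -> intg f /\ rint f <= M.
Proof.
move=> ui u0 und uf uM.
have mf : measurable_fun setT f.
  by apply: (measurable_fun_cvg (h := u)) => [n|x _]; [exact: intg_meas|exact: uf].
have f0 x : 0 <= f x by apply: (cvgr_to_ge (uf x)); exact: nearW.
have E : (\int[mu]_x (f x)%:E <= M%:E)%E.
  have -> : (\int[mu]_x (f x)%:E = \int[mu]_x limn (fun n => (u n x)%:E))%E.
    apply: eq_integral => x _; apply/esym/cvg_lim => //.
    by apply: cvg_EFin; [exact: nearW|exact: uf].
  rewrite (@monotone_convergence _ _ _ mu setT measurableT (fun n x => (u n x)%:E)).
  - apply: lime_le.
      apply: ereal_nondecreasing_is_cvgn => m n mn.
      rewrite !integral_EFin// lee_fin; apply: rint_le => // x; exact: und.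
    by apply: nearW => n; rewrite integral_EFin// lee_fin.
  - by move=> n; apply/measurable_EFinP; exact: intg_meas.
  - by move=> n x _; rewrite lee_fin.
  - by move=> x _ m n mn; rewrite lee_fin; exact: und.
have fi : intg f by apply/(intg_ge0P mf f0); rewrite (le_lt_trans E)// ltry.
by split => //; rewrite -lee_fin -integral_EFin.
Qed.

Lemma aeS (P Q : R -> Prop) : (forall x, P x -> Q x) ->
  {ae mu, forall x, P x} -> {ae mu, forall x, Q x}.
Proof. by move=> PQ; apply: (@filterS _ _ (ae_filter_ringOfSetsType mu)). Qed.

Lemma aeI (P Q : R -> Prop) : {ae mu, forall x, P x} -> {ae mu, forall x, Q x} ->
  {ae mu, forall x, P x /\ Q x}.
Proof. by move=> p q; exact: (@filterI _ _ (ae_filter_ringOfSetsType mu) _ _ p q). Qed.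

Definition aeq {T} (f g : R -> T) := {ae mu, forall x, f x = g x}.

Lemma rint_aeq f g : measurable_fun setT f -> measurable_fun setT g ->
  aeq f g -> rint f = rint g.
Proof.
move=> mf mg fg; rewrite /rint /Rintegral; congr fine.
apply: ae_eq_integral => //; [exact/measurable_EFinP|exact/measurable_EFinP|].
by apply: (aeS _ fg) => x /= -> _.
Qed.

Lemma intg_aeq f g : measurable_fun setT g -> aeq f g -> intg f -> intg g.
Proof.
move=> mg fg fi; have mf := intg_meas fi.
move/integrableP : fi => [_ fy]; apply/integrableP; split; first exact/measurable_EFinP.
rewrite (_ : integral _ _ _ = \int[mu]_x `|(EFin \o f) x|)%E//.
apply: ae_eq_integral => //.
- by apply: measurableT_comp => //; exact/measurable_EFinP.
- by apply: measurableT_comp => //; exact/measurable_EFinP.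
- by apply: (aeS _ fg) => x /= -> _.
Qed.

Lemma rint_eq0 f : intg f -> (forall x, 0 <= f x) -> rint f = 0 -> aeq f (fun=> 0).
Proof.
move=> fi f0 fE.
have /(ae_eq_integral_abs mu measurableT) : measurable_fun setT (EFin \o f).
  by apply/measurable_EFinP; exact: intg_meas.
move=> [H _].
have {}H : ae_eq mu setT (EFin \o f) (cst 0%E).
  apply: H; rewrite -[RHS]/(0%:E) -fE -integral_EFin//.
  by apply: eq_integral => x _ /=; rewrite ger0_norm.
apply: (aeS _ H) => x /= Hx.
by apply: EFin_inj; exact: Hx.
Qed.

End AlmostEverywhere.

Section ComplexIntegral.
Context {R : realType}.
Implicit Types (f g : R -> R[i]) (z w : R[i]).

Lemma cabsE z : cabs z = Num.sqrt (re z ^+ 2 + im z ^+ 2).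
Proof. by case: z. Qed.

Lemma cabs_sq z : cabs z ^+ 2 = re z ^+ 2 + im z ^+ 2.
Proof. by rewrite cabsE sqr_sqrtr// addr_ge0// sqr_ge0. Qed.

Lemma cabs_ge0 z : 0 <= cabs z.
Proof. by rewrite cabsE sqrtr_ge0. Qed.

Lemma re_cabs z : `|re z| <= cabs z.
Proof.
by rewrite -ler_sqr ?nnegrE ?cabs_ge0// cabs_sq real_normK ?num_real// lerDl sqr_ge0.
Qed.

Lemma im_cabs z : `|im z| <= cabs z.
Proof.
by rewrite -ler_sqr ?nnegrE ?cabs_ge0// cabs_sq real_normK ?num_real// lerDr sqr_ge0.
Qed.

Lemma cabs_le z : cabs z <= `|re z| + `|im z|.
Proof.
rewrite -ler_sqr ?nnegrE ?cabs_ge0 ?addr_ge0// cabs_sq sqrrD !real_normK ?num_real//.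
by rewrite lerD2r lerDl mulrn_wge0// mulr_ge0.
Qed.

Lemma cabs_conj z : cabs (conjc z) = cabs z.
Proof. by case: z => a b; rewrite !cabsE /= sqrrN. Qed.

Lemma cabsM z w : cabs (z * w) = cabs z * cabs w.
Proof. exact: ComplexField.Normc.normcM. Qed.

Lemma cabsD z w : cabs (z + w) <= cabs z + cabs w.
Proof. exact: le_normcD. Qed.

Lemma cabsN z : cabs (- z) = cabs z.
Proof. exact: normcN. Qed.

Lemma cabs0 : cabs (0 : R[i]) = 0.
Proof. exact: ComplexField.Normc.normc0. Qed.

Lemma cabs_real (a : R) : cabs a%:C = `|a|.
Proof. by rewrite cabsE /= expr0n/= addr0 sqrtr_sqr. Qed.

Lemma reD z w : re (z + w) = re z + re w. Proof. by case: z; case: w. Qed.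
Lemma imD z w : im (z + w) = im z + im w. Proof. by case: z; case: w. Qed.
Lemma reN z : re (- z) = - re z. Proof. by case: z. Qed.
Lemma imN z : im (- z) = - im z. Proof. by case: z. Qed.
Lemma reM z w : re (z * w) = re z * re w - im z * im w.
Proof. by case: z; case: w. Qed.
Lemma imM z w : im (z * w) = re z * im w + im z * re w.
Proof. by case: z; case: w. Qed.
Lemma reJ z : re (conjc z) = re z. Proof. by case: z. Qed.
Lemma imJ z : im (conjc z) = - im z. Proof. by case: z. Qed.
Lemma complex_eq z w : re z = re w -> im z = im w -> z = w.
Proof. by case: z; case: w => /= ? ? ? ? -> ->. Qed.
Lemma conjcM z w : conjc (z * w) = conjc z * conjc w. Proof. exact: rmorphM. Qed.
Lemma conjcD z w : conjc (z + w) = conjc z + conjc w. Proof. exact: rmorphD. Qed.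
Definition cmeas f := measurable_fun setT (fun x => re (f x)) /\
                      measurable_fun setT (fun x => im (f x)).

Definition cintg f := intg (fun x => re (f x)) /\ intg (fun x => im (f x)).

Lemma cintg_cmeas f : cintg f -> cmeas f.
Proof. by case=> /intg_meas ? /intg_meas ?. Qed.

Lemma cmeas_abs f : cmeas f -> measurable_fun setT (fun x => cabs (f x)).
Proof.
move=> [mr mi].
under eq_fun do rewrite cabsE.
have ms : measurable_fun setT (@Num.sqrt R).
  by apply: continuous_measurable_fun; exact: sqrt_continuous.
have mq : measurable_fun setT (fun x => re (f x) ^+ 2 + im (f x) ^+ 2).
  by apply: measurable_funD; exact: measurable_funX.
exact: (measurableT_comp ms mq).
Qed.

Lemma cmeasM f g : cmeas f -> cmeas g -> cmeas (fun x => f x * g x).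
Proof.
move=> [fr fi] [gr gi]; split.
  under eq_fun do rewrite reM.
  by apply: measurable_funB; exact: measurable_funM.
under eq_fun do rewrite imM.
by apply: measurable_funD; exact: measurable_funM.
Qed.

Lemma cmeasD f g : cmeas f -> cmeas g -> cmeas (fun x => f x + g x).
Proof.
move=> [fr fi] [gr gi]; split.
  by under eq_fun do rewrite reD; exact: measurable_funD.
by under eq_fun do rewrite imD; exact: measurable_funD.
Qed.

Lemma cmeasN f : cmeas f -> cmeas (fun x => - f x).
Proof.
move=> [fr fi]; split.
  by under eq_fun do rewrite reN; exact: measurableT_comp.
by under eq_fun do rewrite imN; exact: measurableT_comp.
Qed.

Lemma cmeasJ f : cmeas f -> cmeas (fun x => conjc (f x)).
Proof.
move=> [fr fi]; split; first by under eq_fun do rewrite reJ.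
by under eq_fun do rewrite imJ; exact: measurableT_comp.
Qed.

Lemma cmeas_cst z : cmeas (fun=> z).
Proof. by split; exact: measurable_cst. Qed.

Lemma cintg_le f (g : R -> R) : cmeas f -> intg g ->
  (forall x, cabs (f x) <= g x) -> cintg f.
Proof.
move=> [mr mi] gi fg; split.
  by apply: (intg_le mr gi) => x; exact: le_trans (re_cabs _) (fg x).
by apply: (intg_le mi gi) => x; exact: le_trans (im_cabs _) (fg x).
Qed.

Lemma cintg_abs f : cintg f -> intg (fun x => cabs (f x)).
Proof.
move=> fi; have [ri ii] := fi.
apply: (intg_le (cmeas_abs (cintg_cmeas fi)) (intgD (intg_abs ri) (intg_abs ii))).
by move=> x; rewrite ger0_norm ?cabs_ge0// cabs_le.
Qed.

Lemma cintgZ z f : cintg f -> cintg (fun x => z * f x).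
Proof.
move=> [fr fi]; split.
  by under eq_fun do rewrite reM; apply: intgB; exact: intgZ.
by under eq_fun do rewrite imM; apply: intgD; exact: intgZ.
Qed.

Lemma cintE f : cintegral f = rint (fun x => re (f x)) +i* rint (fun x => im (f x)).
Proof. by []. Qed.

Lemma cintD f g : cintg f -> cintg g ->
  cintegral (fun x => f x + g x) = cintegral f + cintegral g.
Proof.
move=> [fr fi] [gr gi]; rewrite !cintE; apply: complex_eq => /=; rewrite -rintD//;
congr rint; apply/funext => x; [exact: reD|exact: imD].
Qed.

Lemma cintZ z f : cintg f -> cintegral (fun x => z * f x) = z * cintegral f.
Proof.
move=> [fr fi]; rewrite !cintE; apply: complex_eq; rewrite ?reM ?imM/= -!rintZ//.
  by rewrite -rintB//; [under eq_fun do rewrite reM|exact: intgZ..].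
by rewrite -rintD//; [under eq_fun do rewrite imM|exact: intgZ..].
Qed.

Lemma cintN f : cintg f -> cintegral (fun x => - f x) = - cintegral f.
Proof.
move=> fi; rewrite -mulN1r -cintZ//; congr cintegral.
by apply/funext => x; rewrite mulN1r.
Qed.

Lemma cintgN f : cintg f -> cintg (fun x => - f x).
Proof.
move=> /(cintgZ (-1)); rewrite (_ : (fun x => - f x) = fun x => -1 * f x)//.
by apply/funext => x; rewrite mulN1r.
Qed.

Lemma cintB f g : cintg f -> cintg g ->
  cintegral (fun x => f x - g x) = cintegral f - cintegral g.
Proof. by move=> fi gi; rewrite cintD ?cintN//; exact: cintgN. Qed.

Lemma cintJ f : cintg f -> cintegral (fun x => conjc (f x)) = conjc (cintegral f).
Proof.
move=> [fr fi]; rewrite !cintE; apply: complex_eq; rewrite ?reJ ?imJ/=.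
  by congr rint; apply/funext => x; rewrite reJ.
by rewrite -rintN//; congr rint; apply/funext => x; rewrite imJ.
Qed.

(** The factor 2 comes from adding the bounds for the two components. *)
Lemma cint_bound f (g : R -> R) : cmeas f -> intg g ->
  (forall x, cabs (f x) <= g x) -> cabs (cintegral f) <= 2 * rint g.
Proof.
move=> mf gi fg; have [fr fi] := cintg_le mf gi fg.
rewrite cintE (le_trans (cabs_le _))//= mulr2n mulrDl mul1r.
by apply: lerD; apply: rint_bound => // x; rewrite (le_trans _ (fg x))//;
  [exact: re_cabs|exact: im_cabs].
Qed.

Lemma cint_aeq f g : cmeas f -> cmeas g -> aeq f g -> cintegral f = cintegral g.
Proof.
move=> [fr fi] [gr gi] fg; rewrite !cintE.
by congr (_ +i* _); apply: rint_aeq => //; apply: (aeS _ fg) => x ->.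
Qed.

Lemma cint_affine (a b : R) f : a != 0 -> cintg f ->
  cintegral f = `|a|%:C * cintegral (fun x => f (a * x + b)).
Proof.
move=> a0 [fr fi]; rewrite !cintE; apply: complex_eq; rewrite ?reM ?imM/=.
  by rewrite mul0r subr0 (rint_affine b a0 fr).
by rewrite mul0r addr0 (rint_affine b a0 fi).
Qed.

Lemma cintg_affine (a b : R) f : a != 0 -> cintg f -> cintg (fun x => f (a * x + b)).
Proof.
by move=> a0 [fr fi]; split; [exact: (intg_affine b a0 fr)|exact: (intg_affine b a0 fi)].
Qed.

End ComplexIntegral.

(** * Smooth functions and real test functions *)

Section Smooth.
Context {R : realType}.
Implicit Types (f g a b : R -> R).
Local Notation mu := (@lebesgue_measure R).

Definition D1 f f' := forall x, is_derive x (1 : R) f (f' x).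

Lemma D1E f f' : D1 f f' -> (derive1 f) = f'.
Proof. by move=> H; apply/funext => x; rewrite derive1E; exact: derive_val. Qed.

Lemma D1_derivable f f' x : D1 f f' -> derivable f x 1.
Proof. by move=> H; exact: ex_derive. Qed.

Lemma derivable_D1 f : (forall x, derivable f x 1) -> D1 f (derive1 f).
Proof. by move=> H x; rewrite derive1E; exact/derivableP. Qed.

Lemma D1_eq f f' g' : D1 f f' -> f' =1 g' -> D1 f g'.
Proof. by move=> H E x; rewrite -E. Qed.

Lemma D1D f f' g g' : D1 f f' -> D1 g g' ->
  D1 (fun x => f x + g x) (fun x => f' x + g' x).
Proof. by move=> H K x; have := H x; have := K x => ? ?; exact: is_deriveD. Qed.

Lemma D1M f f' g g' : D1 f f' -> D1 g g' ->
  D1 (fun x => f x * g x) (fun x => f x * g' x + f' x * g x).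
Proof.
move=> H K x; have Hx := H x; have Kx := K x.
by rewrite [f' x * _]mulrC; exact: is_deriveM.
Qed.

Lemma D1_cst (c : R) : D1 (fun=> c) (fun=> 0).
Proof. by move=> x; exact: is_derive_cst. Qed.

Lemma D1_id : D1 (fun x => x) (fun=> 1).
Proof. by move=> x; exact: is_derive_id. Qed.

Lemma D1Z (c : R) f f' : D1 f f' -> D1 (fun x => c * f x) (fun x => c * f' x).
Proof. by move=> H; apply: D1_eq (D1M (D1_cst c) H) _ => x; rewrite mul0r addr0. Qed.

Lemma D1N f f' : D1 f f' -> D1 (fun x => - f x) (fun x => - f' x).
Proof. by move=> H x; have := H x => ?; exact: is_deriveN. Qed.

Lemma D1_comp f f' g g' : D1 f f' -> D1 g g' ->
  D1 (fun x => f (g x)) (fun x => f' (g x) * g' x).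
Proof.
move=> H K x; have Hx := H (g x); have Kx := K x.
exact: (@is_derive1_comp _ f g x).
Qed.

Lemma D1_affine (c e : R) : D1 (fun x => c * x + e) (fun=> c).
Proof.
by apply: D1_eq (D1D (D1Z c D1_id) (D1_cst e)) _ => x; rewrite mulr1 addr0.
Qed.

Lemma D1_cos : D1 (@cos R) (fun x => - sin x).
Proof. by move=> x; exact: is_derive_cos. Qed.

Lemma D1_sin : D1 (@sin R) (@cos R).
Proof. by move=> x; exact: is_derive_sin. Qed.

Lemma D1_expR : D1 (@expR R) (@expR R).
Proof. by move=> x; exact: is_derive_expR. Qed.

Lemma D1_continuous f f' : D1 f f' -> continuous f.
Proof.
by move=> H x; apply: differentiable_continuous; apply/derivable1_diffP; exact: D1_derivable H.
Qed.

Definition rsmooth f := forall n x, derivable (derive1n n f) x 1.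

(** Smoothness by coinduction: a class of functions that is stable under
    differentiation consists of smooth functions. This spares any formula for
    iterated derivatives. *)
Lemma rsmooth_ind (P : (R -> R) -> Prop) :
  (forall f, P f -> exists2 f', D1 f f' & P f') -> forall f, P f -> rsmooth f.
Proof.
move=> H f Pf n; elim: n f Pf => [|n IH] f /H[f' ff' Pf'] x.
  exact: D1_derivable ff'.
by rewrite derive1Sn (D1E ff'); exact: IH.
Qed.

Lemma rsmooth_D1 f : rsmooth f -> D1 f (derive1 f).
Proof. by move=> H; apply: derivable_D1 => x; exact: (H 0%N). Qed.

Lemma rsmooth_derive f : rsmooth f -> rsmooth (derive1 f).
Proof. by move=> H n x; rewrite -derive1Sn; exact: H. Qed.

Lemma rsmooth_continuous f : rsmooth f -> continuous f.
Proof. by move=> /rsmooth_D1 /D1_continuous. Qed.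

Lemma rsmooth_cst (c : R) : rsmooth (fun=> c).
Proof.
apply: (@rsmooth_ind (fun f => exists c : R, f = fun=> c)); last by exists c.
by move=> f [e ->]; exists (fun=> 0); [exact: D1_cst|exists 0].
Qed.

Lemma rsmooth_affine (c e : R) : rsmooth (fun x => c * x + e).
Proof.
apply: (@rsmooth_ind (fun f => exists c e : R, f = fun x => c * x + e)); last by exists c, e.
move=> f [{}c [{}e ->]]; exists (fun=> c); first exact: D1_affine.
by exists 0, c; apply/funext => x; rewrite mul0r add0r.
Qed.

Lemma rsmooth_id : rsmooth (fun x => x).
Proof.
have := @rsmooth_affine 1 0; rewrite (_ : (fun x : R => 1 * x + 0) = fun x => x)//.
by apply/funext => x; rewrite mul1r addr0.
Qed.

(** The recursion on the order is what makes products tractable: the Leibniz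
    rule is only needed for one derivative at a time. *)
Fixpoint Ck (n : nat) f : Prop :=
  exists2 f', D1 f f' & if n is m.+1 then Ck m f' else True.

Lemma rsmooth_Ck f : rsmooth f <-> forall n, Ck n f.
Proof.
split=> [H n|H].
  elim: n f H => [|n IH] f H /=; exists (derive1 f) => //; try exact: rsmooth_D1.
  exact/IH/rsmooth_derive.
move=> n; elim: n f H => [|n IH] f H x.
  by have [f' ff' _] := H 0%N; exact: D1_derivable ff'.
have [f' ff' _] := H 0%N.
rewrite derive1Sn (D1E ff'); apply: IH => m.
have [g fg Hg] := H m.+1.
by rewrite -(D1E ff') (D1E fg).
Qed.

Lemma CkS n f : Ck n.+1 f -> Ck n f.
Proof.
elim: n f => [|n IH] f [f' ff' H]; exists f' => //.
exact: IH.
Qed.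

Lemma CkD n f g : Ck n f -> Ck n g -> Ck n (fun x => f x + g x).
Proof.
elim: n f g => [|n IH] f g [f' ff' Hf] [g' gg' Hg].
  by exists (fun x => f' x + g' x) => //; exact: D1D.
by exists (fun x => f' x + g' x); [exact: D1D|exact: IH].
Qed.

Lemma CkM n f g : Ck n f -> Ck n g -> Ck n (fun x => f x * g x).
Proof.
elim: n f g => [|n IH] f g Cf Cg.
  have [f' ff' _] := Cf; have [g' gg' _] := Cg.
  by eexists; [exact: D1M ff' gg'|].
have [f' ff' Hf] := Cf; have [g' gg' Hg] := Cg.
eexists; first exact: D1M ff' gg'.
by apply: CkD; apply: IH => //; exact: CkS.
Qed.

Lemma rsmoothD f g : rsmooth f -> rsmooth g -> rsmooth (fun x => f x + g x).
Proof. by move=> /rsmooth_Ck H /rsmooth_Ck K; apply/rsmooth_Ck => n; exact: CkD. Qed.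

Lemma rsmoothM f g : rsmooth f -> rsmooth g -> rsmooth (fun x => f x * g x).
Proof. by move=> /rsmooth_Ck H /rsmooth_Ck K; apply/rsmooth_Ck => n; exact: CkM. Qed.

Lemma rsmoothZ (c : R) f : rsmooth f -> rsmooth (fun x => c * f x).
Proof. move=> H; exact: (@rsmoothM (fun=> c) f (@rsmooth_cst c) H). Qed.

Lemma rsmoothX f n : rsmooth f -> rsmooth (fun x => f x ^+ n).
Proof.
move=> H; elim: n => [|n IH]; first exact: rsmooth_cst.
by under eq_fun do rewrite exprS; exact: rsmoothM.
Qed.

Lemma rsmooth_comp_affine f (c e : R) : rsmooth f -> rsmooth (fun x => f (c * x + e)).
Proof.
move=> fs; apply: (@rsmooth_ind (fun g => exists (k : R) h, rsmooth h /\
    g = fun x => k * h (c * x + e))); last first.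
  by exists 1, f; split => //; apply/funext => x; rewrite mul1r.
move=> _ [k [h [hs ->]]].
exists (fun x => k * c * (derive1 h) (c * x + e)).
  apply: D1_eq (D1Z k (D1_comp (rsmooth_D1 hs) (D1_affine c e))) _ => x; ring.
exists (k * c), (derive1 h); split; last by [].
exact: rsmooth_derive.
Qed.

Lemma rsmooth_trig (p q : R) : rsmooth (fun x => p * cos x + q * sin x).
Proof.
apply: (@rsmooth_ind (fun f => exists p q : R, f = fun x => p * cos x + q * sin x)); last by exists p, q.
move=> f [{}p [{}q ->]].
exists (fun x => q * cos x + (- p) * sin x); last by exists q, (- p).
apply: D1_eq (D1D (D1Z p D1_cos) (D1Z q D1_sin)) _ => x; ring.
Qed.

Lemma rsmooth_cos (k : R) : rsmooth (fun x => cos (k * x)).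
Proof.
have := @rsmooth_comp_affine _ k 0 (@rsmooth_trig 1 0).
by under eq_fun do rewrite mul1r mul0r !addr0.
Qed.

Lemma rsmooth_sin (k : R) : rsmooth (fun x => sin (k * x)).
Proof.
have := @rsmooth_comp_affine _ k 0 (@rsmooth_trig 0 1).
by under eq_fun do rewrite mul1r mul0r add0r addr0.
Qed.

Definition rtest a := rsmooth a /\ exists M : R, forall x, M < `|x| -> a x = 0.

Lemma rtest_smooth a : rtest a -> rsmooth a. Proof. by case. Qed.

Lemma near_norm_gt (M x : R) : M < `|x| -> \forall y \near x, M < `|y|.
Proof.
move=> Mx; have nc : Num.norm y @[y --> x] --> `|x| := @norm_continuous R R^o x.
exact: (cvgr_gt _ nc _ Mx).
Qed.

Lemma rtest_derive a : rtest a -> rtest (derive1 a).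
Proof.
move=> [sa [M aM]]; split; first exact: rsmooth_derive.
exists M => x Mx.
have -> : (derive1 a) x = derive1 (fun=> 0 : R) x.
  rewrite !derive1E; apply: near_eq_derive.
  by apply: filterS (near_norm_gt Mx) => y /aM.
by rewrite derive1_cst.
Qed.

Lemma rtest0 : rtest (fun=> 0).
Proof. by split; [exact: rsmooth_cst|exists 0]. Qed.

Lemma rtestD a b : rtest a -> rtest b -> rtest (fun x => a x + b x).
Proof.
move=> [sa [M aM]] [sb [N bN]]; split; first exact: rsmoothD.
by exists (Num.max M N) => x; rewrite gt_max => /andP[/aM -> /bN ->]; rewrite addr0.
Qed.

Lemma rtestMl a f : rsmooth f -> rtest a -> rtest (fun x => f x * a x).
Proof.
move=> sf [sa [M aM]]; split; first exact: rsmoothM.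
by exists M => x /aM ->; rewrite mulr0.
Qed.

Lemma rtestZ (c : R) a : rtest a -> rtest (fun x => c * a x).
Proof. by move=> ta; apply: rtestMl => //; exact: rsmooth_cst. Qed.

Lemma rtestN a : rtest a -> rtest (fun x => - a x).
Proof. by move=> /(rtestZ (-1)); under eq_fun do rewrite mulN1r. Qed.

Lemma rtestB a b : rtest a -> rtest b -> rtest (fun x => a x - b x).
Proof. by move=> ta /rtestN tb; exact: rtestD. Qed.

Lemma rtest_affine a (c e : R) : c != 0 -> rtest a -> rtest (fun x => a (c * x + e)).
Proof.
move=> c0 [sa [M aM]]; split; first exact: rsmooth_comp_affine.
exists ((`|M| + `|e|) / `|c|) => x; rewrite ltr_pdivrMr ?normr_gt0// => Mx.
apply: aM; rewrite (le_lt_trans (ler_norm M))//.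
have : `|x| * `|c| <= `|c * x + e| + `|e|.
  rewrite -normrM [x * c]mulrC -[c * x](addrK e).
  by rewrite (le_trans (ler_normB _ _))// addrK.
lra.
Qed.

Lemma rtest_continuous a : rtest a -> continuous a.
Proof. by move=> /rtest_smooth/rsmooth_continuous. Qed.

Lemma rtest_meas a : rtest a -> measurable_fun setT a.
Proof. by move=> /rtest_continuous; exact: continuous_measurable_fun. Qed.

Lemma rtest_bounded a : rtest a -> exists2 B : R, 0 <= B & forall x, `|a x| <= B.
Proof.
move=> ta; have ca := rtest_continuous ta; have [_ [M aM]] := ta.
have [||c _ cmax] := @EVT_max R (fun x => `|a x|) (- `|M|) `|M|.
- by rewrite -subr_ge0 opprK addr_ge0.
- by apply: continuous_subspaceT => x; apply: continuous_comp; [exact: ca|exact: norm_continuous].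
exists `|a c| => // x.
have [xM|/aM ->] := leP `|x| M; last by rewrite normr0.
by apply: cmax; rewrite in_itv/= -ler_norml (le_trans xM)// ler_norm.
Qed.

Lemma intg_bounded_supp a (B M : R) : measurable_fun setT a ->
  (forall x, `|a x| <= B) -> (forall x, M < `|x| -> a x = 0) -> intg a.
Proof.
move=> ma aB aM.
have B0 : 0 <= B by rewrite (le_trans _ (aB 0)).
apply: (@intg_le _ _ (fun x => B * \1_(`[- M, M]%classic : set R) x) ma).
  by apply: intgZ; exact: integrable_indic_itv.
move=> x; have [xM|/aM ->] := leP `|x| M; last by rewrite normr0 mulr_ge0.
by rewrite indicE mem_set ?mulr1//= in_itv/= -ler_norml.
Qed.

Lemma rtest_intg a : rtest a -> intg a.
Proof.
move=> ta; have [B _ aB] := rtest_bounded ta; have [_ [M aM]] := ta.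
exact: intg_bounded_supp (rtest_meas ta) aB aM.
Qed.

(** The fundamental theorem of calculus on an interval that contains the
    support; this is the integration by parts behind the decay of Fourier
    transforms. *)
Lemma rint_derive a : rtest a -> rint (derive1 a) = 0.
Proof.
move=> ta; have [_ [M0 aM0]] := ta.
pose M : R := `|M0| + 1.
have M0M : M0 < M by rewrite (le_lt_trans (ler_norm _))// ltrDl.
have Mp : 0 < M by rewrite ltr_wpDl.
have aM x : M <= `|x| -> a x = 0 by move=> H; apply: aM0; exact: lt_le_trans H.
have ta' := rtest_derive ta.
have da := rsmooth_D1 (rtest_smooth ta).
have [_ [N aN]] := ta'.
have E : (\int[mu]_(x in `[(- M)%R, M]) ((derive1 a) x)%:E = (a M)%:E - (a (- M)%R)%:E)%E.
  apply: continuous_FTC2 => //.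
  - by rewrite -subr_gt0; lra.
  - by apply: continuous_subspaceT => x; exact: rtest_continuous.
  - split; first by move=> x _; exact: D1_derivable da.
    + by apply: cvg_at_right_filter; exact: rtest_continuous.
    + by apply: cvg_at_left_filter; exact: rtest_continuous.
have a'M x : M <= `|x| -> (derive1 a) x = 0.
  move=> Mx; have -> : (derive1 a) x = derive1 (fun=> 0 : R) x.
    rewrite !derive1E; apply: near_eq_derive.
    by apply: filterS (near_norm_gt (lt_le_trans M0M Mx)) => y /aM0.
  by rewrite derive1_cst.
have aM1 : a M = 0 by apply: aM; rewrite ler_norm.
have aM2 : a (- M) = 0 by apply: aM; rewrite normrN ler_norm.
rewrite integral_mkcond aM1 aM2 subee// in E.
rewrite /rint /Rintegral -[RHS]/(fine 0%E) -E; congr fine.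
apply: eq_integral => x _; rewrite patchE; case: ifPn => // /negP.
rewrite inE/= in_itv/= -ler_norml => /negP; rewrite -ltNge => /ltW.
by move=> /a'M ->.
Qed.

End Smooth.

(** * Bump functions *)

Section Bump.
Context {R : realType}.
Implicit Types (p q : {poly R}).

(** From 1 + t/n <= exp (t/n), raised to the power n. *)
Lemma pow_le_expR (t : R) (n : nat) : 0 <= t -> t ^+ n <= n%:R ^+ n * expR t.
Proof.
move=> t0; case: n => [|n]; first by rewrite !expr0 mul1r -expR0 ler_expR.
have n0 : 0 < n.+1%:R :> R by rewrite ltr0n.
have -> : expR t = expR (t / n.+1%:R) ^+ n.+1.
  by rewrite -expRM_natl; congr expR; field.
rewrite -exprMn ler_pXn2r ?nnegrE ?mulr_ge0 ?expR_ge0 ?(ltW n0)//.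
apply: (@le_trans _ _ (n.+1%:R * (t / n.+1%:R))).
  by rewrite mulrC divfK// gt_eqF.
by rewrite ler_pM2l// (le_trans _ (expR_ge1Dx _))// lerDr.
Qed.

Lemma poly_le_expR p : exists2 C : R, 0 <= C &
  forall t, 0 <= t -> `|p.[t]| <= C * expR t.
Proof.
exists (\sum_(i < size p) `|p`_i| * i%:R ^+ i).
  by apply: sumr_ge0 => i _; rewrite mulr_ge0// exprn_ge0.
move=> t t0; rewrite horner_coef (le_trans (ler_norm_sum _ _ _))// mulr_suml.
apply: ler_sum => i _; rewrite normrM -mulrA ler_wpM2l// ger0_norm ?exprn_ge0//.
exact: pow_le_expR.
Qed.

(** The functions p(1/x) exp(-1/x) on the positive half-line form a class that
    is stable under differentiation, hence consist of smooth functions that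
    are flat at 0. *)
Definition flat p (x : R) : R := if 0 < x then p.[x^-1] * expR (- x^-1) else 0.

(** Being O(x^2) at 0 gives both continuity and a zero derivative there. *)
Lemma flat_bound p : exists2 C : R, 0 <= C & forall x, `|flat p x| <= C * x ^+ 2.
Proof.
have [C C0 H] := poly_le_expR (p * 'X^2).
exists C => // x; rewrite /flat; case: ifPn => [x0|_]; last by rewrite normr0 mulr_ge0// sqr_ge0.
have xi0 : 0 <= x^-1 by rewrite invr_ge0 ltW.
have := H _ xi0; rewrite hornerM hornerXn normrM [`|_ ^+ 2|]ger0_norm ?exprn_ge0//.
rewrite normrM [`|expR _|]ger0_norm ?expR_ge0// expRN => Hp.
rewrite ler_pdivrMr ?expR_gt0//.
rewrite -(ler_pM2r (x := (x^-1) ^+ 2)) ?exprn_gt0 ?invr_gt0// (le_trans Hp)//.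
rewrite le_eqVlt; apply/orP; left; apply/eqP.
by field; rewrite gt_eqF.
Qed.

Lemma flat_D1 p : D1 (flat p) (flat ((p - p^`()) * 'X^2)).
Proof.
move=> x; have [x0|x0|->] := ltgtP x 0.
- rewrite {2}/flat ltNge (ltW x0)/=.
  apply: (@near_eq_is_derive _ _ _ (fun=> 0) (flat p)).
    by near=> y; rewrite /flat ltNge ltW//; near: y; exact: lt_nbhsl.
- rewrite {2}/flat x0.
  apply: (@near_eq_is_derive _ _ _ (fun x : R => p.[x^-1] * expR (- x^-1))).
    by near=> y; rewrite /flat ifT//; near: y; exact: lt_nbhsr.
  have iV : is_derive x (1:R) (fun x : R => x^-1) (- x ^- 2).
    have := @is_deriveV R (fun x => x) x 1 1; rewrite /= gt_eqF//.
    by move=> /(_ isT (is_derive_id _ _)); rewrite [_ *: _]mulr1.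
  have iP : is_derive x (1:R) (fun x : R => p.[x^-1]) (p^`().[x^-1] * (- x ^- 2)).
    exact: (@is_derive1_comp _ (horner p) (fun x : R => x^-1) x).
  have iN : is_derive x (1:R) (fun x : R => - x^-1) (- - x ^- 2) by exact: is_deriveN.
  have iE : is_derive x (1:R) (fun x : R => expR (- x^-1)) (expR (- x^-1) * (- - x ^- 2)).
    exact: (@is_derive1_comp _ expR (fun x : R => - x^-1) x).
  have := is_deriveM iP iE => H.
  apply: is_derive_eq; rewrite /= hornerM hornerXn hornerD hornerN /GRing.scale/=.
  by field; rewrite gt_eqF.
- have [C C0 HC] := flat_bound p.
  have f0 q : flat q 0 = 0 by rewrite /flat ltxx.
  rewrite f0; apply/is_derive1_caratheodory.
  exists (fun z => flat p z / z); split.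
  + move=> z; rewrite f0 !subr0; have [->|z0] := eqVneq z 0; first by rewrite f0 mulr0.
    by rewrite divfK.
  + suff: flat p z / z @[z --> (0:R)] --> (0:R) by rewrite /prop_for /continuous_at f0 mul0r.
    apply/(@cvgr0Pnorm_le R R^o) => e e0.
    near=> z.
    have [->|z0] := eqVneq z 0; first by rewrite f0 mul0r normr0 ltW.
    rewrite normf_div ler_pdivrMr ?normr_gt0// (le_trans (HC z))//.
    rewrite -[z ^+ 2]real_normK ?num_real// expr2 mulrA ler_wpM2r//.
    rewrite (@le_trans _ _ ((C + 1) * `|z|))//; first by rewrite ler_wpM2r// lerDl.
    rewrite -ler_pdivlMl ?ltr_wpDl//.
    by near: z; apply: (@nbhs0_le R R^o); rewrite mulr_gt0 ?invr_gt0 ?ltr_wpDl.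
  + by rewrite f0 mul0r.
Unshelve. all: end_near. Qed.

Lemma rsmooth_flat p : rsmooth (flat p).
Proof.
apply: (@rsmooth_ind _ (fun f => exists p, f = flat p)); last by exists p.
move=> f [{}p ->]; exists (flat ((p - p^`()) * 'X^2)); first exact: flat_D1.
by eexists.
Qed.

(** For a smooth h with values in [0, 1) that is positive exactly on the
    interval, 1 - (1 - h)^n tends to the indicator function of the interval,
    and stays smooth and supported in it. *)
Lemma bump_seq (a b : R) : exists g : nat -> R -> R,
  [/\ forall n, rtest (g n), forall n x, 0 <= g n x <= 1,
      forall n x, x \notin `]a, b[ -> g n x = 0 &
      forall x, x \in `]a, b[ -> g n x @[n --> \oo] --> (1 : R)].
Proof.
pose e := flat 1.
have e01 x : 0 <= e x <= 1.
  rewrite /e /flat hornerC mul1r; case: ifPn => // x0; last by rewrite lexx ler01.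
  by rewrite expR_ge0 -expR0 ler_expR lerNl oppr0 invr_ge0 ltW.
have epos x : 0 < x -> 0 < e x.
  by move=> x0; rewrite /e /flat x0 hornerC mul1r expR_gt0.
have e0 x : x <= 0 -> e x = 0 by move=> x0; rewrite /e /flat ltNge x0.
pose h x := e (1 * x + (- a)) * e ((-1) * x + b).
have h01 x : 0 <= h x <= 1.
  have /andP[p1 p2] := e01 (1 * x - a); have /andP[q1 q2] := e01 (-1 * x + b).
  by rewrite mulr_ge0//= mulr_ile1.
have hs : rsmooth h.
  by apply: rsmoothM; apply: rsmooth_comp_affine; exact: rsmooth_flat.
have hout x : x \notin `]a, b[ -> h x = 0.
  rewrite in_itv/= negb_and -!leNgt => /orP[xa|xb]; rewrite /h.
    by rewrite e0 ?mul0r// mul1r subr_le0.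
  by rewrite mulrC e0 ?mul0r// mulN1r addrC subr_le0.
have hin x : x \in `]a, b[ -> 0 < h x.
  rewrite in_itv/= => /andP[xa xb]; rewrite mulr_gt0 ?epos//.
    by rewrite mul1r subr_gt0.
  by rewrite mulN1r addrC subr_gt0.
exists (fun n x => 1 - (1 + (-1) * h x) ^+ n); split.
- move=> n; split.
    under eq_fun do rewrite -mulN1r.
    apply: rsmoothD; first exact: rsmooth_cst.
    apply: rsmoothZ; apply: rsmoothX; apply: rsmoothD; first exact: rsmooth_cst.
    exact: rsmoothZ.
  exists (Num.max `|a| `|b|) => x; rewrite gt_max => /andP[xa xb].
  rewrite hout ?mulr0 ?addr0 ?expr1n ?subrr//.
  rewrite in_itv/=; apply/negP => /andP[ax bx].
  have := ler_norm a; have := ler_norm b; have := ler_norm (- a); rewrite normrN.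
  move: xa xb; have [x0|x0] := leP 0 x; rewrite ?(ger0_norm x0) ?(ltr0_norm x0); lra.
- move=> n x; have /andP[p1 p2] := h01 x; rewrite mulN1r.
  have q0 : 0 <= 1 - h x by rewrite subr_ge0.
  rewrite subr_ge0 exprn_ile1//=; last by rewrite gerBl.
  by rewrite gerBl exprn_ge0.
- by move=> n x /hout ->; rewrite mulr0 addr0 expr1n subrr.
- move=> x /hin hx; rewrite -[X in _ --> X]subr0; apply: cvgB; first exact: cvg_cst.
  apply: cvg_expr; rewrite mulN1r ger0_norm; last by rewrite subr_ge0; have /andP[] := h01 x.
  by rewrite gtrBl.
Qed.

End Bump.

(** * Classes generated by test functions *)

Section IndicatorClass.
Context {R : realType}.
Import HBSimple HBNNSimple.
Variable V : (R -> R) -> Prop.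
Hypothesis Vset : forall (M : R) (A : set R), measurable A ->
  V (\1_(A `&` `]- M, M[%classic)).
Hypothesis Vlin : forall (c : R) f g, V f -> V g -> V (fun x => f x + c * g x).
Hypothesis Vlim : forall (u : nat -> R -> R) f (M B : R),
  (forall n, V (u n)) -> (forall n, measurable_fun setT (u n)) ->
  (forall n x, `|u n x| <= B) -> (forall n x, M < `|x| -> u n x = 0) ->
  (forall x, u n x @[n --> \oo] --> f x) -> V f.

Let V0 : V (fun=> 0).
Proof.
have := Vset 0 measurable0; rewrite set0I indic0.
by rewrite (_ : cst 0 = fun=> 0).
Qed.

Let V_sum (k : nat) (c : nat -> R) (F : nat -> R -> R) : (forall i, V (F i)) ->
  V (fun x => \sum_(i < k) c i * F i x).
Proof.
move=> VF; elim: k => [|k IH]; first by under eq_fun do rewrite big_ord0.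
by under eq_fun do rewrite big_ord_recr/=; exact: Vlin.
Qed.

Let V_pos (f : R -> R) (B M : R) : measurable_fun setT f -> (forall x, 0 <= f x <= B) ->
  (forall x, M < `|x| -> f x = 0) -> V f.
Proof.
move=> mf fB fM.
have f0 x : setT x -> (0 <= (f x)%:E)%E by move=> _; rewrite lee_fin; case/andP: (fB x).
have mf' : measurable_fun setT (fun x => (f x)%:E) by exact/measurable_EFinP.
pose u := nnsfun_approx (@measurableT _ R) mf'.
have cu x : u n x @[n --> \oo] --> f x.
  have := cvg_nnsfun_approx measurableT mf' f0 (x := x) Logic.I.
  by move=> /fine_cvg.
have uf x n : u n x <= f x.
  have nd : nondecreasing_seq (fun n => u n x).
    by move=> m k mk; have /lefP := nd_nnsfun_approx measurableT mf' mk; exact.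
  apply: (cvgr_to_ge (cu x)); near=> k; apply: nd; near: k; exact: nbhs_infty_ge.
have u0 x n : 0 <= u n x by exact: fun_ge0.
have uM n x : M < `|x| -> u n x = 0.
  by move=> xM; apply/eqP; rewrite eq_le u0 andbT -(fM _ xM) uf.
apply: (Vlim (u := fun n => u n : R -> R) (M := M) (B := B)) => //.
- move=> n; pose s : seq R := finmap.enum_fset (fset_set (range (u n))).
  have -> : (u n : R -> R) = fun x => \sum_(i < size s)
      s`_i * \1_((u n @^-1` [set s`_i]) `&` `]- (`|M| + 1), `|M| + 1[%classic) x.
    apply/funext => x.
    have [xM|xM] := pselect ((`]- (`|M| + 1), `|M| + 1[%classic : set R) x); last first.
      rewrite uM; last first.
        move: xM; rewrite /= in_itv/= -ltr_norml => /negP; rewrite -leNgt.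
        by apply: lt_le_trans; rewrite (le_lt_trans (ler_norm _))// ltrDl.
      by rewrite big1// => i _; rewrite indicE memNset ?mulr0// => -[].
    rewrite fimfunEord; apply: eq_bigr => i _; rewrite !indicE.
    have [H|H] := pselect ((u n @^-1` [set s`_i]) x); first by rewrite !mem_set.
    by rewrite !memNset// => -[].
  apply: (@V_sum _ (nth 0 s)
    (fun i => \1_((u n @^-1` [set s`_i]) `&` `]- (`|M| + 1), `|M| + 1[%classic))) => i.
  by apply: Vset; exact: measurable_sfunP.
- by move=> n x; rewrite ger0_norm// (le_trans (uf x n))//; case/andP: (fB x).
Unshelve. all: end_near. Qed.

(** A functional form of the approximation by simple functions: what holds for
    bounded indicator functions, and passes to linear combinations and to
    bounded pointwise limits with a common support, holds for all bounded
    measurable functions of bounded support. *)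
Theorem indicator_class (f : R -> R) (B M : R) : measurable_fun setT f ->
  (forall x, `|f x| <= B) -> (forall x, M < `|x| -> f x = 0) -> V f.
Proof.
move=> mf fB fM.
have -> : f = fun x => Num.max (f x) 0 + (-1) * Num.max (- f x) 0.
  apply/funext => x; rewrite mulN1r; have [f0|f0] := leP 0 (f x).
    by rewrite max_r ?oppr_le0// subr0.
  by rewrite max_l ?oppr_ge0 ?ltW// opprK add0r.
have B0 : 0 <= B by rewrite (le_trans _ (fB 0)).
apply: Vlin; apply: (@V_pos _ B M).
- exact: measurable_maxr.
- move=> x; rewrite le_max lexx orbT ge_max B0 andbT.
  exact: le_trans (ler_norm _) (fB x).
- by move=> x /fM ->; rewrite maxxx.
- by apply: measurable_maxr => //; exact: measurableT_comp.
- move=> x; rewrite le_max lexx orbT ge_max B0 andbT.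
  by rewrite (le_trans (ler_norm _))// normrN.
- by move=> x /fM ->; rewrite oppr0 maxxx.
Qed.

End IndicatorClass.

Section TestClass.
Context {R : realType}.
Variable V : (R -> R) -> Prop.
Hypothesis Vtest : forall a, rtest a -> V a.
Hypothesis Vlin : forall (c : R) f g, V f -> V g -> V (fun x => f x + c * g x).
Hypothesis Vlim : forall (u : nat -> R -> R) f (M B : R),
  (forall n, V (u n)) -> (forall n, measurable_fun setT (u n)) ->
  (forall n x, `|u n x| <= B) -> (forall n x, M < `|x| -> u n x = 0) ->
  (forall x, u n x @[n --> \oo] --> f x) -> V f.

Let V_itv (a b : R) : V (\1_(`]a, b[%classic : set R)).
Proof.
have [g [gt g01 g0 g1]] := bump_seq a b.
apply: (Vlim (u := g) (M := Num.max `|a| `|b|) (B := 1)).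
- by move=> n; exact: Vtest.
- by move=> n; exact: rtest_meas.
- by move=> n x; have /andP[p q] := g01 n x; rewrite ger0_norm.
- move=> n x; rewrite gt_max => /andP[xa xb]; apply: g0.
  rewrite in_itv/=; apply/negP => /andP[ax bx].
  have := ler_norm a; have := ler_norm b; have := ler_norm (- a); rewrite normrN.
  move: xa xb; have [x0|x0] := leP 0 x; rewrite ?(ger0_norm x0) ?(ltr0_norm x0); lra.
- move=> x; rewrite indicE; have [xab|xab] := boolP (x \in `]a, b[).
    by rewrite mem_set//; exact: g1.
  rewrite memNset; last exact/negP.
  by under eq_fun do rewrite g0//; exact: cvg_cst.
Qed.

Let V_set (M : R) (A : set R) : measurable A -> V (\1_(A `&` `]- M, M[%classic)).
Proof.
move=> mA0; have mA : (@RGenOInfty.G R).-sigma.-measurable A.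
  by rewrite -RGenOInfty.measurableE.
pose H := [set A : set R | measurable A /\ V (\1_(A `&` `]- M, M[%classic))].
suff : H A by case.
apply: (@lambda_system_subset _ (@RGenOInfty.G R) _ setT H) => //.
- move=> _ _ [a ->] [b ->]; exists (Num.max a b).
  by apply/seteqP; split => x /=; rewrite !in_itv/= !andbT gt_max => /andP.
- split => //.
  + by split => //; rewrite setTI; exact: V_itv.
  + move=> B C CB [mB VB] [mC VC]; split; first exact: measurableD.
    have -> : \1_((B `\` C) `&` `]- M, M[%classic) =
        (fun x => \1_(B `&` `]- M, M[%classic) x + (-1) * \1_(C `&` `]- M, M[%classic) x) :> (R -> R).
      apply/funext => x; rewrite !indicE.
      have [xM|xM] := pselect ((`]- M, M[%classic : set R) x); last first.
        by rewrite !memNset ?mulr0 ?addr0// => -[].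
      have [Cx|Cx] := pselect (C x).
        rewrite memNset; last by case=> -[].
        by rewrite mem_set ?mem_set ?mulr1 ?subrr//; split=> //; exact: CB.
      rewrite [in X in _ + X]memNset ?mulr0 ?addr0; last by case.
      have [Bx|Bx] := pselect (B x); first by rewrite !mem_set.
      by rewrite !memNset// => -[]// [].
    exact: Vlin.
  + move=> F ndF HF; have mF n : measurable (F n) by case: (HF n).
    split; first exact: bigcup_measurable.
    apply: (Vlim (u := fun n => \1_(F n `&` `]- M, M[%classic)) (M := M) (B := 1)).
    * by move=> n; case: (HF n).
    * by move=> n; apply: measurable_indic; apply: measurableI.
    * by move=> n x; rewrite indicE normr_nat; case: (_ \in _); rewrite ?ler01.
    * move=> n x xM; rewrite indicE memNset// => -[_]; rewrite /= in_itv/=.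
      by rewrite -ltr_norml ltNge (ltW xM).
    * move=> x; have [[[k _ Fk] xM]|nx] := pselect (((\bigcup_k F k) `&` `]- M, M[%classic) x).
        rewrite indicE mem_set; last by split => //; exists k.
        apply: (@cvg_near_cst _ _ _ _ _ _); exists k => // n /= kn.
        rewrite indicE mem_set//; split => //.
        by have /subsetPset := ndF _ _ kn; exact.
      rewrite [in X in _ --> X]indicE memNset//.
      under eq_fun => n.
        rewrite indicE memNset; last by move=> [Fn xM]; apply: nx; split => //; exists n.
        over.
      exact: cvg_cst.
- move=> _ [a ->]; split; first exact: measurable_itv.
  have -> : `]a, +oo[%classic `&` `]- M, M[%classic = `]Num.max a (- M), M[%classic.
    apply/seteqP; split => x /=; rewrite !in_itv/= andbT gt_max.
      by move=> [-> /andP[-> ->]].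
    by move=> /andP[/andP[-> ->] ->].
  exact: V_itv.
Qed.

(** Test functions generate everything under bounded limits: they approximate
    indicators of bounded open intervals, in particular of open rays cut to
    ]-M, M[. Open rays form a pi-system that generates the Borel sets, and the
    sets whose indicator, cut to ]-M, M[, is in the class form a
    lambda-system. *)
Theorem test_class (f : R -> R) (B M : R) : measurable_fun setT f ->
  (forall x, `|f x| <= B) -> (forall x, M < `|x| -> f x = 0) -> V f.
Proof. exact: indicator_class. Qed.

End TestClass.

Section TestFunctions.
Context {R : realType}.
Implicit Types (f : R -> R[i]) (a b : R -> R).

(** Complex test functions reduce to pairs of real ones, for which the support
    condition is the vanishing outside of a bounded interval. *)
Lemma testfunP f : testfun f <->
  rtest (fun x => re (f x)) /\ rtest (fun x => im (f x)).
Proof.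
split=> [[sf cf]|[[sr [M rM]] [si [N iN]]]].
  have [M [_ HM]] := compact_bounded cf.
  have fM x : M + 1 < `|x| -> f x = 0.
    move=> xM; apply/eqP; apply/negPn/negP => fx.
    have MM : M < M + 1 by rewrite ltrDl.
    have : `|x| <= M + 1 by apply: (HM _ MM); exact: subset_closure.
    by rewrite leNgt xM.
  split; split.
  - by move=> n x; exact: (proj1 (sf n x)).
  - by exists (M + 1) => x /fM ->.
  - by move=> n x; exact: (proj2 (sf n x)).
  - by exists (M + 1) => x /fM ->.
split; first by move=> n x; split; [exact: sr|exact: si].
pose K := Num.max M N.
apply: (subclosed_compact _ (@segment_compact _ (- K) K)); first exact: closed_closure.
have cK : closed (`[- K, K]%classic : set R) by exact: interval_closed.
rewrite ((closure_id _).1 cK); apply: closureS => x /= fx.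
rewrite in_itv/= -ler_norml leNgt; apply/negP; rewrite gt_max => /andP[xM xN].
by move/eqP: fx; apply; apply: complex_eq; rewrite ?rM ?iN.
Qed.

End TestFunctions.

(** * Weighted L^2 spaces *)

Section Weight.
Context {R : realType}.
Implicit Types (a b f g : R -> R) (tau : R).

Definition wt tau (x : R) : R := (1 + x ^+ 2) `^ tau.

Lemma oneDsq_ge1 (x : R) : 1 <= 1 + x ^+ 2.
Proof. by rewrite lerDl sqr_ge0. Qed.

Lemma oneDsq_gt0 (x : R) : 0 < 1 + x ^+ 2.
Proof. exact: lt_le_trans (oneDsq_ge1 x). Qed.

Lemma wt_gt0 tau x : 0 < wt tau x.
Proof. exact: powR_gt0 (oneDsq_gt0 x). Qed.

Lemma wt_ge0 tau x : 0 <= wt tau x. Proof. exact/ltW/wt_gt0. Qed.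

Lemma wtM s t x : wt s x * wt t x = wt (s + t) x.
Proof. by rewrite /wt powRD// (gt_eqF (oneDsq_gt0 x)) implybT. Qed.

Lemma wt0 x : wt 0 x = 1. Proof. exact: powRr0. Qed.

Lemma wtNK tau x : wt tau x * wt (- tau) x = 1.
Proof. by rewrite wtM subrr wt0. Qed.

Lemma wt_meas tau : measurable_fun setT (wt tau).
Proof.
have m1 : measurable_fun setT (fun x : R => 1 + x ^+ 2).
  by apply: measurable_funD => //; exact: measurable_funX.
by apply: (measurableT_comp (f := @powR R ^~ tau) _ m1); exact: measurable_powR.
Qed.

Lemma wt_bounded tau (M x : R) : `|x| <= M -> wt tau x <= (1 + M ^+ 2) `^ `|tau|.
Proof.
move=> xM; apply: (@le_trans _ _ (wt `|tau| x)).
  by rewrite /wt ler_powR ?oneDsq_ge1// ler_norm.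
apply: ge0_ler_powR; rewrite ?nnegrE ?(ltW (oneDsq_gt0 _))//.
by rewrite lerD2l -real_normK ?num_real// lerXn2r ?nnegrE// (le_trans _ xM).
Qed.

(** 1 + (c x)^2 and 1 + x^2 are comparable; this makes dilations bounded on
    every weighted space. *)
Lemma wt_scale tau (c : R) : c != 0 ->
  exists2 K : R, 0 < K & forall x, wt tau (c * x) <= K * wt tau x.
Proof.
move=> c0; have c2 : 0 < c ^+ 2 by rewrite exprn_even_gt0.
have [t0|t0] := leP 0 tau.
- pose M := 1 + c ^+ 2.
  exists (M `^ tau) => [|x]; first by rewrite powR_gt0// addr_gt0.
  have M0 : 0 <= M := ltW (oneDsq_gt0 c).
  rewrite /wt -powRM ?(ltW (oneDsq_gt0 _))//.
  apply: ge0_ler_powR; rewrite ?nnegrE ?(ltW (oneDsq_gt0 _)) ?mulr_ge0 ?(ltW (oneDsq_gt0 _))//.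
  rewrite /M exprMn mulrDl mul1r mulrDr mulr1 lerD ?lerDr ?sqr_ge0//.
  by rewrite lerDl sqr_ge0.
- pose m := Num.min 1 (c ^+ 2).
  have m0 : 0 < m by rewrite lt_min ltr01.
  exists (m `^ tau) => [|x]; first by rewrite powR_gt0.
  rewrite /wt -powRM ?(ltW (oneDsq_gt0 _)) ?(ltW m0)//.
  have [s s0 ->] : exists2 s, 0 < s & tau = - s.
    by exists (- tau); rewrite ?opprK ?oppr_gt0.
  rewrite !powRN ler_pV2 ?inE ?unitfE ?gt_eqF ?powR_gt0 ?mulr_gt0 ?oneDsq_gt0//.
  apply: ge0_ler_powR; rewrite ?nnegrE ?(ltW s0) ?(ltW (oneDsq_gt0 _)) ?mulr_ge0 ?(ltW m0) ?(ltW (oneDsq_gt0 _))//.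
  rewrite mulrDr mulr1 exprMn lerD//; first by rewrite ge_min lexx.
  by rewrite ler_wpM2r ?sqr_ge0// ge_min lexx orbT.
Qed.

(** Recovers the product form of the Cauchy-Schwarz inequality from the
    additive one, which is preserved by sums and integrals; the choice t = X /
    A gives it unless A = 0, where a large t shows that X = 0. *)
Lemma amgm_cs (X A B : R) : 0 <= A -> 0 <= B -> 0 <= X ->
  (forall t, 0 < t -> 2 * X <= t * A + t^-1 * B) -> X ^+ 2 <= A * B.
Proof.
move=> A0 B0 X0 H; have [X00|X00] := leP X 0.
  by rewrite (_ : X = 0) ?expr0n ?mulr_ge0//; apply/eqP; rewrite eq_le X00.
have [A00|A00] := leP A 0.
  have AE : A = 0 by apply/eqP; rewrite eq_le A00.
  have B1 : 0 < B + 1 by rewrite ltr_wpDl.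
  have := H ((B + 1) / X) (divr_gt0 B1 X00); rewrite AE mulr0 add0r invf_div.
  have : X / (B + 1) * B <= X.
    by rewrite mulrAC ler_pdivrMr// ler_wpM2l// lerDl.
  move=> h1 h2; have := le_trans h2 h1; rewrite -subr_ge0.
  by rewrite (_ : X - 2 * X = - X); [rewrite oppr_ge0 leNgt X00|ring].
have := H (X / A) (divr_gt0 X00 A00); rewrite divfK ?gt_eqF// invf_div mulr2n mulrDl mul1r lerD2l.
by rewrite mulrAC ler_pdivlMr// expr2.
Qed.

Lemma sqr_sum_le (x y : R) : (x + y) ^+ 2 <= 2 * x ^+ 2 + 2 * y ^+ 2.
Proof. by have := sqr_ge0 (x - y); rewrite !expr2; lra. Qed.

(** [r2] and [q2] are the real weighted space L^2 of (1 + x^2)^tau dx and its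
    squared norm. *)
Definition r2 tau a := measurable_fun setT a /\ intg (fun x => a x ^+ 2 * wt tau x).
Definition q2 tau a := rint (fun x => a x ^+ 2 * wt tau x).

Lemma sqw_ge0 tau (y x : R) : 0 <= y ^+ 2 * wt tau x.
Proof. exact: mulr_ge0 (sqr_ge0 _) (wt_ge0 _ _). Qed.

Lemma q2_ge0 tau a : 0 <= q2 tau a.
Proof. by apply: rint_ge0 => x; rewrite mulr_ge0 ?sqr_ge0 ?wt_ge0. Qed.

Lemma r2_meas_sq tau a : measurable_fun setT a ->
  measurable_fun setT (fun x => a x ^+ 2 * wt tau x).
Proof. by move=> ma; apply: measurable_funM; [exact: measurable_funX|exact: wt_meas]. Qed.

Lemma r2_bounded_supp tau a (B M : R) : measurable_fun setT a ->
  (forall x, `|a x| <= B) -> (forall x, M < `|x| -> a x = 0) -> r2 tau a.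
Proof.
move=> ma aB aM; split => //.
apply: (@intg_bounded_supp _ _ (B ^+ 2 * (1 + M ^+ 2) `^ `|tau|) M).
- exact: r2_meas_sq.
- move=> x; rewrite normrM normrX (ger0_norm (wt_ge0 _ _)).
  have [xM|/aM ->] := leP `|x| M.
    rewrite ler_pM ?sqr_ge0 ?wt_ge0 ?wt_bounded//.
    by rewrite lerXn2r ?nnegrE// (le_trans _ (aB x)).
  by rewrite normr0 expr0n mul0r mulr_ge0 ?sqr_ge0 ?powR_ge0.
- by move=> x /aM ->; rewrite expr0n mul0r.
Qed.

Lemma r2_test tau a : rtest a -> r2 tau a.
Proof.
move=> ta; have [B _ aB] := rtest_bounded ta; have [_ [M aM]] := ta.
exact: r2_bounded_supp (rtest_meas ta) aB aM.
Qed.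

Lemma r2Z tau (c : R) a : r2 tau a -> r2 tau (fun x => c * a x).
Proof.
move=> [ma ia]; split; first exact: measurable_funM.
by under eq_fun do rewrite exprMn -mulrA; exact: intgZ.
Qed.

Lemma q2Z tau (c : R) a : r2 tau a -> q2 tau (fun x => c * a x) = c ^+ 2 * q2 tau a.
Proof.
move=> [ma ia]; rewrite /q2 -rintZ//; congr rint.
by apply/funext => x; rewrite exprMn mulrA.
Qed.

Lemma r2_le tau a b : measurable_fun setT a -> r2 tau b ->
  (forall x, `|a x| <= `|b x|) -> r2 tau a /\ q2 tau a <= q2 tau b.
Proof.
move=> ma [mb ib] ab.
have H x : a x ^+ 2 * wt tau x <= b x ^+ 2 * wt tau x.
  rewrite ler_wpM2r ?wt_ge0// -(real_normK (num_real (a x))) -(real_normK (num_real (b x))).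
  by rewrite lerXn2r ?nnegrE.
have ra : r2 tau a.
  split => //; apply: (intg_le (r2_meas_sq _ ma) ib) => x.
  by rewrite ger0_norm// mulr_ge0 ?sqr_ge0 ?wt_ge0.
by split => //; apply: rint_le => //; case: ra.
Qed.

Lemma r2D tau a b : r2 tau a -> r2 tau b ->
  r2 tau (fun x => a x + b x) /\
  q2 tau (fun x => a x + b x) <= 2 * q2 tau a + 2 * q2 tau b.
Proof.
move=> [ma ia] [mb ib].
have ii : intg (fun x => 2 * (a x ^+ 2 * wt tau x) + 2 * (b x ^+ 2 * wt tau x)).
  by apply: intgD; exact: intgZ.
have H x : (a x + b x) ^+ 2 * wt tau x <= 2 * (a x ^+ 2 * wt tau x) + 2 * (b x ^+ 2 * wt tau x).
  have := sqr_sum_le (a x) (b x).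
  by rewrite -(ler_pM2r (wt_gt0 tau x)) mulrDl -!mulrA.
have iab : intg (fun x => (a x + b x) ^+ 2 * wt tau x).
  apply: (intg_le _ ii); first by apply: r2_meas_sq; exact: measurable_funD.
  by move=> x; rewrite ger0_norm// mulr_ge0 ?sqr_ge0 ?wt_ge0.
split; first by split => //; exact: measurable_funD.
by rewrite /q2 -!rintZ// -rintD; [exact: rint_le|exact: intgZ..].
Qed.

Lemma r2B tau a b : r2 tau a -> r2 tau b ->
  r2 tau (fun x => a x - b x) /\
  q2 tau (fun x => a x - b x) <= 2 * q2 tau a + 2 * q2 tau b.
Proof.
move=> ra rb; have rb' := r2Z (-1) rb.
have := r2D ra rb'; rewrite q2Z// sqrrN expr1n mul1r.
by under eq_fun do rewrite mulN1r.
Qed.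

(** Pointwise, 2|ab| <= t a^2 / w + t^-1 b^2 w; integrate and optimize in t. *)
Lemma r2_pair tau a b : r2 (- tau) a -> r2 tau b -> intg (fun x => a x * b x) /\
  (rint (fun x => `|a x * b x|)) ^+ 2 <= q2 (- tau) a * q2 tau b.
Proof.
move=> [ma ia] [mb ib].
have H (t : R) x : 0 < t -> `|a x * b x| * 2 <=
    t * (a x ^+ 2 * wt (- tau) x) + t^-1 * (b x ^+ 2 * wt tau x).
  move=> t0; have w0 := wt_gt0 tau x; have wn : wt (- tau) x = (wt tau x)^-1.
    by rewrite /wt powRN.
  rewrite wn normrM.
  have -> : a x ^+ 2 = `|a x| ^+ 2 by rewrite real_normK ?num_real.
  have -> : b x ^+ 2 = `|b x| ^+ 2 by rewrite real_normK ?num_real.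
  have tw : 0 < t / wt tau x by rewrite divr_gt0.
  set A := `|a x|; set B := `|b x|.
  have -> : t * (A ^+ 2 / wt tau x) + t^-1 * (B ^+ 2 * wt tau x) =
    A * B * 2 + (t / wt tau x) * (A - B * wt tau x / t) ^+ 2.
    by field; rewrite !gt_eqF.
  by rewrite lerDl mulr_ge0 ?sqr_ge0// ltW.
have iab : intg (fun x => a x * b x).
  apply: (intg_le _ (intgD (intgZ 1 ia) (intgZ 1^-1 ib))); first exact: measurable_funM.
  by move=> x; have := H 1 x ltr01; rewrite mulr_natr mulr2n; apply: le_trans; rewrite lerDl.
split => //; apply: amgm_cs; rewrite ?q2_ge0 ?rint_ge0// => t t0.
rewrite /q2 -!rintZ//; last exact: intg_abs.
rewrite -rintD; [|exact: intgZ..].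
apply: rint_le; [by apply: intgZ; exact: intg_abs|by apply: intgD; exact: intgZ|].
by move=> x; rewrite mulrC H.
Qed.

End Weight.

(** * Density of test functions *)

Section Density.
Context {R : realType}.
Implicit Types (a b f g : R -> R) (tau : R).
Local Notation mu := (@lebesgue_measure R).

Lemma rint_oneDsqrV : intg (fun x : R => (1 + x ^+ 2)^-1) /\
  rint (fun x : R => (1 + x ^+ 2)^-1) = pi.
Proof.
have E : (\int[mu]_x ((1 + x ^+ 2)^-1)%:E = pi%:E)%E.
  rewrite (@ge0_symfun_integralT R (fun x => (1 + x ^+ 2)^-1)).
  - rewrite -set_itvcy integral0y_oneDsqr -EFinM; congr EFin.
    by rewrite mulrC divfK.
  - by move=> x; rewrite invr_ge0 ltW ?oneDsq_gt0.
  - exact: continuous_oneDsqrV.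
  - by move=> x /=; rewrite sqrrN.
split; last by rewrite /rint /Rintegral E.
apply/intg_ge0P; last by rewrite E ltry.
- by apply: continuous_measurable_fun; exact: continuous_oneDsqrV.
- by move=> x; rewrite invr_ge0 ltW ?oneDsq_gt0.
Qed.

Lemma intg_wtN1 : intg (@wt R (-1)).
Proof.
have [H _] := rint_oneDsqrV.
rewrite (_ : wt (-1) = fun x => (1 + x ^+ 2)^-1)//; apply/funext => x.
by rewrite /wt powR_inv1// ltW// oneDsq_gt0.
Qed.

(** Truncation in range and in domain: the result is bounded with bounded
    support and never exceeds the original function, so that dominated
    convergence applies. *)
Definition cut (n : nat) a : R -> R :=
  fun x => if (`|a x| <= n%:R) && (`|x| <= n%:R) then a x else 0.

Lemma cut_meas n a : measurable_fun setT a -> measurable_fun setT (cut n a).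
Proof.
move=> ma; apply: measurable_fun_ifT => //.
apply: measurable_and; apply: measurable_fun_ler => //; exact: measurableT_comp.
Qed.

Lemma cut_le n a x : `|cut n a x| <= n%:R.
Proof. by rewrite /cut; case: ifPn => [/andP[]//|_]; rewrite normr0. Qed.

Lemma cut_abs_le n a x : `|cut n a x| <= `|a x|.
Proof. by rewrite /cut; case: ifPn => // _; rewrite normr0. Qed.

Lemma cut_supp n a x : n%:R < `|x| -> cut n a x = 0.
Proof. by rewrite /cut ltNge => /negbTE ->; rewrite andbF. Qed.

Lemma cut_cvg a x : cut n a x @[n --> \oo] --> a x.
Proof.
apply: cvg_near_cst; near=> n.
rewrite /cut ifT//; apply/andP; split; near: n; exact: nbhs_infty_ger.
Unshelve. all: end_near. Qed.

Lemma q2_dct tau (u : nat -> R -> R) f g : (forall n, measurable_fun setT (u n)) ->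
  (forall x, u n x @[n --> \oo] --> f x) -> r2 tau g ->
  (forall n x, `|u n x| <= `|g x|) -> measurable_fun setT f ->
  q2 tau (fun x => f x - u n x) @[n --> \oo] --> 0.
Proof.
move=> mu_ uf [mg ig] ug mf.
have fg x : `|f x| <= `|g x|.
  have /cvg_norm fx := uf x.
  by apply: (ler_cvg_to fx (cvg_cst `|g x|)); exact: nearW.
rewrite -[X in _ --> X](@rint0 R).
apply: (proj2 (@rint_dct R _ _ (fun x => 4 * (g x ^+ 2 * wt tau x)) _ _ _ _)).
- by move=> n; apply: r2_meas_sq; exact: measurable_funB.
- move=> x; rewrite -[X in _ --> X](mul0r (wt tau x)); apply: cvgMl.
  have h : f x - u n x @[n --> \oo] --> 0.
    by rewrite -[X in _ --> X](subrr (f x)); apply: cvgB; [exact: cvg_cst|exact: uf].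
  by rewrite -[X in _ --> X](mul0r 0); under eq_fun do rewrite expr2; exact: cvgM.
- exact: intgZ.
- move=> n x; rewrite (ger0_norm (sqw_ge0 _ _ _)).
  rewrite mulrA ler_wpM2r ?wt_ge0//.
  rewrite -(real_normK (num_real (f x - _))) -(real_normK (num_real (g x))).
  have -> : 4 * `|g x| ^+ 2 = (2 * `|g x|) ^+ 2 by ring.
  rewrite lerXn2r ?nnegrE ?mulr_ge0// (le_trans (ler_normB _ _))//.
  by rewrite mulr2n mulrDl mul1r lerD.
Qed.

Definition approx tau a := r2 tau a /\
  forall e, 0 < e -> exists2 g, rtest g & q2 tau (fun x => a x - g x) <= e.

Lemma approx_trans tau a : r2 tau a ->
  (forall e, 0 < e -> exists2 b, approx tau b & q2 tau (fun x => a x - b x) <= e) ->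
  approx tau a.
Proof.
move=> ra H; split => // e e0.
have [b [rb Hb] qb] := H (e / 4) ltac:(by rewrite divr_gt0).
have [g tg qg] := Hb (e / 4) ltac:(by rewrite divr_gt0).
exists g => //.
have [r1 _] := r2B ra rb; have [r3 _] := r2B rb (r2_test tau tg).
have [_] := r2D r1 r3.
under eq_fun do rewrite subrKA.
move/le_trans; apply; lra.
Qed.

(** Approximability by test functions is closed under linear combinations and
    dominated limits, so the class generated by test functions consists of
    approximable functions. *)
Lemma approx_bounded tau a (B M : R) : measurable_fun setT a ->
  (forall x, `|a x| <= B) -> (forall x, M < `|x| -> a x = 0) -> approx tau a.
Proof.
move: a B M; apply: test_class.
- move=> a ta; split; first exact: r2_test.
  move=> e e0; exists a => //; rewrite /q2.
  by under eq_fun do rewrite subrr expr0n mul0r; rewrite rint0 ltW.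
- move=> c f g [rf Hf] [rg Hg]; split; first by case: (r2D rf (r2Z c rg)).
  move=> e e0.
  have [f0 tf qf] := Hf (e / 4) ltac:(by rewrite divr_gt0).
  have c1 : 0 < c ^+ 2 + 1 by rewrite ltr_wpDl ?sqr_ge0.
  have [g0 tg qg] := Hg (e / (4 * (c ^+ 2 + 1))) ltac:(by rewrite divr_gt0 ?mulr_gt0).
  exists (fun x => f0 x + c * g0 x); first by apply: rtestD => //; exact: rtestZ.
  have [r1 _] := r2B rf (r2_test tau tf); have [r3 _] := r2B rg (r2_test tau tg).
  have [_] := r2D r1 (r2Z c r3).
  have -> : (fun x => f x - f0 x + c * (g x - g0 x)) = fun x => f x + c * g x - (f0 x + c * g0 x).
    by apply/funext => x; ring.
  move/le_trans; apply; rewrite q2Z//.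
  have : c ^+ 2 * q2 tau (fun x => g x - g0 x) <= e / 4.
    apply: (@le_trans _ _ ((c ^+ 2 + 1) * (e / (4 * (c ^+ 2 + 1))))).
      by rewrite ler_pM ?sqr_ge0 ?q2_ge0// lerDl.
    by rewrite le_eqVlt; apply/orP; left; apply/eqP; field; rewrite gt_eqF.
  by move: qf; lra.
- move=> u f M B Vu mu_ uB uM uf.
  have mf : measurable_fun setT f.
    by apply: (measurable_fun_cvg (h := u)) => [n|x _]; [exact: mu_|exact: uf].
  pose g : R -> R := fun x => B * \1_(`[- M, M]%classic : set R) x.
  have mg : measurable_fun setT g.
    by apply: measurable_funM => //; exact: measurable_indic.
  have ug n x : `|u n x| <= `|g x|.
    rewrite /g; have [xM|/uM ->] := leP `|x| M; last by rewrite normr0.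
    by rewrite indicE mem_set/= ?in_itv/= -?ler_norml// mulr1 (le_trans (uB n x))// ler_norm.
  have rg : r2 tau g.
    apply: (@r2_bounded_supp _ _ _ `|B| M) => //.
    + move=> x; rewrite /g normrM indicE normr_nat; case: (_ \in _); rewrite ?mulr1// mulr0 //.
    + move=> x xM; rewrite /g indicE memNset ?mulr0// /= in_itv/= -ler_norml.
      by apply/negP; rewrite -ltNge.
  have rf : r2 tau f.
    have fg x : `|f x| <= `|g x|.
      have /cvg_norm fx := uf x.
      by apply: (ler_cvg_to fx (cvg_cst `|g x|)); exact: nearW.
    by case: (r2_le mf rg fg).
  apply: approx_trans => // e e0.
  have /cvgrPdist_le/(_ _ e0)[N _ HN] := q2_dct mu_ uf rg ug mf.
  exists (u N) => //; have := HN N (leqnn N).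
  by rewrite sub0r normrN; apply: le_trans; exact: ler_norm.
Qed.

Lemma r2_approx tau a : r2 tau a -> approx tau a.
Proof.
move=> ra; have [ma _] := ra; apply: approx_trans => // e e0.
have cm n : measurable_fun setT (cut n a) by exact: cut_meas.
have /cvgrPdist_le/(_ _ e0)[N _ HN] := q2_dct cm (@cut_cvg a) ra (fun n => cut_abs_le n a) ma.
exists (cut N a).
  exact: (@approx_bounded _ _ N%:R N%:R (cut_meas _ ma) (cut_le _ _) (@cut_supp _ _)).
by have := HN N (leqnn N); rewrite sub0r normrN; apply: le_trans; exact: ler_norm.
Qed.

(** Local integrability on compact sets, tested on the intervals [-M, M] only. *)
Definition locintg a := measurable_fun setT a /\
  forall M : R, intg (fun x => a x * \1_(`[- M, M]%classic : set R) x).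

Lemma locintgP a : locally_integrable setT a <-> locintg a.
Proof.
have E (M : R) : (\int[mu]_(x in `[(- M)%R, M]) `|a x|%:E =
    \int[mu]_x (`|(EFin \o (fun x => a x * \1_(`[- M, M]%classic : set R) x)%R) x|))%E.
  rewrite integral_mkcond; apply: eq_integral => x _.
  rewrite patchE /= indicE; case: ifPn => _; first by rewrite mulr1.
  by rewrite mulr0 normr0.
split=> [[ma _ H]|[ma H]].
  split=> // M; apply/integrableP; split.
    apply/measurable_EFinP; apply: measurable_funM => //; exact: measurable_indic.
  rewrite -E; apply: H => //; exact: segment_compact.
split => //; first exact: openT.
move=> K _ cK; have [M [_ HM]] := compact_bounded cK.
have KM : K `<=` `[- (M + 1), M + 1]%classic.
  move=> x Kx; rewrite /= in_itv/= -ler_norml.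
  by apply: (HM (M + 1)); rewrite ?ltrDl.
have /integrableP[_] := H (M + 1); rewrite -E; apply: le_lt_trans.
apply: ge0_subset_integral => //.
- by apply: closed_measurable; exact: compact_closed cK.
- by apply/measurable_EFinP/measurable_funTS; exact: measurableT_comp.
Qed.

Lemma locintg_mul_bounded a (u : R -> R) (B M : R) : locintg a -> measurable_fun setT u ->
  (forall x, `|u x| <= B) -> (forall x, M < `|x| -> u x = 0) ->
  intg (fun x => a x * u x).
Proof.
move=> [ma ia] mu_ uB uM.
apply: (intg_le _ (intgZ B (intg_abs (ia M)))); first exact: measurable_funM.
move=> x; rewrite !normrM; have [xM|/uM ->] := leP `|x| M.
  rewrite indicE mem_set/= ?in_itv/= -?ler_norml// normr1 mulr1 mulrC.
  by rewrite ler_wpM2r.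
have B0 : 0 <= B by rewrite (le_trans _ (uB 0)).
by rewrite normr0 mulr0 !mulr_ge0.
Qed.

(** The identity extends from test functions to bounded measurable functions
    of bounded support, in particular to the truncated sign of a, which yields
    that |a| has integral zero. *)
Lemma fundamental_lemma a : locintg a ->
  (forall g, rtest g -> rint (fun x => a x * g x) = 0) -> aeq a (fun=> 0).
Proof.
move=> la H; have [ma ia] := la.
have Z : forall (u : R -> R) (B M : R), measurable_fun setT u ->
  (forall x, `|u x| <= B) -> (forall x, M < `|x| -> u x = 0) ->
  intg (fun x => a x * u x) /\ rint (fun x => a x * u x) = 0.
  apply: (@test_class R (fun u => intg (fun x => a x * u x) /\ rint (fun x => a x * u x) = 0)).
  - move=> g tg; split; last exact: H.
    have [B _ gB] := rtest_bounded tg; have [_ [M gM]] := tg.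
    exact: locintg_mul_bounded la (rtest_meas tg) gB gM.
  - move=> c f g [i1 r1] [i2 r3].
    have E : (fun x => a x * (f x + c * g x)) = fun x => a x * f x + c * (a x * g x).
      by apply/funext => x; ring.
    rewrite E; split; first by apply: intgD => //; exact: intgZ.
    by rewrite rintD ?rintZ ?r1 ?r3 ?mulr0 ?addr0//; exact: intgZ.
  - move=> u f M B Vu mu_ uB uM uf.
    pose G x := B * `|a x * \1_(`[- M, M]%classic : set R) x|.
    have [||||i1 c1] := @rint_dct R (fun n x => a x * u n x) (fun x => a x * f x) G.
    + by move=> n; exact: measurable_funM.
    + by move=> x; apply: cvgMr; exact: uf.
    + by apply: intgZ; apply: intg_abs.
    + move=> n x; rewrite /G !normrM; have [xM|/uM ->] := leP `|x| M.
        rewrite indicE mem_set/= ?in_itv/= -?ler_norml// normr1 mulr1 mulrC.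
        by rewrite ler_wpM2r.
      have B0 : 0 <= B by rewrite (le_trans _ (uB 0%N 0)).
      by rewrite normr0 mulr0 !mulr_ge0.
    split=> //; have E : (fun n => rint (fun x => a x * u n x)) = fun=> 0.
      by apply/funext => n; exact: (Vu n).2.
    by move: c1; rewrite E => /(cvg_lim (@Rhausdorff R)) <-; rewrite lim_cst.
pose u (n : nat) x := Num.sg (a x) * \1_(`[- n%:R, n%:R]%classic : set R) x.
have au n x : a x * u n x = `|a x| * \1_(`[- n%:R, n%:R]%classic : set R) x.
  by rewrite /u mulrA; congr (_ * _); rewrite normrEsg mulrC.
have mu_ n : measurable_fun setT (u n).
  apply: measurable_funM; last exact: measurable_indic.
  have -> : (fun x => Num.sg (a x)) = (fun x => if a x == 0 then 0 else if a x < 0 then -1 else 1) :> (R -> R).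
    by apply/funext => x; rewrite /Num.sg.
  apply: measurable_fun_ifT => //; first by apply: measurable_fun_eqr.
  by apply: measurable_fun_ifT => //; apply: measurable_fun_ltr.
have uZ n : intg (fun x => a x * u n x) /\ rint (fun x => a x * u n x) = 0.
  apply: (Z _ 1 n%:R) => //.
  - move=> x; rewrite /u normrM normr_sg indicE normr_nat.
    by case: (_ \in _); case: (_ != 0); rewrite ?mulr0 ?mulr1 ?mul0r.
  - move=> x xM; rewrite /u indicE memNset ?mulr0// /= in_itv/= -ler_norml.
    by apply/negP; rewrite -ltNge.
have [iabs r0] : intg (fun x => `|a x|) /\ rint (fun x => `|a x|) <= 0.
  apply: (@rint_mono R (fun n x => a x * u n x)).
  - by move=> n; case: (uZ n).
  - by move=> n x; rewrite au mulr_ge0.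
  - move=> x m n mn; rewrite !au ler_wpM2l// !indicE.
    have [xm|xm] := leP `|x| m%:R; last first.
      by rewrite memNset//= in_itv/= -ler_norml; apply/negP; rewrite -ltNge.
    rewrite !mem_set//= in_itv/= -ler_norml//.
    by rewrite (le_trans xm)// ler_nat.
  - move=> x; apply: cvg_near_cst; near=> n.
    rewrite au indicE mem_set ?mulr1// /= in_itv/= -ler_norml.
    near: n; exact: nbhs_infty_ger.
  - by move=> n; rewrite (uZ n).2.
have := rint_eq0 iabs (fun x => normr_ge0 _).
move=> /(_ ltac:(by apply/eqP; rewrite eq_le r0 rint_ge0)).
by apply: aeS => x /eqP; rewrite normr_eq0 => /eqP.
Unshelve. all: end_near. Qed.

End Density.

(** * Riesz representation in the real weighted spaces *)

Section Riesz.
Context {R : realType}.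
Implicit Types (a b f g : R -> R).
Local Notation mu := (@lebesgue_measure R).
Variables (tau K : R) (L : (R -> R) -> R).
Hypothesis K0 : 0 <= K.
Hypothesis Llin : forall (c : R) f g, rtest f -> rtest g ->
  L (fun x => f x + c * g x) = L f + c * L g.
Hypothesis Lbnd : forall g, rtest g -> (L g) ^+ 2 <= K * q2 tau g.

Let rad a g : R := 2 * Num.sqrt (K * q2 tau (fun x => a x - g x)).

Let rad_ge0 a g : 0 <= rad a g.
Proof. by rewrite mulr_ge0// sqrtr_ge0. Qed.

Let rad_sq a g : rad a g ^+ 2 = 4 * K * q2 tau (fun x => a x - g x).
Proof.
by rewrite exprMn sqr_sqrtr ?mulr_ge0 ?q2_ge0// -natrX mulrA.
Qed.

(** The extension of L to the weighted space by density. Every test function g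
    confines the value at a to an interval centred at L g, of a radius
    proportional to the distance from a to g; these intervals meet pairwise,
    so the supremum of their lower ends lies in all of them. This avoids
    choosing approximating sequences. *)
Definition extend a : R := sup [set y | exists2 g, rtest g & y = L g - rad a g].

Let Lsub f g : rtest f -> rtest g -> L f - L g = L (fun x => f x - g x).
Proof.
move=> tf tg; rewrite -mulN1r -Llin//; congr L.
by apply/funext => x; rewrite mulN1r.
Qed.

Let L_rad a f g : r2 tau a -> rtest f -> rtest g ->
  L f - rad a f <= L g + rad a g.
Proof.
move=> ra tf tg; suff : L f - L g <= rad a f + rad a g by lra.
apply: le_trans (ler_norm _) _.
rewrite -ler_sqr ?nnegrE ?addr_ge0 ?rad_ge0// real_normK ?num_real// Lsub//.
apply: le_trans (Lbnd (rtestB tf tg)) _.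
have [r1 _] := r2B ra (r2_test tau tf); have [r3 _] := r2B ra (r2_test tau tg).
have [_] := r2B r3 r1.
have -> : (fun x => a x - g x - (a x - f x)) = fun x => f x - g x by apply/funext => x; ring.
move=> H; apply: le_trans (ler_wpM2l K0 H) _.
rewrite sqrrD !rad_sq.
have : 0 <= rad a f * rad a g by rewrite mulr_ge0.
have : 0 <= K * q2 tau (fun x => a x - f x) by rewrite mulr_ge0 ?q2_ge0.
have : 0 <= K * q2 tau (fun x => a x - g x) by rewrite mulr_ge0 ?q2_ge0.
lra.
Qed.

Lemma extendP a g : r2 tau a -> rtest g ->
  (extend a - L g) ^+ 2 <= 4 * K * q2 tau (fun x => a x - g x).
Proof.
move=> ra tg; rewrite -rad_sq -(real_normK (num_real _)) lerXn2r ?nnegrE ?rad_ge0//.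
have S0 : [set y | exists2 g, rtest g & y = L g - rad a g] (L g - rad a g) by exists g.
have Su : has_ubound [set y | exists2 g, rtest g & y = L g - rad a g].
  by exists (L g + rad a g) => _ [f tf ->]; exact: L_rad.
rewrite ler_norml; apply/andP; split.
  rewrite lerBrDr addrC; apply: ub_le_sup => //.
rewrite lerBlDr addrC; apply: ge_sup; first by exists (L g - rad a g).
by move=> _ [f tf ->]; exact: L_rad.
Qed.

Let q2_0 : q2 tau (fun=> 0) = 0.
Proof. by rewrite -[RHS](@rint0 R) /q2; congr rint; apply/funext => x; rewrite expr0n mul0r. Qed.

Let L0 : L (fun=> 0) = 0.
Proof.
by have := Lbnd rtest0; rewrite q2_0 mulr0 => H; apply/eqP; rewrite -sqrf_eq0 eq_le H sqr_ge0.
Qed.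

Lemma extend_bound a : r2 tau a -> (extend a) ^+ 2 <= 4 * K * q2 tau a.
Proof.
move=> ra; have := extendP ra rtest0.
by rewrite L0 subr0; under [in q2 _ _]eq_fun do rewrite subr0.
Qed.

Lemma extend_test g : rtest g -> extend g = L g.
Proof.
move=> tg; have := extendP (r2_test tau tg) tg.
under [in q2 _ _]eq_fun do rewrite subrr.
rewrite q2_0 mulr0 => H; apply/eqP; rewrite -subr_eq0 -sqrf_eq0.
by rewrite eq_le H sqr_ge0.
Qed.

(** All three values are approximated by L on test functions close to a and b,
    where linearity holds; the error is at most e for every e > 0. *)
Lemma extend_lin (c : R) a b : r2 tau a -> r2 tau b ->
  extend (fun x => a x + c * b x) = extend a + c * extend b.
Proof.
move=> ra rb; apply/eqP; rewrite -subr_eq0 -sqrf_eq0 eq_le sqr_ge0 andbT.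
apply/ler_addgt0Pr => e e0; rewrite add0r.
have [_ Ha] := r2_approx ra; have [_ Hb] := r2_approx rb.
pose D := 64 * (K + 1) * (c ^+ 2 + 1).
have D0 : 0 < D by rewrite !mulr_gt0 ?ltr_wpDl ?sqr_ge0.
have [f tf qf] := Ha (e / D) ltac:(by rewrite divr_gt0).
have [g tg qg] := Hb (e / D) ltac:(by rewrite divr_gt0).
have [r1 _] := r2B ra (r2_test tau tf); have [r3 _] := r2B rb (r2_test tau tg).
have [rab _] := r2D ra (r2Z c rb).
have tfg : rtest (fun x => f x + c * g x) by apply: rtestD => //; exact: rtestZ.
have := extendP ra tf; have := extendP rb tg; have := extendP rab tfg.
rewrite Llin//.
have [_] := r2D r1 (r2Z c r3); rewrite q2Z//.
have -> : (fun x => a x - f x + c * (b x - g x)) = fun x => a x + c * b x - (f x + c * g x).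
  by apply/funext => x; ring.
set Q := q2 tau (fun x => _ - (_ + _)) => HQ.
set X := extend (fun x => _); set A := extend a; set B := extend b.
move=> HX HB HA.
have -> : X - (A + c * B) = (X - (L f + c * L g)) + (- (A - L f) + - c * (B - L g)) by ring.
apply: le_trans (sqr_sum_le _ _) _.
have H2 := sqr_sum_le (- (A - L f)) (- c * (B - L g)).
apply: le_trans (lerD (ler_wpM2l _ HX) (ler_wpM2l _ H2)) _ => //.
rewrite sqrrN exprMn sqrrN.
have c0 := sqr_ge0 c.
have h1 : c ^+ 2 * (B - L g) ^+ 2 <= c ^+ 2 * (4 * K * (e / D)).
  by rewrite ler_wpM2l// (le_trans HB)// ler_wpM2l// mulr_ge0.
have h2 : (A - L f) ^+ 2 <= 4 * K * (e / D).
  by rewrite (le_trans HA)// ler_wpM2l// mulr_ge0.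
have h3 : Q <= 2 * (e / D) + 2 * (c ^+ 2 * (e / D)).
  apply: le_trans HQ _; apply: lerD; rewrite ler_wpM2l//.
  by rewrite ler_wpM2l.
have h4 : 4 * K * Q <= 4 * K * (2 * (e / D) + 2 * (c ^+ 2 * (e / D))).
  by rewrite ler_wpM2l// mulr_ge0.
have e1 : e = 64 * (K + 1) * (c ^+ 2 + 1) * (e / D).
  by rewrite -/D mulrC divfK// gt_eqF.
have E0 : 0 <= e / D by rewrite divr_ge0// ltW.
rewrite [X in _ <= X]e1.
have p1 : 0 <= K * (e / D) by rewrite mulr_ge0.
have p2 : 0 <= c ^+ 2 * (e / D) by rewrite mulr_ge0.
have p3 : 0 <= K * (c ^+ 2 * (e / D)) by rewrite mulr_ge0.
move: h1 h2 h4 p1 p2 p3 E0 => {HX HB HA HQ H2 h3 e1}.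
set E := e / D; set C := c ^+ 2; set S := (A - L f) ^+ 2.
set T := (B - L g) ^+ 2; rewrite -/T.
move=> h1 h2 h4 p1 p2 p3 E0.
have -> : 64 * (K + 1) * (C + 1) * E = 64 * (K * (C * E)) + 64 * (K * E) + 64 * (C * E) + 64 * E by ring.
have h1' : C * T <= 4 * (K * (C * E)) by rewrite (le_trans h1)// le_eqVlt; apply/orP; left; apply/eqP; ring.
have h4' : 4 * K * Q <= 8 * (K * E) + 8 * (K * (C * E)).
  by rewrite (le_trans h4)// le_eqVlt; apply/orP; left; apply/eqP; ring.
have h2' : S <= 4 * (K * E) by rewrite (le_trans h2)// le_eqVlt; apply/orP; left; apply/eqP; ring.
lra.
Qed.

Lemma extend_cvg (u : nat -> R -> R) f : (forall n, r2 tau (u n)) -> r2 tau f ->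
  q2 tau (fun x => f x - u n x) @[n --> \oo] --> 0 -> extend (u n) @[n --> \oo] --> extend f.
Proof.
move=> ru rf qu; apply/cvgrPdist_le => e e0.
have E0 : 0 < e ^+ 2 / (4 * K + 1) by rewrite divr_gt0 ?exprn_gt0// ltr_wpDl// mulr_ge0.
move/cvgrPdist_le : qu => /(_ _ E0); apply: filterS => n.
rewrite sub0r normrN ger0_norm ?q2_ge0// => H.
have [rfu _] := r2B rf (ru n).
have -> : extend f - extend (u n) = extend (fun x => f x - u n x).
  rewrite -mulN1r -(extend_lin (-1) rf (ru n)); congr extend.
  by apply/funext => x; rewrite mulN1r.
rewrite -ler_sqr ?nnegrE ?(ltW e0)// real_normK ?num_real//.
apply: le_trans (extend_bound rfu) _.
apply: (@le_trans _ _ (4 * K * (e ^+ 2 / (4 * K + 1)))).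
  by rewrite ler_wpM2l// mulr_ge0.
rewrite mulrCA ler_piMr ?exprn_ge0 ?(ltW e0)// ler_pdivrMr ?mul1r ?lerDl//.
by rewrite ltr_wpDl// mulr_ge0.
Qed.

(* The exponent makes v^2 wt tau = wt (-1) = 1 / (1 + x^2), which is integrable. *)
Let v := @wt R (- (tau + 1) / 2).

Let v_gt0 x : 0 < v x. Proof. exact: wt_gt0. Qed.

Let v_meas : measurable_fun setT v. Proof. exact: wt_meas. Qed.

Let v_r2 : r2 tau v.
Proof.
split => //; have -> : (fun x => v x ^+ 2 * wt tau x) = wt (-1).
  by apply/funext => x; rewrite expr2 /v !wtM; congr wt; field.
exact: intg_wtN1.
Qed.

Let vset_r2 (A : set R) : measurable A -> r2 tau (fun x => \1_A x * v x).
Proof.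
move=> mA; have mAv : measurable_fun setT (fun x => \1_A x * v x).
  by apply: measurable_funM => //; exact: measurable_indic.
have [] // := r2_le mAv v_r2.
move=> x; rewrite normrM ler_piMl// indicE normr_nat.
by case: (_ \in _).
Qed.

(** Lebesgue measure is infinite, so indicator functions of unbounded sets
    need not belong to the space; multiplication by the positive member v
    turns all of them into members, and makes the set function finite. *)
Definition riesz_charge (A : set (measurableTypeR R)) : \bar R :=
  (extend (fun x => \1_(A : set R) x * v x))%:E.

Let charge0 : riesz_charge set0 = 0%E.
Proof.
rewrite /riesz_charge; congr EFin.
have -> : (fun x => \1_(set0 : set R) x * v x) = fun=> 0.
  by apply/funext => x; rewrite indic0 mul0r.
by rewrite (extend_test rtest0).
Qed.

Let charge_fin (A : set (measurableTypeR R)) : measurable A -> riesz_charge A \is a fin_num.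
Proof. by []. Qed.

Let charge_sum (F : nat -> set R) n : (forall n, measurable (F n)) ->
  extend (fun x => (\sum_(0 <= i < n) \1_(F i) x) * v x) =
  \sum_(0 <= i < n) extend (fun x => \1_(F i) x * v x).
Proof.
move=> mF; elim: n => [|n IH].
  rewrite big_geq//; under eq_fun do rewrite big_geq// mul0r.
  by have := charge0; rewrite /riesz_charge; under eq_fun do rewrite indic0 mul0r; move=> [].
rewrite big_nat_recr//= -IH -[extend (fun x => \1_(F n) x * v x)]mul1r -extend_lin.
- by congr extend; apply/funext => x; rewrite big_nat_recr//= mul1r mulrDl.
- elim: n {IH} => [|n IH].
    by under eq_fun do rewrite big_geq// mul0r; exact: r2_test rtest0.
  under eq_fun do rewrite big_nat_recr//= mulrDl.
  by case: (r2D IH (vset_r2 (mF n))).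
- exact: vset_r2.
Qed.

Let charge_sigma : semi_sigma_additive riesz_charge.
Proof.
move=> F mF tF mUF; rewrite /riesz_charge.
have -> : (fun n => \sum_(0 <= i < n) (extend (fun x => \1_(F i : set R) x * v x))%:E)%E =
  (fun n => (extend (fun x => (\sum_(0 <= i < n) \1_(F i : set R) x) * v x))%:E).
  by apply/funext => n; rewrite sumEFin charge_sum.
apply: cvg_EFin; first exact: nearW.
have S01 n (x : R) : 0 <= (\sum_(0 <= i < n) \1_(F i : set R) x : R) <= 1.
  rewrite sumr_ge0//=.
  elim: n => [|n IH]; first by rewrite big_geq.
  rewrite big_nat_recr//=; have [Fnx|Fnx] := pselect ((F n : set R) x).
    rewrite big_nat big1 ?add0r ?indicE ?mem_set// => i /andP[_ ilt].
    rewrite indicE memNset// => Fix.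
    have := trivIsetP.1 tF i n Logic.I Logic.I; rewrite ltn_eqF// => /(_ isT).
    by move/seteqP => [/(_ x) + _]; apply.
  by rewrite [X in _ + X]indicE memNset ?addr0.
have mS n : measurable_fun setT (fun x : R => \sum_(0 <= i < n) \1_(F i : set R) x : R).
  apply: (@measurable_sum _ _ _ setT _ (index_iota 0 n) (fun i x => \1_(F i : set R) x)) => i.
  by apply: measurable_indic; exact: mF.
have Sv n x : `|(\sum_(0 <= i < n) \1_(F i : set R) x) * v x| <= `|v x|.
  by rewrite normrM ler_piMl//; have /andP[p q] := S01 n x; rewrite ger0_norm.
have mSv n : measurable_fun setT (fun x => (\sum_(0 <= i < n) \1_(F i : set R) x) * v x).
  exact: measurable_funM.
have rS n : r2 tau (fun x => (\sum_(0 <= i < n) \1_(F i : set R) x) * v x).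
  by case: (r2_le (mSv n) v_r2 (Sv n)).
apply: extend_cvg => //; first exact: vset_r2.
apply: (q2_dct _ _ v_r2) => //; last by case: (vset_r2 mUF).
move=> x; apply: cvgMl.
have [[k _ Fk]|nx] := pselect ((\bigcup_n F n : set R) x).
  rewrite indicE mem_set; last by exists k.
  apply: cvg_near_cst; exists k.+1 => // n /= kn.
  apply/eqP; rewrite eq_le; have /andP[_ ->] /= := S01 n x.
  rewrite (@bigD1_seq _ _ _ _ _ k)/= ?iota_uniq ?mem_index_iota//.
  by rewrite [X in _ <= X + _]indicE mem_set// lerDl sumr_ge0.
rewrite [in X in _ --> X]indicE memNset//.
under eq_fun => n.
  rewrite big1; last by move=> i _; rewrite indicE memNset// => Fi; apply: nx; exists i.
  over.
exact: cvg_cst.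
Qed.

HB.instance Definition _ := isCharge.Build _ _ _ riesz_charge
  charge0 charge_fin charge_sigma.

Let charge_dom : riesz_charge `<< mu.
Proof.
apply/null_content_dominatesP => A mA muA.
have rA := vset_r2 mA; have := extend_bound rA.
have -> : q2 tau (fun x => \1_(A : set R) x * v x) = 0.
  rewrite -(@rint0 R); apply: rint_aeq => //; first by apply: r2_meas_sq; case: rA.
  exists A; split => // x /=; apply: contra_notP => nA.
  by rewrite indicE memNset// mul0r expr0n mul0r.
rewrite mulr0 => H; congr EFin; apply/eqP.
by rewrite -sqrf_eq0 eq_le H sqr_ge0.
Qed.

(** Riesz representation. The density G of the charge with respect to Lebesgue
    measure represents L on v times bounded functions of bounded support, so a
    = G / v represents L on test functions. Applying the bound on L to
    truncations of a wt(-tau), the would-be Riesz dual of a, bounds the norm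
    of a by monotone convergence. *)
Theorem riesz_real : exists a,
  r2 (- tau) a /\ forall g, rtest g -> L g = rint (fun x => a x * g x).
Proof.
pose G0 := Radon_Nikodym riesz_charge mu.
pose G : R -> R := fun x => fine (G0 x).
have iG0 : mu.-integrable setT G0 by exact: Radon_Nikodym_integrable.
have G0E x : G0 x = (G x)%:E by rewrite fineK//; exact: Radon_Nikodym_fin_num.
have iG : intg G by apply: eq_integrable iG0.
have mG := intg_meas iG.
have iGB (u : R -> R) (B : R) : measurable_fun setT u -> (forall x, `|u x| <= B) ->
    intg (fun x => G x * u x).
  move=> mu_ uB; apply: (intg_le _ (intgZ B (intg_abs iG))).
    exact: measurable_funM.
  by move=> x; rewrite normrM mulrC ler_wpM2r.
have nuE (A : set R) : measurable A ->
    extend (fun x => \1_A x * v x) = rint (fun x => G x * \1_A x).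
  move=> mA; apply: EFin_inj.
  rewrite -[LHS]/(riesz_charge A) (Radon_Nikodym_integral charge_dom)//.
  rewrite integral_mkcond -integral_EFin.
    apply: eq_integral => x _; rewrite patchE indicE.
    by case: ifPn => _; rewrite ?mulr1 ?mulr0// -G0E.
  apply: (iGB _ 1); first exact: measurable_indic.
  by move=> x; rewrite indicE normr_nat; case: (_ \in _).
have Z : forall (u : R -> R) (B M : R), measurable_fun setT u ->
    (forall x, `|u x| <= B) -> (forall x, M < `|x| -> u x = 0) ->
    [/\ r2 tau (fun x => u x * v x), intg (fun x => G x * u x) &
        extend (fun x => u x * v x) = rint (fun x => G x * u x)].
  apply: (@indicator_class R (fun u => [/\ r2 tau (fun x => u x * v x),
     intg (fun x => G x * u x) & extend (fun x => u x * v x) = rint (fun x => G x * u x)])).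
  - move=> M A mA; have mAI : measurable (A `&` `]- M, M[%classic : set R).
      by apply: measurableI => //; exact: measurable_itv.
    split; [exact: vset_r2| |exact: nuE].
    apply: (iGB _ 1); first exact: measurable_indic.
    by move=> x; rewrite indicE normr_nat; case: (_ \in _).
  - move=> c f g [r1 i1 e1] [r3 i3 e3].
    have -> : (fun x => (f x + c * g x) * v x) = fun x => f x * v x + c * (g x * v x).
      by apply/funext => x; ring.
    have -> : (fun x => G x * (f x + c * g x)) = fun x => G x * f x + c * (G x * g x).
      by apply/funext => x; ring.
    split; first by case: (r2D r1 (r2Z c r3)).
    - by apply: intgD => //; exact: intgZ.
    - by rewrite extend_lin// rintD ?rintZ ?e1 ?e3//; exact: intgZ.
  - move=> u f M B Vu mu_ uB uM uf.
    have mf : measurable_fun setT f.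
      by apply: (measurable_fun_cvg (h := u)) => [n|x _]; [exact: mu_|exact: uf].
    have B0 : 0 <= B by rewrite (le_trans _ (uB 0%N 0)).
    have [|||| i1 c1] := @rint_dct R (fun n x => G x * u n x) (fun x => G x * f x)
        (fun x => B * `|G x|).
    + by move=> n; exact: measurable_funM.
    + by move=> x; apply: cvgMr; exact: uf.
    + by apply: intgZ; exact: intg_abs.
    + by move=> n x; rewrite normrM mulrC ler_wpM2r.
    have rBv := r2Z B v_r2.
    have uBv n x : `|u n x * v x| <= `|B * v x|.
      by rewrite !normrM ler_wpM2r// (le_trans (uB n x))// ler_norm.
    have mfv : measurable_fun setT (fun x => f x * v x) by exact: measurable_funM.
    have cv x : u n x * v x @[n --> \oo] --> f x * v x by apply: cvgMl; exact: uf.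
    have rfv : r2 tau (fun x => f x * v x).
      have fB x : `|f x * v x| <= `|B * v x|.
        have /cvg_norm fx := cv x.
        by apply: (ler_cvg_to fx (cvg_cst `|B * v x|)); exact: nearW.
      by case: (r2_le mfv rBv fB).
    split => //.
    have c3 : extend (fun x => u n x * v x) @[n --> \oo] --> extend (fun x => f x * v x).
      apply: extend_cvg => //; first by move=> n; case: (Vu n).
      apply: (q2_dct _ cv rBv uBv mfv) => n; exact: measurable_funM.
    have E : (fun n => extend (fun x => u n x * v x)) = (fun n => rint (fun x => G x * u n x)).
      by apply/funext => n; case: (Vu n).
    rewrite E in c3.
    by rewrite -(cvg_lim (@Rhausdorff R) c3) -(cvg_lim (@Rhausdorff R) c1).
have vn0 x : v x != 0 by rewrite gt_eqF.
have vV x : (v x)^-1 = wt (- (- (tau + 1) / 2)) x by rewrite /v /wt powRN.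
pose a x := G x / v x.
have ma : measurable_fun setT a.
  apply: measurable_funM => //; under eq_fun do rewrite vV; exact: wt_meas.
exists a; split; last first.
  move=> g tg; have [B B0 gB] := rtest_bounded tg; have [_ [M gM]] := tg.
  have [] := Z (fun x => g x / v x) (B * (1 + M ^+ 2) `^ `|- (- (tau + 1) / 2)|) M.
  - apply: measurable_funM; first exact: rtest_meas.
    by under eq_fun do rewrite vV; exact: wt_meas.
  - move=> x; rewrite normrM vV (ger0_norm (wt_ge0 _ _)).
    have [xM|/gM ->] := leP `|x| M; first by rewrite ler_pM ?wt_ge0 ?wt_bounded.
    by rewrite normr0 mul0r mulr_ge0 ?powR_ge0.
  - by move=> x /gM ->; rewrite mul0r.
  move=> _ _.
  have -> : (fun x => g x / v x * v x) = g by apply/funext => x; rewrite divfK.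
  rewrite extend_test// => ->; congr rint; apply/funext => x.
  by rewrite /a mulrA mulrAC.
pose h x := a x * wt (- tau) x / v x.
have mh : measurable_fun setT h.
  apply: measurable_funM; first by apply: measurable_funM => //; exact: wt_meas.
  by under eq_fun do rewrite vV; exact: wt_meas.
pose I n x := G x * cut n h x.
have Gav x : G x = a x * v x by rewrite /a divfK.
have IE n x : I n x = (a x ^+ 2 * wt (- tau) x) * ((`|h x| <= n%:R) && (`|x| <= n%:R))%:R.
  rewrite /I /cut Gav; case: ifPn => _; last by rewrite !mulr0.
  by rewrite mulr1 /h; field.
have I0 n x : 0 <= I n x by rewrite IE mulr_ge0// sqw_ge0.
have q2I n : q2 tau (fun x => cut n h x * v x) = rint (I n).
  congr rint; apply/funext => x; rewrite IE /cut; case: ifPn => _; last by rewrite mul0r expr0n mul0r mulr0.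
  rewrite mulr1 /h divfK// exprMn -mulrA -[wt _ x ^+ 2 * _]mulrA.
  by rewrite [_ * wt tau x]mulrC wtNK mulr1.
(* L on the truncation equals its squared norm; dividing by it gives the bound *)
have In n : intg (I n) /\ rint (I n) <= 4 * K.
  have [r1 i1 e1] := Z _ _ _ (cut_meas n mh) (cut_le n h) (@cut_supp _ n h).
  split => //; have := extend_bound r1; rewrite e1 q2I -/(I n) expr2.
  have := rint_ge0 (I0 n); rewrite le_eqVlt => /predU1P[<- _|p]; first by rewrite mulr_ge0.
  by rewrite ler_pM2r.
(* the truncated integrals increase to the squared norm of a *)
have [iA _] : intg (fun x => a x ^+ 2 * wt (- tau) x) /\ rint (fun x => a x ^+ 2 * wt (- tau) x) <= 4 * K.
  apply: (@rint_mono R I) => //.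
  - by move=> n; case: (In n).
  - move=> x m n mn; rewrite !IE ler_wpM2l ?sqw_ge0//.
    have mn' : m%:R <= n%:R :> R by rewrite ler_nat.
    case: andP => [[p q]|_]; last by [].
    by rewrite (le_trans p mn') (le_trans q mn').
  - move=> x; apply: cvg_near_cst; near=> n.
    rewrite IE (_ : _ && _ = true) ?mulr1//; apply/andP.
    by split; near: n; exact: nbhs_infty_ger.
  - by move=> n; case: (In n).
by split.
Unshelve. all: end_near. Qed.

End Riesz.

(** * Complex weighted spaces and representable distributions *)

Section ComplexL2.
Context {R : realType}.
Implicit Types (F G f g : R -> R[i]) (tau : R) (T : distr R).
Local Notation mu := (@lebesgue_measure R).

(** [L2 tau] is the Fourier image of the Sobolev space of order tau, and [nrm]
    its squared norm without the factor 1 / (2 pi). *)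
Definition L2 tau F := r2 tau (fun x => re (F x)) /\ r2 tau (fun x => im (F x)).
Definition nrm tau F := q2 tau (fun x => re (F x)) + q2 tau (fun x => im (F x)).

Lemma L2_cmeas tau F : L2 tau F -> cmeas F.
Proof. by case=> -[? _] [? _]. Qed.

Lemma nrm_ge0 tau F : 0 <= nrm tau F.
Proof. by rewrite addr_ge0 ?q2_ge0. Qed.

Lemma L2_abs tau F : L2 tau F -> r2 tau (fun x => cabs (F x)) /\
  q2 tau (fun x => cabs (F x)) = nrm tau F.
Proof.
move=> FL; have [[mr ir] [mi ii]] := FL.
have E : (fun x => cabs (F x) ^+ 2 * wt tau x) =
    fun x => re (F x) ^+ 2 * wt tau x + im (F x) ^+ 2 * wt tau x.
  by apply/funext => x; rewrite cabs_sq mulrDl.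
split; first by split; [exact: cmeas_abs|rewrite E; exact: intgD].
by rewrite /q2 E rintD.
Qed.

Lemma L2_of_abs tau F : cmeas F -> r2 tau (fun x => cabs (F x)) -> L2 tau F.
Proof.
move=> [mr mi] ra; split.
  by have [] // := r2_le mr ra; move=> x; rewrite [leRHS]ger0_norm ?cabs_ge0// re_cabs.
by have [] // := r2_le mi ra; move=> x; rewrite [leRHS]ger0_norm ?cabs_ge0// im_cabs.
Qed.

Lemma L2_sqnorm tau F : L2 tau F -> hat_sobolev_sqnorm tau F = ((2 * pi)^-1 * nrm tau F)%:E.
Proof.
move=> /L2_abs[[_ ia] <-]; rewrite /hat_sobolev_sqnorm EFinM; congr (_ * _)%E.
exact: integral_EFin ia.
Qed.

Lemma pi2_gt0 : 0 < 2 * pi :> R.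
Proof. by rewrite mulr_gt0 ?pi_gt0. Qed.

Lemma sqnorm_L2 tau F : cmeas F -> (hat_sobolev_sqnorm tau F < +oo)%E -> L2 tau F.
Proof.
move=> mF Fy; apply: L2_of_abs => //.
have mA := cmeas_abs mF; split => //.
apply/intg_ge0P; [exact: r2_meas_sq|by move=> x; exact: sqw_ge0|].
move: Fy; rewrite /hat_sobolev_sqnorm; apply: contraTT; rewrite -!leNgt !leye_eq.
move=> /eqP H; rewrite (_ : (\int[_]_x _ = +oo)%E) ?gt0_muley ?lte_fin ?invr_gt0 ?pi2_gt0//.
Qed.

Lemma L2D tau F G : L2 tau F -> L2 tau G -> L2 tau (fun x => F x + G x) /\
  nrm tau (fun x => F x + G x) <= 2 * nrm tau F + 2 * nrm tau G.
Proof.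
move=> [Fr Fi] [Gr Gi]; have [r1 n1] := r2D Fr Gr; have [r3 n3] := r2D Fi Gi.
rewrite /L2 /nrm.
rewrite (_ : (fun x => re (F x + G x)) = fun x => re (F x) + re (G x)); last first.
  by apply/funext => x; rewrite reD.
rewrite (_ : (fun x => im (F x + G x)) = fun x => im (F x) + im (G x)); last first.
  by apply/funext => x; rewrite imD.
by split => //; lra.
Qed.

Lemma L2_le tau F G (C : R) : 0 <= C -> cmeas F -> L2 tau G ->
  (forall x, cabs (F x) <= C * cabs (G x)) ->
  L2 tau F /\ nrm tau F <= C ^+ 2 * nrm tau G.
Proof.
move=> C0 mF GL FG; have [rG nG] := L2_abs GL.
have [||r1 n1] := @r2_le _ tau (fun x => cabs (F x)) _ _ (r2Z C rG).
- exact: cmeas_abs.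
- by move=> x; rewrite !ger0_norm ?mulr_ge0 ?cabs_ge0.
have FL := L2_of_abs mF r1; have [_ nF] := L2_abs FL.
by split => //; rewrite -nF -nG -q2Z.
Qed.

Lemma L2Z tau (c : R[i]) F : L2 tau F -> L2 tau (fun x => c * F x) /\
  nrm tau (fun x => c * F x) <= cabs c ^+ 2 * nrm tau F.
Proof.
move=> FL; apply: L2_le => //; first exact: cabs_ge0.
  by apply: cmeasM; [exact: cmeas_cst|exact: L2_cmeas FL].
by move=> x; rewrite cabsM.
Qed.

Lemma L2N tau F : L2 tau F -> L2 tau (fun x => - F x) /\
  nrm tau (fun x => - F x) <= nrm tau F.
Proof.
move=> FL; rewrite -[leRHS]mul1r -[1 in leRHS](expr1n _ 2); apply: L2_le => //.
  by apply: cmeasN; exact: L2_cmeas FL.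
by move=> x; rewrite cabsN mul1r.
Qed.

Lemma L2B tau F G : L2 tau F -> L2 tau G -> L2 tau (fun x => F x - G x) /\
  nrm tau (fun x => F x - G x) <= 2 * nrm tau F + 2 * nrm tau G.
Proof.
move=> FL GL; have [GN nG] := L2N GL; have [r n] := L2D FL GN.
by split => //; lra.
Qed.

Lemma L2J tau F : L2 tau F -> L2 tau (fun x => conjc (F x)) /\
  nrm tau (fun x => conjc (F x)) <= nrm tau F.
Proof.
move=> FL; rewrite -[leRHS]mul1r -[1 in leRHS](expr1n _ 2); apply: L2_le => //.
  by apply: cmeasJ; exact: L2_cmeas FL.
by move=> x; rewrite cabs_conj mul1r.
Qed.

(** The weighted spaces of opposite orders are dual under the plain bilinear
    integral; no weight appears in it. *)
Lemma L2_pair tau F G : L2 (- tau) F -> L2 tau G ->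
  cintg (fun x => F x * G x) /\
  cabs (cintegral (fun x => F x * G x)) ^+ 2 <= 4 * (nrm (- tau) F * nrm tau G).
Proof.
move=> FL GL; have [rF nF] := L2_abs FL; have [rG nG] := L2_abs GL.
have [ip bp] := r2_pair rF rG.
have mFG := cmeasM (L2_cmeas FL) (L2_cmeas GL).
have H x : cabs (F x * G x) <= `|cabs (F x) * cabs (G x)| by rewrite cabsM ler_norm.
have ia := intg_abs ip; split; first exact: cintg_le mFG ia H.
have h0 := cabs_ge0 (cintegral (fun x => F x * G x)).
have h1 := cint_bound mFG ia H; have h2 := le_trans h0 h1.
have {h1} : cabs (cintegral (fun x => F x * G x)) ^+ 2 <=
    (2 * rint (fun x => `|cabs (F x) * cabs (G x)|)) ^+ 2.
  by rewrite lerXn2r ?nnegrE.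
move/le_trans; apply.
by rewrite exprMn -natrX ler_wpM2l// -nF -nG.
Qed.

Lemma testfun_L2 tau f : testfun f -> L2 tau f.
Proof. by move=> /testfunP[? ?]; split; exact: r2_test. Qed.

Lemma L2_approx tau F : L2 tau F -> forall e, 0 < e ->
  exists2 f, testfun f & nrm tau (fun x => F x - f x) <= e.
Proof.
move=> [/r2_approx[_ Hr] /r2_approx[_ Hi]] e e0.
have [a ta qa] := Hr (e / 2) ltac:(by rewrite divr_gt0).
have [b tb qb] := Hi (e / 2) ltac:(by rewrite divr_gt0).
exists (fun x => a x +i* b x); first exact/testfunP.
rewrite /nrm.
rewrite (_ : (fun x => re _) = fun x => re (F x) - a x); last first.
  by apply/funext => x; rewrite reD reN.
rewrite (_ : (fun x => im _) = fun x => im (F x) - b x); last first.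
  by apply/funext => x; rewrite imD imN.
lra.
Qed.

Lemma testfun_real a : @rtest R a -> testfun (fun x => (a x)%:C).
Proof. by move=> ta; apply/testfunP; split => //=; exact: rtest0. Qed.

Lemma testfunD f g : testfun f -> testfun g -> testfun (fun x => f x + g x).
Proof.
move=> /testfunP[fr fi] /testfunP[gr gi]; apply/testfunP; split.
  by under eq_fun do rewrite reD; exact: rtestD.
by under eq_fun do rewrite imD; exact: rtestD.
Qed.

Lemma testfunZ (c : R[i]) f : testfun f -> testfun (fun x => c * f x).
Proof.
move=> /testfunP[fr fi]; apply/testfunP; split.
  by under eq_fun do rewrite reM; apply: rtestB; exact: rtestZ.
by under eq_fun do rewrite imM; apply: rtestD; exact: rtestZ.
Qed.

Lemma testfunJ f : testfun f -> testfun (conjf f).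
Proof.
move=> /testfunP[fr fi]; apply/testfunP; rewrite /conjf; split.
  by under eq_fun do rewrite reJ.
by under eq_fun do rewrite imJ; exact: rtestN.
Qed.

Lemma testfun_cintg f : testfun f -> cintg f.
Proof. by move=> /testfunP[? ?]; split; exact: rtest_intg. Qed.

Definition test_linear T := forall (c : R[i]) f g, testfun f -> testfun g ->
  T (fun x => c * f x + g x) = c * T f + T g.

(** Continuity on test functions for the norm of a weighted space, the
    hypothesis of the representation theorem. *)
Definition test_bounded tau T := exists2 K : R, 0 <= K &
  forall g, testfun g -> cabs (T g) ^+ 2 <= K * nrm tau g.

Lemma r2_locintg tau a : r2 tau a -> locintg a.
Proof.
move=> ra; split=> [|M]; first by case: ra.
have rb : r2 (- tau) (\1_(`[- M, M]%classic : set R)).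
  apply: (@r2_bounded_supp _ _ _ 1 M); first exact: measurable_indic.
  - by move=> x; rewrite indicE normr_nat; case: (_ \in _).
  - move=> x xM; rewrite indicE memNset// /= in_itv/= -ler_norml.
    by apply/negP; rewrite -ltNge.
rewrite -[tau]opprK in ra.
by have [] := r2_pair ra rb.
Qed.

Lemma represents_cmeas F T : represents F T -> cmeas F.
Proof. by case=> /locintgP[? _] /locintgP[? _] _; split. Qed.

Lemma locintg_mul_test a (g : R -> R) : @locintg R a -> rtest g -> intg (fun x => a x * g x).
Proof.
move=> la tg; have [B _ gB] := rtest_bounded tg; have [_ [M gM]] := tg.
exact: locintg_mul_bounded la (rtest_meas tg) gB gM.
Qed.

(** The real theorem is applied to the real and imaginary parts of T on real
    test functions; complex linearity does the rest. *)
Theorem riesz tau T : test_linear T -> test_bounded tau T ->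
  exists2 F, L2 (- tau) F & represents F T.
Proof.
move=> Tlin [K K0 Tb].
have Treal (c : R) a b : rtest a -> rtest b ->
    T (fun x => (a x + c * b x)%:C) = T (fun x => (a x)%:C) + c%:C * T (fun x => (b x)%:C).
  move=> ta tb; rewrite addrC -Tlin; [|exact: testfun_real..].
  by congr T; apply/funext => x; apply: complex_eq; rewrite /= ?mul0r ?mulr0 ?subr0 ?addr0// addrC.
have Tbr a : rtest a -> cabs (T (fun x => (a x)%:C)) ^+ 2 <= K * q2 tau a.
  move=> ta; apply: le_trans (Tb _ (testfun_real ta)) _.
  rewrite ler_wpM2l// /nrm/= [X in _ + X](_ : _ = 0) ?addr0//.
  rewrite -[RHS](@rint0 R) /q2; congr rint.
  by apply/funext => x; rewrite expr0n mul0r.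
have [||A [rA HA]] := @riesz_real _ tau K (fun a => re (T (fun x => (a x)%:C))) K0.
- by move=> c f g tf tg; rewrite Treal// reD reM mul0r subr0.
- by move=> g tg; rewrite (le_trans _ (Tbr _ tg))// cabs_sq lerDl sqr_ge0.
have [||B [rB HB]] := @riesz_real _ tau K (fun a => im (T (fun x => (a x)%:C))) K0.
- by move=> c f g tf tg; rewrite Treal// imD imM mul0r addr0.
- by move=> g tg; rewrite (le_trans _ (Tbr _ tg))// cabs_sq lerDr sqr_ge0.
have lA := r2_locintg rA; have lB := r2_locintg rB.
exists (fun x => A x +i* B x) => //; split; [exact/locintgP|exact/locintgP|].
move=> g tg; have [gr gi] := (testfunP g).1 tg.
have -> : T g = 'i * T (fun x => (im (g x))%:C) + T (fun x => (re (g x))%:C).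
  rewrite -Tlin; [|exact: testfun_real..]; congr T.
  by apply/funext => x; apply: complex_eq => /=; rewrite ?mul0r ?mul1r ?mulr0 ?subr0 ?add0r ?addr0 ?subrr.
have iAr := locintg_mul_test lA gr; have iAi := locintg_mul_test lA gi.
have iBr := locintg_mul_test lB gr; have iBi := locintg_mul_test lB gi.
rewrite cintE; apply: complex_eq; rewrite ?reD ?imD ?reM ?imM /= ?mul0r ?mul1r ?sub0r ?add0r.
  rewrite (HA _ gr) (HB _ gi) addrC -rintB//; congr rint; apply/funext => x.
  by rewrite reM.
rewrite (HB _ gr) (HA _ gi) -rintD//; congr rint; apply/funext => x.
by rewrite imM/=.
Qed.

Lemma represents_unique F G T : represents F T -> represents G T -> aeq F G.
Proof.
move=> [/locintgP Fr /locintgP Fi FT] [/locintgP Gr /locintgP Gi GT].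
have lB a b : locintg a -> locintg b -> locintg (fun x => a x - b x : R).
  move=> [ma ia] [mb ib]; split; first exact: measurable_funB.
  by move=> M; under eq_fun do rewrite mulrBl; exact: intgB.
have Hr : aeq (fun x => re (F x) - re (G x)) (fun=> 0).
  apply: fundamental_lemma; first exact: lB.
  move=> g tg; have := FT _ (testfun_real tg); rewrite GT ?cintE; last exact: testfun_real.
  move=> [+ _].
  under [X in rint X = _]eq_fun do rewrite reM/= mulr0 subr0.
  under [X in _ = rint X]eq_fun do rewrite reM/= mulr0 subr0.
  move=> E; rewrite (_ : (fun x => _) = fun x => re (F x) * g x - re (G x) * g x).
    by rewrite rintB; [rewrite E subrr|exact: locintg_mul_test..].
  by apply/funext => x; rewrite mulrBl.
have Hi : aeq (fun x => im (F x) - im (G x)) (fun=> 0).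
  apply: fundamental_lemma; first exact: lB.
  move=> g tg; have := FT _ (testfun_real tg); rewrite GT ?cintE; last exact: testfun_real.
  move=> [_ +].
  under [X in rint X = _]eq_fun do rewrite imM/= mulr0 add0r.
  under [X in _ = rint X]eq_fun do rewrite imM/= mulr0 add0r.
  move=> E; rewrite (_ : (fun x => _) = fun x => im (F x) * g x - im (G x) * g x).
    by rewrite rintB; [rewrite E subrr|exact: locintg_mul_test..].
  by apply/funext => x; rewrite mulrBl.
apply: (aeS _ (aeI Hr Hi)) => x [/eqP h1 /eqP h2].
by apply: complex_eq; apply/eqP; rewrite -subr_eq0.
Qed.

Lemma L2_aeq tau F G : cmeas G -> aeq F G -> L2 tau F -> L2 tau G /\ nrm tau G = nrm tau F.
Proof.
move=> [mGr mGi] FG [[mFr iFr] [mFi iFi]].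
have Hr : aeq (fun x => re (F x) ^+ 2 * wt tau x) (fun x => re (G x) ^+ 2 * wt tau x).
  by apply: (aeS _ FG) => x ->.
have Hi : aeq (fun x => im (F x) ^+ 2 * wt tau x) (fun x => im (G x) ^+ 2 * wt tau x).
  by apply: (aeS _ FG) => x ->.
split.
  split; split => //; first exact: (intg_aeq (r2_meas_sq tau mGr) Hr iFr).
  exact: (intg_aeq (r2_meas_sq tau mGi) Hi iFi).
rewrite /nrm /q2 (rint_aeq (r2_meas_sq tau mFr) (r2_meas_sq tau mGr) Hr).
by rewrite (rint_aeq (r2_meas_sq tau mFi) (r2_meas_sq tau mGi) Hi).
Qed.

(** The chosen representative is a genuine one as soon as some representative
    exists. *)
Lemma hatfun_represents T F : represents F (fourier_dist T) ->
  represents (hatfun T) (fourier_dist T).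
Proof.
move=> H; rewrite /hatfun.
by have /(xgetPex (fun=> 0)) : exists F, [set F | represents F (fourier_dist T)] F by exists F.
Qed.

Lemma sobolev_L2 tau T : sobolev tau T ->
  L2 tau (hatfun T) /\ represents (hatfun T) (fourier_dist T).
Proof.
move=> [_ [F /hatfun_represents rF] Ty]; split => //.
exact: sqnorm_L2 (represents_cmeas rF) Ty.
Qed.

Lemma represents_bounded tau F T : L2 (- tau) F -> represents F T -> test_bounded tau T.
Proof.
move=> FL [_ _ FT]; exists (4 * nrm (- tau) F); first by rewrite mulr_ge0 ?nrm_ge0.
move=> g tg; rewrite FT//; have [_] := L2_pair FL (testfun_L2 tau tg).
by rewrite mulrA.
Qed.

Lemma represents_linear F T : represents F T -> test_linear T.
Proof.
move=> [/locintgP Fr /locintgP Fi FT] c f g tf tg.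
have iF h : testfun h -> cintg (fun x => F x * h x).
  move=> /testfunP[hr hi]; split.
    by under eq_fun do rewrite reM; apply: intgB; exact: locintg_mul_test.
  by under eq_fun do rewrite imM; apply: intgD; exact: locintg_mul_test.
rewrite !FT//; last by apply: testfunD => //; exact: testfunZ.
rewrite -cintZ; last exact: iF.
rewrite -cintD; [|by apply: cintgZ; exact: iF|exact: iF].
by congr cintegral; apply/funext => x; ring.
Qed.

End ComplexL2.

(** * Fourier transforms of test functions *)

Section RealFourier.
Context {R : realType}.
Implicit Types (a b : R -> R) (f g h : R -> R[i]).

(** Real and imaginary parts of Fourier transforms are all of this shape, a
    class that, for test functions a and b, is stable under differentiation
    and under multiplication by the variable. *)
Definition trigint a b (xi : R) : R := rint (fun x => a x * cos (x * xi) + b x * sin (x * xi)).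

Lemma cos_le1 (t : R) : `|cos t| <= 1.
Proof. by rewrite ler_norml cos_geN1 cos_le1. Qed.

Lemma sin_le1 (t : R) : `|sin t| <= 1.
Proof. by rewrite ler_norml sin_geN1 sin_le1. Qed.

Lemma meas_cosM (xi : R) : measurable_fun setT (fun x : R => cos (x * xi)).
Proof.
apply: continuous_measurable_fun => x; apply: continuous_comp; last exact: continuous_cos.
by apply: cvgMl; exact: cvg_id.
Qed.

Lemma meas_sinM (xi : R) : measurable_fun setT (fun x : R => sin (x * xi)).
Proof.
apply: continuous_measurable_fun => x; apply: continuous_comp; last exact: continuous_sin.
by apply: cvgMl; exact: cvg_id.
Qed.

Lemma trig_meas a b xi : measurable_fun setT a -> measurable_fun setT b ->
  measurable_fun setT (fun x : R => a x * cos (x * xi) + b x * sin (x * xi)).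
Proof.
move=> ma mb; apply: measurable_funD; apply: measurable_funM => //.
  exact: meas_cosM.
exact: meas_sinM.
Qed.

Lemma trig_bound a b x t : `|a x * cos t + b x * sin t| <= `|a x| + `|b x| :> R.
Proof.
rewrite (le_trans (ler_normD _ _))// lerD// normrM ler_piMr//.
  exact: cos_le1.
exact: sin_le1.
Qed.

Lemma trig_intg a b xi : intg a -> intg b ->
  intg (fun x : R => a x * cos (x * xi) + b x * sin (x * xi)).
Proof.
move=> ia ib; apply: (intg_le (trig_meas xi (intg_meas ia) (intg_meas ib))
  (intgD (intg_abs ia) (intg_abs ib))) => x; exact: trig_bound.
Qed.

Lemma trigint_bound a b xi : intg a -> intg b ->
  `|trigint a b xi| <= rint (fun x => `|a x| + `|b x|).
Proof.
move=> ia ib; apply: rint_bound; first exact: trig_intg.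
  by apply: intgD; exact: intg_abs.
by move=> x; exact: trig_bound.
Qed.

Lemma trigint_continuous a b : intg a -> intg b -> continuous (trigint a b).
Proof.
move=> ia ib xi; apply/(@cvg_nbhsP _ R^o) => u uxi.
apply: (proj2 (@rint_dct R (fun n x => a x * cos (x * u n) + b x * sin (x * u n)) _
  (fun x => `|a x| + `|b x|) _ _ _ _)).
- by move=> n; apply: trig_meas; exact: intg_meas.
- move=> x; have cu : x * u n @[n --> \oo] --> x * xi by apply: cvgMr.
  apply: cvgD; apply: cvgMr; first exact: (cvg_comp _ _ cu (@continuous_cos R _)).
  exact: (cvg_comp _ _ cu (@continuous_sin R _)).
- by apply: intgD; exact: intg_abs.
- by move=> n x; exact: trig_bound.
Qed.

(** Differentiation under the integral sign; on a compact support the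
    derivative is dominated. *)
Lemma trigint_D1 a b : rtest a -> rtest b ->
  D1 (trigint a b) (trigint (fun x => x * b x) (fun x => - (x * a x))).
Proof.
move=> ta tb xi.
have txa : rtest (fun x => x * a x) by apply: rtestMl => //; exact: rsmooth_id.
have txb : rtest (fun x => x * b x) by apply: rtestMl => //; exact: rsmooth_id.
pose F (t x : R) := a x * cos (x * t) + b x * sin (x * t).
have dF x : D1 (F ^~ x) (fun t => x * b x * cos (x * t) + - (x * a x) * sin (x * t)).
  have dl : D1 (fun t : R => x * t) (fun=> x).
    by apply: D1_eq (D1Z x D1_id) _ => t; rewrite mulr1.
  apply: D1_eq (D1D (D1Z (a x) (D1_comp D1_cos dl)) (D1Z (b x) (D1_comp D1_sin dl))) _ => t.
  by ring.
have pF t x : partial1of2 F t x = x * b x * cos (x * t) + - (x * a x) * sin (x * t).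
  by rewrite /partial1of2 (D1E (dF x)).
pose G x := `|x * b x| + `|x * a x|.
have Ixi : `]xi - 1, xi + 1[%classic xi by rewrite /= in_itv/= ltrDl gtrDl oppr_lt0 ltr01.
have iF t : `]xi - 1, xi + 1[%classic t -> (@lebesgue_measure R).-integrable setT (EFin \o F t).
  by move=> _; apply: trig_intg; exact: rtest_intg.
have dFI t x : `]xi - 1, xi + 1[%classic t -> setT x -> derivable (F ^~ x) t 1.
  by move=> _ _; exact: D1_derivable (dF x).
have G0 x : 0 <= G x by rewrite addr_ge0.
have iG : (@lebesgue_measure R).-integrable setT (EFin \o G).
  by apply: intgD; apply: intg_abs; exact: rtest_intg.
have FG t x : `]xi - 1, xi + 1[%classic t -> setT x -> `|partial1of2 F t x| <= G x.
  move=> _ _; rewrite pF /G -[`|x * a x|]normrN.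
  exact: (trig_bound (fun x => x * b x) (fun x => - (x * a x))).
have dD := derivable_under_integral measurableT Ixi iF dFI G0 iG FG.
have eD := differentiation_under_integral measurableT Ixi iF dFI G0 iG FG.
apply: DeriveDef; first exact: dD.
rewrite -derive1E eD /trigint /rint; apply: eq_Rintegral => x _; exact: pF.
Qed.

(** Integration by parts: the integral of the derivative of a test function
    vanishes. *)
Lemma trigint_mul a b xi : rtest a -> rtest b ->
  xi * trigint a b xi = trigint (derive1 b) (fun x => - derive1 a x) xi.
Proof.
move=> ta tb.
pose h x := sin (xi * x) * a x - cos (xi * x) * b x.
have th : rtest h.
  by apply: rtestB; apply: rtestMl => //; [exact: rsmooth_sin|exact: rsmooth_cos].
have dl : D1 (fun t : R => xi * t) (fun=> xi).
  by apply: D1_eq (D1Z xi D1_id) _ => t; rewrite mulr1.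
have da := rsmooth_D1 (rtest_smooth ta); have db := rsmooth_D1 (rtest_smooth tb).
have dh : D1 h (fun x => xi * (a x * cos (x * xi) + b x * sin (x * xi)) -
    (derive1 b x * cos (x * xi) + - derive1 a x * sin (x * xi))).
  apply: D1_eq (D1D (D1M (D1_comp D1_sin dl) da) (D1N (D1M (D1_comp D1_cos dl) db))) _ => x.
  by rewrite [x * xi]mulrC; ring.
have := rint_derive th; rewrite (D1E dh) rintB.
- rewrite rintZ; last by apply: trig_intg; exact: rtest_intg.
  by move=> /eqP; rewrite subr_eq0 => /eqP.
- by apply: intgZ; apply: trig_intg; exact: rtest_intg.
- apply: trig_intg; first by apply: rtest_intg; exact: rtest_derive.
  by apply: rtest_intg; apply: rtestN; exact: rtest_derive.
Qed.

Definition is_trigint (F : R -> R) := exists a b, [/\ rtest a, rtest b & F = trigint a b].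

Lemma is_trigint_derive F : is_trigint F -> is_trigint (derive1 F) /\ D1 F (derive1 F).
Proof.
move=> [a [b [ta tb ->]]]; have H := trigint_D1 ta tb; rewrite (D1E H); split => //.
exists (fun x => x * b x), (fun x => - (x * a x)); split => //.
  by apply: rtestMl => //; exact: rsmooth_id.
by apply: rtestN; apply: rtestMl => //; exact: rsmooth_id.
Qed.

Lemma is_trigint_mul F : is_trigint F -> is_trigint (fun x => x * F x).
Proof.
move=> [a [b [ta tb ->]]]; exists (derive1 b), (fun x => - derive1 a x); split.
- exact: rtest_derive.
- by apply: rtestN; exact: rtest_derive.
- by apply/funext => x; rewrite trigint_mul.
Qed.

(** Multiplication by the variable stays in the class, whose members are
    bounded; this is rapid decay. *)
Lemma is_trigint_bounded F m : is_trigint F -> exists C : R, forall x, `|x| ^+ m * `|F x| <= C.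
Proof.
elim: m F => [|m IH] F HF.
  have [a [b [ta tb ->]]] := HF.
  exists (rint (fun x => `|a x| + `|b x|)) => x; rewrite expr0 mul1r.
  by apply: trigint_bound; exact: rtest_intg.
have [C HC] := IH _ (is_trigint_mul HF); exists C => x.
by have := HC x; rewrite normrM mulrA -exprSr.
Qed.

Lemma is_trigint_smooth F : is_trigint F -> rsmooth F.
Proof.
apply: rsmooth_ind => {}F HF; exists (derive1 F); by case: (is_trigint_derive HF).
Qed.

Lemma is_trigint_deriven F n : is_trigint F -> is_trigint (derive1n n F).
Proof.
elim: n F => [//|n IH] F HF; rewrite derive1Sn; apply: IH.
by case: (is_trigint_derive HF).
Qed.

Lemma cabs_expi (t : R) : cabs (expi t) = 1.
Proof. by rewrite cabsE /= cos2Dsin2 sqrtr1. Qed.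

Lemma expiD (s t : R) : expi (s + t) = expi s * expi t.
Proof.
by apply: complex_eq; rewrite ?reM ?imM /= ?cosD ?sinD// addrC.
Qed.

Lemma expi0 : expi (0 : R) = 1.
Proof. by apply: complex_eq; rewrite /= ?cos0 ?sin0. Qed.

Lemma fourier_re f xi : re (fourier f xi) = trigint (fun x => re (f x)) (fun x => im (f x)) xi.
Proof.
rewrite /fourier cintE /=; congr rint; apply/funext => x.
by rewrite reM /= cosN sinN mulrN opprK.
Qed.

Lemma fourier_im f xi : im (fourier f xi) = trigint (fun x => im (f x)) (fun x => - re (f x)) xi.
Proof.
rewrite /fourier cintE /=; congr rint; apply/funext => x.
by rewrite imM /= cosN sinN mulrN mulNr addrC.
Qed.

Lemma cabs_bound_schwartz f m n : is_trigint (fun x => re (f x)) -> is_trigint (fun x => im (f x)) ->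
  has_ubound (schwartz_values m n f).
Proof.
move=> Hr Hi.
have [A HA] := is_trigint_bounded m (is_trigint_deriven n Hr).
have [B HB] := is_trigint_bounded m (is_trigint_deriven n Hi).
exists (A + B) => _ [x _ <-].
apply: (@le_trans _ _ (`|x| ^+ m * (`|derive1n n (fun y => re (f y)) x| +
   `|derive1n n (fun y => im (f y)) x|))).
  by rewrite ler_wpM2l ?exprn_ge0//; exact: cabs_le.
by rewrite mulrDr lerD.
Qed.

(** Needed for Fourier transforms of tempered distributions to be defined on
    test functions. *)
Theorem schwartz_fourier f : testfun f -> schwartz (fourier f).
Proof.
move=> /testfunP[tr ti].
have Hr : is_trigint (fun x => re (fourier f x)).
  exists (fun x => re (f x)), (fun x => im (f x)); split => //.
  by apply/funext => xi; exact: fourier_re.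
have Hi : is_trigint (fun x => im (fourier f x)).
  exists (fun x => im (f x)), (fun x => - re (f x)); split => //; first exact: rtestN.
  by apply/funext => xi; exact: fourier_im.
split; last by move=> m n; exact: cabs_bound_schwartz.
by move=> n x; split; [exact: is_trigint_smooth|exact: is_trigint_smooth].
Qed.

Lemma expi_cmeas (xi : R) : cmeas (fun x : R => expi (- (x * xi))).
Proof.
split => /=.
  by under eq_fun do rewrite cosN; exact: meas_cosM.
by under eq_fun do rewrite sinN; exact: measurableT_comp (meas_sinM xi).
Qed.

Lemma fourier_cintg f xi : cintg f -> cintg (fun x => f x * expi (- (x * xi))).
Proof.
move=> fi; apply: (@cintg_le _ _ (fun x => cabs (f x))).
- by apply: cmeasM; [exact: cintg_cmeas|exact: expi_cmeas].
- exact: cintg_abs.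
- by move=> x; rewrite cabsM cabs_expi mulr1.
Qed.

Lemma fourier_lin (c : R[i]) f g : cintg f -> cintg g ->
  fourier (fun x => c * f x + g x) = fun xi => c * fourier f xi + fourier g xi.
Proof.
move=> fi gi; apply/funext => xi; rewrite /fourier.
have -> : (fun x => (c * f x + g x) * expi (- (x * xi))) =
    fun x => c * (f x * expi (- (x * xi))) + g x * expi (- (x * xi)).
  by apply/funext => x; ring.
rewrite cintD ?cintZ//; [exact: fourier_cintg|by apply: cintgZ; exact: fourier_cintg|].
exact: fourier_cintg.
Qed.

Lemma fourier_bound f xi : cintg f -> cabs (fourier f xi) <= 2 * rint (fun x => cabs (f x)).
Proof.
move=> fi; apply: cint_bound.
- by apply: cmeasM; [exact: cintg_cmeas|exact: expi_cmeas].
- exact: cintg_abs.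
- by move=> x; rewrite cabsM cabs_expi mulr1.
Qed.

Lemma fourier_cmeas f : cintg f -> cmeas (fourier f).
Proof.
move=> [fr fi]; split.
  under eq_fun do rewrite fourier_re.
  by apply: continuous_measurable_fun; exact: trigint_continuous.
under eq_fun do rewrite fourier_im.
by apply: continuous_measurable_fun; apply: trigint_continuous => //; exact: intgN.
Qed.

Lemma tempered_test_linear (T : distr R) : tempered T -> test_linear (fourier_dist T).
Proof.
move=> [Tlin _] c f g tf tg; rewrite /fourier_dist fourier_lin ?Tlin//;
  by [exact: schwartz_fourier|exact: testfun_cintg].
Qed.

End RealFourier.

(** * The Laplace kernel and its transform *)

Section AbelKernel.
Context {R : realType}.
Implicit Types (a b : R -> R) (f g h : R -> R[i]).
Local Notation mu := (@lebesgue_measure R).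

Lemma rint_Fubini (k : R * R -> R) (p q : R -> R) : measurable_fun setT k ->
  intg p -> intg q -> (forall x y, `|k (x, y)| <= `|p x| * `|q y|) ->
  rint (fun x => rint (fun y => k (x, y))) = rint (fun y => rint (fun x => k (x, y))).
Proof.
move=> mk ip iq kpq.
have mk' : measurable_fun setT (fun z : R * R => (k z)%:E) by exact/measurable_EFinP.
have kx x : intg (fun y => k (x, y)).
  apply: (@intg_le _ _ (fun y => `|p x| * `|q y|)) => [||//].
    by apply: (measurableT_comp mk); exact: measurable_pair1.
  by apply: intgZ; exact: intg_abs.
have ky y : intg (fun x => k (x, y)).
  apply: (@intg_le _ _ (fun x => `|q y| * `|p x|)) => [||x].
  - by apply: (measurableT_comp mk); exact: measurable_pair2.
  - by apply: intgZ; exact: intg_abs.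
  - by rewrite mulrC kpq.
have ik : (mu \x mu)%E.-integrable setT (fun z : R * R => (k z)%:E).
  have HH := (@integrable12ltyP _ _ _ _ _ mu mu _ mk').
  apply: (proj2 HH).
  apply: (@le_lt_trans _ _ (\int[mu]_x (rint (fun y => `|q y|) * `|p x|)%R%:E)%E).
    apply: ge0_le_integral => //.
    - by move=> x _; apply: integral_ge0.
    - apply: (@measurable_fun_fubini_tonelli_F _ _ _ _ _ mu (fun z : R * R => `|(k z)%:E|%E)) => //=.
      by apply/measurable_EFinP; exact: measurableT_comp.
    - apply/measurable_EFinP; apply: measurable_funM => //.
      by apply: measurableT_comp => //; exact: intg_meas.
    - move=> x _; rewrite -[leLHS]/(\int[mu]_y (`|k (x, y)|)%:E)%E integral_EFin; last exact: intg_abs.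
      rewrite lee_fin mulrC -rintZ; last exact: intg_abs.
      by apply: rint_le => //; [exact: intg_abs|apply: intgZ; exact: intg_abs].
  by rewrite integral_EFin ?ltry//; apply: intgZ; exact: intg_abs.
have E := Fubini ik.
have -> : rint (fun x => rint (fun y => k (x, y))) = fine (\int[mu]_x \int[mu]_y (k (x, y))%:E)%E.
  by congr fine; apply: eq_integral => x _; rewrite integral_EFin.
rewrite E; congr fine; apply: eq_integral => x _; rewrite integral_EFin//.
Qed.

Lemma exp_abs_continuous (e : R) : continuous (fun t : R => expR (- (e * `|t|))).
Proof.
move=> t; apply: continuous_comp; last exact: continuous_expR.
apply: cvgN; apply: cvgMr; exact: (@norm_continuous R R^o).
Qed.

(** Adding 1 to the cosine makes the integrand nonnegative, so that the
    improper form of the fundamental theorem of calculus applies, to an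
    explicit antiderivative on the positive half-line. *)
Lemma rint_exp_cos_ge0 (e x : R) : 0 < e ->
  intg (fun t => expR (- (e * `|t|)) * (1 + cos (x * t))) /\
  rint (fun t => expR (- (e * `|t|)) * (1 + cos (x * t))) = 2 * e^-1 + 2 * (e / (e ^+ 2 + x ^+ 2)).
Proof.
move=> e0.
have ex0 : e ^+ 2 + x ^+ 2 != 0 by rewrite gt_eqF// ltr_pwDl ?exprn_gt0 ?sqr_ge0.
have ce : continuous (fun t : R => expR (- (e * `|t|)) * (1 + cos (x * t))).
  move=> t; apply: cvgM; first exact: exp_abs_continuous.
  apply: cvgD; first exact: cvg_cst.
  have cx : x * u @[u --> t] --> x * t by apply: cvgMr; exact: cvg_id.
  exact: (cvg_comp _ _ cx (@continuous_cos R _)).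
have f0 t : 0 <= expR (- (e * `|t|)) * (1 + cos (x * t)).
  by rewrite mulr_ge0 ?expR_ge0// -lerBlDl sub0r cos_geN1.
pose F t := - (e^-1 * expR (- (e * t))) +
  (e ^+ 2 + x ^+ 2)^-1 * (expR (- (e * t)) * (x * sin (x * t) - e * cos (x * t))).
have dl (c : R) : D1 (fun t : R => c * t) (fun=> c).
  by apply: D1_eq (D1Z c D1_id) _ => t; rewrite mulr1.
have dE : D1 (fun t => expR (- (e * t))) (fun t => expR (- (e * t)) * (- e)).
  by apply: D1_eq (D1_comp (@D1_expR R) (D1N (dl e))) _ => t.
have dF : D1 F (fun t => expR (- (e * t)) * (1 + cos (x * t))).
  have ds := D1_comp D1_sin (dl x); have dc := D1_comp D1_cos (dl x).
  apply: D1_eq (D1D (D1N (D1Z e^-1 dE)) (D1Z (e ^+ 2 + x ^+ 2)^-1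
    (D1M dE (D1D (D1Z x ds) (D1N (D1Z e dc)))))) _ => t.
  by field; rewrite ?ex0 ?(gt_eqF e0).
have Fl : F t @[t --> +oo] --> (0 : R).
  have dE0 : expR (- (e * t)) @[t --> +oo] --> (0 : R).
    have eo : e * t @[t --> +oo] --> +oo by apply: gt0_cvgMry.
    exact: (cvg_comp _ _ eo (@cvgr_expR R)).
  apply/cvgr0Pnorm_le => eps eps0.
  pose C := e^-1 + `|(e ^+ 2 + x ^+ 2)^-1| * (`|x| + e).
  have C0 : 0 < C by rewrite ltr_wpDr ?invr_gt0// mulr_ge0// addr_ge0// ltW.
  have epC : 0 < eps / C by rewrite divr_gt0.
  move/cvgr0Pnorm_le : dE0 => /(_ _ epC); apply: filterS => t.
  rewrite (ger0_norm (expR_ge0 _)) ler_pdivlMr// => H; apply: le_trans H.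
  rewrite /F /C [X in _ <= X]mulrDr (le_trans (ler_normD _ _))// lerD//.
    by rewrite normrN normrM !ger0_norm ?expR_ge0 ?invr_ge0 ?(ltW e0)// mulrC.
  rewrite !normrM (ger0_norm (expR_ge0 _)) mulrCA.
  rewrite ler_wpM2l ?expR_ge0//. rewrite ler_wpM2l// (le_trans (ler_normB _ _))// lerD//.
    by rewrite normrM ler_piMr// sin_le1.
  by rewrite normrM (gtr0_norm e0) ler_piMr ?(ltW e0)// cos_le1.
have If : (\int[mu]_(t in `[0%R, +oo[) (expR (- (e * `|t|)) * (1 + cos (x * t)))%:E =
    0%:E - (F 0)%:E)%E.
  apply: ge0_continuous_FTC2y => //.
  - exact: continuous_subspaceT.
  - by apply: cvg_at_right_filter; apply: (D1_continuous dF).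
  - move=> t; rewrite in_itv/= andbT => t0; rewrite (D1E dF).
    by rewrite gtr0_norm.
have ef : (fun t => expR (- (e * `|t|)) * (1 + cos (x * t))) =1
    (fun t => expR (- (e * `|t|)) * (1 + cos (x * t))) \o -%R.
  by move=> t /=; rewrite normrN mulrN cosN.
have E := ge0_symfun_integralT f0 ce ef.
rewrite -set_itvcy If -EFinB -EFinM in E.
have F0 : 0 - F 0 = e^-1 + e / (e ^+ 2 + x ^+ 2).
  rewrite /F !mulr0 oppr0 expR0 sin0 cos0; field.
  by rewrite ?ex0 ?(gt_eqF e0).
rewrite F0 mulrDr in E; split; last by rewrite /rint /Rintegral E.
apply/intg_ge0P => //; last by rewrite E ltry.
exact: continuous_measurable_fun.
Qed.

Lemma rint_exp_abs (e : R) : 0 < e ->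
  intg (fun t => expR (- (e * `|t|))) /\ rint (fun t => expR (- (e * `|t|))) = 2 * e^-1.
Proof.
move=> e0; have [i r] := rint_exp_cos_ge0 0 e0.
have E : (fun t => expR (- (e * `|t|))) =
    fun t => 2^-1 * (expR (- (e * `|t|)) * (1 + cos (0 * t))) :> R.
  by apply/funext => t; rewrite mul0r cos0; field.
rewrite E; split; first exact: intgZ.
rewrite rintZ// r; field.
by rewrite gt_eqF.
Qed.

Lemma rint_exp_cos (e x : R) : 0 < e ->
  intg (fun t => expR (- (e * `|t|)) * cos (x * t)) /\
  rint (fun t => expR (- (e * `|t|)) * cos (x * t)) = 2 * (e / (e ^+ 2 + x ^+ 2)).
Proof.
move=> e0; have [i r] := rint_exp_cos_ge0 x e0; have [i1 r1] := rint_exp_abs e0.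
have E : (fun t => expR (- (e * `|t|)) * cos (x * t)) =
    fun t => expR (- (e * `|t|)) * (1 + cos (x * t)) - expR (- (e * `|t|)) :> R.
  by apply/funext => t; ring.
rewrite E; split; first exact: intgB.
by rewrite rintB// r r1; ring.
Qed.

Lemma rint_exp_sin (e x : R) : 0 < e ->
  intg (fun t => expR (- (e * `|t|)) * sin (x * t)) /\
  rint (fun t => expR (- (e * `|t|)) * sin (x * t)) = 0.
Proof.
move=> e0; have [i1 _] := rint_exp_abs e0.
have i : intg (fun t => expR (- (e * `|t|)) * sin (x * t)).
  apply: (intg_le _ i1).
    apply: measurable_funM; first exact: intg_meas.
    by under eq_fun do rewrite mulrC; exact: meas_sinM.
  by move=> t; rewrite normrM (ger0_norm (expR_ge0 _)) ler_piMr ?expR_ge0// sin_le1.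
split => //; have := @rint_affine R (-1) 0 _ _ i; rewrite oppr_eq0 oner_eq0 => /(_ isT).
rewrite normrN normr1 mul1r.
have -> : (fun t => expR (- (e * `|-1 * t + 0|)) * sin (x * (-1 * t + 0))) =
    fun t => - (expR (- (e * `|t|)) * sin (x * t)) :> R.
  by apply/funext => t; rewrite addr0 mulN1r normrN mulrN sinN mulrN.
rewrite rintN// => /eqP; rewrite -subr_eq0 opprK -mulr2n mulrn_eq0 => /eqP //.
Qed.

End AbelKernel.

(** * Fourier inversion *)

Section Inversion.
Context {R : realType}.
Implicit Types (a b : R -> R) (f g h : R -> R[i]).
Local Notation mu := (@lebesgue_measure R).

Lemma intg_decay (F : R -> R) (C0 C2 : R) : measurable_fun setT F ->
  (forall x, `|F x| <= C0) -> (forall x, `|x| ^+ 2 * `|F x| <= C2) ->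
  intg F /\ rint (fun x => `|F x|) <= (C0 + C2) * pi.
Proof.
move=> mF F0 F2; have [i r] := @rint_oneDsqrV R.
have H x : `|F x| <= (C0 + C2) * (1 + x ^+ 2)^-1.
  rewrite ler_pdivlMr ?oneDsq_gt0// mulrDr mulr1 lerD//.
  by rewrite mulrC -real_normK ?num_real.
have iF := intg_le mF (intgZ (C0 + C2) i) H; split => //.
by rewrite -r -rintZ//; apply: rint_le => //; [exact: intg_abs|exact: intgZ].
Qed.

Lemma intg_is_trigint F : is_trigint F -> @intg R F.
Proof.
move=> HF; have [C0 H0] := is_trigint_bounded 0 HF; have [C2 H2] := is_trigint_bounded 2 HF.
have [] // := @intg_decay F C0 C2.
  by apply: continuous_measurable_fun; apply: rsmooth_continuous; exact: is_trigint_smooth.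
by move=> x; have := H0 x; rewrite expr0 mul1r.
Qed.

(** Abel summation of the inversion integral: exchanging the integrals
    replaces the factor exp(-e|xi|) by its transform, the Poisson kernel, here
    rescaled to width 1. *)
Lemma abel_mean a b (e : R) : 0 < e -> rtest a -> rtest b ->
  rint (fun xi => expR (- (e * `|xi|)) * trigint a b xi) =
  rint (fun y => a (e * y) * (2 * (1 + y ^+ 2)^-1)).
Proof.
move=> e0 ta tb; have ia := rtest_intg ta; have ib := rtest_intg tb.
have [ie _] := rint_exp_abs e0.
pose k (z : R * R) := expR (- (e * `|z.1|)) * (a z.2 * cos (z.2 * z.1) + b z.2 * sin (z.2 * z.1)).
have mk : measurable_fun setT k.
  have m12 : measurable_fun setT (fun z : R * R => z.2 * z.1) by exact: measurable_funM.
  apply: measurable_funM.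
    exact: (measurableT_comp (intg_meas ie) measurable_fst).
  apply: measurable_funD; apply: measurable_funM.
  - exact: (measurableT_comp (intg_meas ia) measurable_snd).
  - apply: (measurableT_comp (f := @cos R) _ m12).
    by apply: continuous_measurable_fun; exact: continuous_cos.
  - exact: (measurableT_comp (intg_meas ib) measurable_snd).
  - apply: (measurableT_comp (f := @sin R) _ m12).
    by apply: continuous_measurable_fun; exact: continuous_sin.
have iab : intg (fun x => `|a x| + `|b x|) by apply: intgD; exact: intg_abs.
have kb x y : `|k (x, y)| <= `|expR (- (e * `|x|))| * `| `|a y| + `|b y| |.
  by rewrite normrM ler_wpM2l// [leRHS]ger0_norm ?addr_ge0// trig_bound.
have := rint_Fubini mk ie iab kb.
have -> : (fun x => rint (fun y => k (x, y))) = fun xi => expR (- (e * `|xi|)) * trigint a b xi.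
  by apply/funext => xi; rewrite -rintZ//; exact: trig_intg.
move=> ->.
have -> : (fun y => rint (fun x => k (x, y))) = fun x => a x * (2 * (e / (e ^+ 2 + x ^+ 2))).
  apply/funext => x; have [i1 r1] := rint_exp_cos x e0; have [i3 r3] := rint_exp_sin x e0.
  rewrite -[RHS]addr0 -r1 -[0](mulr0 (b x)) -r3 -!rintZ// -rintD; [|exact: intgZ..].
  by congr rint; apply/funext => t; rewrite /k /=; ring.
have ie2 : intg (fun x => a x * (2 * (e / (e ^+ 2 + x ^+ 2)))).
  have [_ [M aM]] := ta; have [B B0 aB] := rtest_bounded ta.
  have q0 x : 0 < e ^+ 2 + x ^+ 2 by rewrite ltr_pwDl ?exprn_gt0 ?sqr_ge0.
  apply: (@intg_bounded_supp _ _ (B * (2 * (e / e ^+ 2))) M).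
  - apply: measurable_funM; first exact: rtest_meas.
    apply: continuous_measurable_fun => x; apply: cvgMr; apply: cvgMr.
    apply: cvgV; first by rewrite gt_eqF.
    apply: cvgD; first exact: cvg_cst.
    by under eq_fun do rewrite expr2; apply: cvgM; exact: cvg_id.
  - move=> x; rewrite normrM ler_pM// ger0_norm; last first.
      by rewrite mulr_ge0// divr_ge0// ltW.
    by rewrite ler_wpM2l// ler_wpM2l ?(ltW e0)// lef_pV2 ?posrE ?exprn_gt0// lerDl sqr_ge0.
  - by move=> x /aM ->; rewrite mul0r.
have en0 : e != 0 by rewrite gt_eqF.
rewrite (rint_affine 0 en0 ie2) gtr0_norm// -rintZ; last exact: (intg_affine 0 en0 ie2).
congr rint; apply/funext => y; rewrite addr0 exprMn.
have y0 := oneDsq_gt0 y.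
have -> : e ^+ 2 + e ^+ 2 * y ^+ 2 = e ^+ 2 * (1 + y ^+ 2) by ring.
field; by rewrite en0 gt_eqF.
Qed.

Lemma eps_gt0 (n : nat) : 0 < n.+1%:R^-1 :> R.
Proof. by rewrite invr_gt0. Qed.

(** Fourier inversion at the origin: let e tend to 0 in the Abel means, on
    both sides by dominated convergence. The Poisson kernel has total mass 2
    pi. *)
Lemma rint_trigint a b : rtest a -> rtest b -> rint (trigint a b) = 2 * pi * a 0.
Proof.
move=> ta tb; have iD : intg (trigint a b) by apply: intg_is_trigint; exists a, b.
have e0 : (n.+1%:R^-1 : R) @[n --> \oo] --> (0 : R) by exact: cvg_harmonic.
pose A n := rint (fun xi => expR (- ((n.+1%:R^-1) * `|xi|)) * trigint a b xi).
have c1 : A n @[n --> \oo] --> rint (trigint a b).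
  apply: (proj2 (@rint_dct R (fun n xi => expR (- ((n.+1%:R^-1) * `|xi|)) * trigint a b xi) _
    (fun xi => `|trigint a b xi|) _ _ _ _)).
  - move=> n; apply: measurable_funM; last exact: intg_meas.
    by apply: continuous_measurable_fun; exact: exp_abs_continuous.
  - move=> x; rewrite -[X in _ --> X]mul1r; apply: cvgMl.
    rewrite -[X in _ --> X](@expR0 R) -oppr0 -(mul0r `|x|).
    have cx : - (n.+1%:R^-1 * `|x|) @[n --> \oo] --> - (0 * `|x|).
      by apply: cvgN; apply: cvgMl.
    exact: (cvg_comp _ _ cx (@continuous_expR R _)).
  - exact: intg_abs.
  - move=> n x; rewrite normrM ler_piMl// (ger0_norm (expR_ge0 _)).
    by rewrite -expR0 ler_expR oppr_le0 mulr_ge0.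
have [i r] := @rint_oneDsqrV R; have [B B0 aB] := rtest_bounded ta.
have c3 : A n @[n --> \oo] --> rint (fun y => a 0 * (2 * (1 + y ^+ 2)^-1)).
  have -> : A = fun n => rint (fun y => a (n.+1%:R^-1 * y) * (2 * (1 + y ^+ 2)^-1)).
    by apply/funext => n; rewrite /A abel_mean// eps_gt0.
  apply: (proj2 (@rint_dct R (fun n y => a (n.+1%:R^-1 * y) * (2 * (1 + y ^+ 2)^-1)) _
    (fun y => B * (2 * (1 + y ^+ 2)^-1)) _ _ _ _)).
  - move=> n; apply: measurable_funM; last by apply: intg_meas; exact: intgZ.
    apply: rtest_meas; have := @rtest_affine R a n.+1%:R^-1 0.
    by under [X in _ -> _ -> rtest X]eq_fun do rewrite addr0; apply => //; rewrite gt_eqF// eps_gt0.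
  - move=> y; apply: cvgMl.
    have cx : n.+1%:R^-1 * y @[n --> \oo] --> (0 : R).
      by rewrite -[X in _ --> X](mul0r y); apply: cvgMl.
    exact: (cvg_comp _ _ cx (@rtest_continuous _ _ ta 0)).
  - by apply: intgZ; exact: intgZ.
  - move=> n y; rewrite normrM ler_pM// ger0_norm// mulr_ge0// invr_ge0.
    by rewrite ltW// oneDsq_gt0.
rewrite -(cvg_lim (@Rhausdorff R) c1) (cvg_lim (@Rhausdorff R) c3).
rewrite rintZ; last exact: intgZ.
by rewrite rintZ// r; ring.
Qed.

Lemma fourier_translate g (xi y : R) : cintg g ->
  fourier g xi * expi (xi * y) = fourier (fun x => g (x + y)) xi.
Proof.
move=> gi; rewrite /fourier.
have n1 : (1 : R) != 0 by rewrite oner_neq0.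
have ig := fourier_cintg xi gi.
rewrite (cint_affine y n1 ig) normr1 mul1r mulrC -cintZ; last first.
  exact: (cintg_affine y n1 ig).
congr cintegral; apply/funext => x; rewrite !mul1r mulrCA -expiD; congr (_ * expi _).
ring.
Qed.

(** Translation reduces the inversion formula to its value at the origin. *)
Theorem fourier_inversion g y : testfun g ->
  fourier (fourier g) (- y) = (2 * pi)%:C * g y.
Proof.
move=> tg; have gi := testfun_cintg tg.
rewrite {1}/fourier.
have -> : (fun x => fourier g x * expi (- (x * - y))) = fourier (fun x => g (x + y)).
  by apply/funext => x; rewrite mulrN opprK fourier_translate.
have [tr ti] := (testfunP g).1 tg.
have n1 : (1 : R) != 0 by rewrite oner_neq0.
have sh a : rtest a -> rtest (fun x => a (x + y)).
  by move=> ta; have := rtest_affine y n1 ta; under eq_fun do rewrite mul1r.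
have Er : rint (fun xi => re (fourier (fun x => g (x + y)) xi)) = 2 * pi * re (g y).
  rewrite (_ : (fun xi => _) = trigint (fun x => re (g (x + y))) (fun x => im (g (x + y)))).
    by rewrite (rint_trigint (sh _ tr) (sh _ ti)) add0r.
  by apply/funext => xi; exact: fourier_re.
have Ei : rint (fun xi => im (fourier (fun x => g (x + y)) xi)) = 2 * pi * im (g y).
  rewrite (_ : (fun xi => _) = trigint (fun x => im (g (x + y))) (fun x => - re (g (x + y)))).
    by rewrite (rint_trigint (sh _ ti) (rtestN (sh _ tr))) add0r.
  by apply/funext => xi; exact: fourier_im.
rewrite cintE Er Ei.
by apply: complex_eq; rewrite ?reM ?imM /= ?mul0r ?subr0 ?addr0.
Qed.

End Inversion.

Section TestDistribution.
Context {R : realType}.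
Implicit Types (f g h : R -> R[i]).

Lemma cderiv0 h : cderiv 0 h = h.
Proof. by apply/funext => x; rewrite /cderiv !derive1n0; case: (h x). Qed.

Lemma schwartz_le m n h x : schwartz h ->
  `|x| ^+ m * cabs (cderiv n h x) <= schwartz_seminorm m n h.
Proof. by move=> [_ H]; apply: ub_le_sup; [exact: H|exists x]. Qed.

Lemma seminorm_ge0 m n h : schwartz h -> 0 <= schwartz_seminorm m n h :> R.
Proof.
by move=> sh; apply: le_trans (schwartz_le m n 0 sh); rewrite mulr_ge0 ?exprn_ge0 ?cabs_ge0.
Qed.

Lemma schwartz_cintg h : schwartz h -> cintg h /\
  rint (fun x => cabs (h x)) <= (schwartz_seminorm 0 0 h + schwartz_seminorm 2 0 h) * pi.
Proof.
move=> sh; have [smh _] := sh.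
have mh : cmeas h.
  have sr : rsmooth (fun x => re (h x)) by move=> n x; exact: (proj1 (smh n x)).
  have si : rsmooth (fun x => im (h x)) by move=> n x; exact: (proj2 (smh n x)).
  split; apply: continuous_measurable_fun; [exact: (rsmooth_continuous sr)|].
  exact: (rsmooth_continuous si).
have [|||ia ra] := @intg_decay R (fun x => cabs (h x)) (schwartz_seminorm 0 0 h) (schwartz_seminorm 2 0 h).
- exact: cmeas_abs.
- by move=> x; have := schwartz_le 0 0 x sh; rewrite expr0 mul1r cderiv0 ger0_norm ?cabs_ge0.
- by move=> x; have := schwartz_le 2 0 x sh; rewrite cderiv0 (ger0_norm (cabs_ge0 _)).
split; first by apply: (cintg_le mh ia) => x.
apply: le_trans ra; apply: rint_le => //; first exact: intg_abs.
by move=> x; exact: ler_norm.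
Qed.

(** Moving the inverse transform to the argument h defines the distribution with
    no regularity of h beyond integrability. *)
Definition inv_fourier_dist f : distr R := fun h =>
  ((2 * pi)^-1)%:C * cintegral (fun xi => f xi * fourier h (- xi)).

Lemma inv_fourier_cintg f h : testfun f -> cintg h ->
  cintg (fun xi => f xi * fourier h (- xi)) /\
  cabs (cintegral (fun xi => f xi * fourier h (- xi))) <=
    2 * (2 * rint (fun x => cabs (h x)) * rint (fun x => cabs (f x))).
Proof.
move=> tf hi; have fi := testfun_cintg tf.
have [mr mi] := fourier_cmeas hi.
have mo : measurable_fun setT (fun x : R => - x) by exact: oppr_measurable.
have mh : cmeas (fun xi => fourier h (- xi)).
  by split; [exact: (measurableT_comp mr mo)|exact: (measurableT_comp mi mo)].
have m := cmeasM (cintg_cmeas fi) mh.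
have b x : cabs (f x * fourier h (- x)) <= 2 * rint (fun x => cabs (h x)) * cabs (f x).
  by rewrite cabsM mulrC ler_wpM2r ?cabs_ge0// fourier_bound.
have ib : intg (fun x => 2 * rint (fun x => cabs (h x)) * cabs (f x)).
  by apply: intgZ; exact: cintg_abs.
split; first exact: cintg_le m ib b.
have := cint_bound m ib b; rewrite rintZ//; exact: cintg_abs.
Qed.

(** The transform of h is bounded by the L^1 norm of h, hence by two Schwartz
    seminorms. *)
Lemma inv_fourier_tempered f : testfun f -> tempered (inv_fourier_dist f).
Proof.
move=> tf; split.
  move=> c g h sg sh; have [gi _] := schwartz_cintg sg; have [hi _] := schwartz_cintg sh.
  rewrite /inv_fourier_dist fourier_lin//.
  have [ig _] := inv_fourier_cintg tf gi; have [ih _] := inv_fourier_cintg tf hi.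
  have -> : (fun xi => f xi * (c * fourier g (- xi) + fourier h (- xi))) =
      fun xi => c * (f xi * fourier g (- xi)) + f xi * fourier h (- xi).
    by apply/funext => xi; ring.
  by rewrite (cintD (cintgZ c ig) ih) (cintZ c ig) mulrDr mulrCA.
pose F := rint (fun x => cabs (f x)).
have F0 : 0 <= F by apply: rint_ge0 => x; exact: cabs_ge0.
exists (((2 * pi)^-1) * (4 * F * pi)), 3%N => h sh.
have [hi hb] := schwartz_cintg sh; have [_ b] := inv_fourier_cintg tf hi.
have p0 : 0 <= (2 * pi)^-1 :> R by rewrite invr_ge0 ltW// pi2_gt0.
rewrite /inv_fourier_dist cabsM cabs_real ger0_norm// -(mulrA _ (4 * F * pi)) ler_wpM2l//.
apply: (le_trans b); rewrite -/F.
apply: (@le_trans _ _ (4 * F * pi * (schwartz_seminorm 0 0 h + schwartz_seminorm 2 0 h))).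
  have H := ler_wpM2l F0 hb.
  have E1 (X : R) : 2 * (2 * X * F) = 4 * (F * X) by ring.
  have E2 (S : R) : 4 * F * pi * S = 4 * (F * (S * pi)) by ring.
  by rewrite E1 E2 ler_wpM2l.
rewrite ler_wpM2l//; first by rewrite !mulr_ge0// pi_ge0.
rewrite !big_ord_recr !big_ord0 /= !add0r.
have s m n := @seminorm_ge0 m n h sh.
move: (s 0%N 1%N) (s 0%N 2%N) (s 1%N 0%N) (s 1%N 1%N) (s 1%N 2%N) (s 2%N 1%N) (s 2%N 2%N) => {s}.
move: (schwartz_seminorm 0 0 h) (schwartz_seminorm 0 1 h) (schwartz_seminorm 0 2 h)
  (schwartz_seminorm 1 0 h) (schwartz_seminorm 1 1 h) (schwartz_seminorm 1 2 h)
  (schwartz_seminorm 2 0 h) (schwartz_seminorm 2 1 h) (schwartz_seminorm 2 2 h) => *; lra.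
Qed.

Lemma testfun_locintg a : @rtest R a -> locintg a.
Proof. by move=> ta; exact: (r2_locintg (r2_test 0 ta)). Qed.

(** This is Fourier inversion, applied to the test function on the right. *)
Theorem inv_fourier_represents f : testfun f -> represents f (fourier_dist (inv_fourier_dist f)).
Proof.
move=> tf; have [tr ti] := (testfunP f).1 tf.
split; [exact/locintgP/testfun_locintg|exact/locintgP/testfun_locintg|].
move=> g tg; rewrite /fourier_dist /inv_fourier_dist.
have [gi _] := schwartz_cintg (schwartz_fourier tg).
rewrite -cintZ; last by case: (inv_fourier_cintg tf gi).
have E : ((2 * pi)^-1)%:C * (2 * pi)%:C = 1 :> R[i].
  by rewrite -rmorphM mulVf// gt_eqF// pi2_gt0.
congr cintegral; apply/funext => xi; rewrite fourier_inversion// mulrCA.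
by rewrite (mulrA _ _ (g xi)) E mul1r.
Qed.

Lemma inv_fourier_sobolev tau f : testfun f -> sobolev tau (inv_fourier_dist f) /\
  aeq f (hatfun (inv_fourier_dist f)).
Proof.
move=> tf; have rf := inv_fourier_represents tf; have rh := hatfun_represents rf.
have E := represents_unique rf rh; split => //.
split; [exact: inv_fourier_tempered|by exists f|].
have [L _] := L2_aeq (represents_cmeas rh) E (testfun_L2 tau tf).
by rewrite /sobolev_sqnorm L2_sqnorm// ltry.
Qed.

End TestDistribution.

(** * Dilations and modulations *)

Section Dilation.
Context {R : realType}.
Implicit Types (a b : R -> R) (f g h : R -> R[i]) (T : distr R) (lambda : R).

Definition modulate lambda (k : int) f : R -> R[i] := fun y =>
  ((`|lambda| `^ (- 2^-1))%:C * expi (- (k%:~R * y)) * f (lambda^-1 * y)).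

Lemma dilate_modulateE lambda k T f : dilate_modulate lambda k T f = T (modulate lambda k f).
Proof. by []. Qed.

(** The change of variables that turns translates of dilates into modulated
    dilates; the power of |lambda| is the Jacobian. *)
Lemma fourier_dilate lambda (k : int) f y : lambda != 0 -> cintg f ->
  (`|lambda| `^ (- 2^-1))%:C * fourier f (lambda^-1 * (y + k%:~R)) =
  fourier (modulate lambda^-1 k f) y.
Proof.
move=> l0 fi; rewrite /fourier.
have ig := fourier_cintg (lambda^-1 * (y + k%:~R)) fi.
have igl := cintg_affine 0 l0 ig.
rewrite (cint_affine 0 l0 ig) mulrA -rmorphM -cintZ//.
congr cintegral; apply/funext => x; rewrite /modulate addr0 invrK.
have -> : `|lambda| `^ (- 2^-1) * `|lambda| = `|lambda^-1| `^ (- 2^-1).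
  have L0 : `|lambda| != 0 by rewrite normr_eq0.
  transitivity (`|lambda| `^ 2^-1).
    rewrite -[X in _ * X](powRr1 (normr_ge0 lambda)) -powRD ?L0 ?implybT//.
    by congr (_ `^ _); field.
  by rewrite normfV -(powR_inv1 (normr_ge0 lambda)) -powRrM mulN1r opprK.
have -> : - (lambda * x * (lambda^-1 * (y + k%:~R))) = - (k%:~R * x) + - (x * y).
  by field.
by rewrite expiD; ring.
Qed.

Lemma fourier_dist_dilate lambda k T f : lambda != 0 -> testfun f ->
  fourier_dist (dilate_translate lambda k T) f = dilate_modulate lambda^-1 k (fourier_dist T) f.
Proof.
move=> l0 tf; rewrite dilate_modulateE /fourier_dist /dilate_translate; congr T.
by apply/funext => y; rewrite fourier_dilate//; exact: testfun_cintg.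
Qed.

Lemma rsmooth_expi_testfun (k : R) f : testfun f ->
  testfun (fun y => expi (- (k * y)) * f y).
Proof.
move=> /testfunP[fr fi]; apply/testfunP; split.
  under eq_fun do rewrite reM /= cosN sinN mulNr opprK.
  by apply: rtestD; apply: rtestMl => //; [exact: rsmooth_cos|exact: rsmooth_sin].
under eq_fun do rewrite imM /= cosN sinN mulNr.
by apply: rtestB; apply: rtestMl => //; [exact: rsmooth_cos|exact: rsmooth_sin].
Qed.

Lemma modulate_testfun lambda k f : lambda != 0 -> testfun f -> testfun (modulate lambda k f).
Proof.
move=> l0 tf; rewrite /modulate.
have -> : (fun y => (`|lambda| `^ (- 2^-1))%:C * expi (- (k%:~R * y)) * f (lambda^-1 * y)) =
   fun y => (`|lambda| `^ (- 2^-1))%:C * (expi (- (k%:~R * y)) * f (lambda^-1 * y)).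
  by apply/funext => y; rewrite mulrA.
apply: testfunZ; apply: rsmooth_expi_testfun.
have li0 : lambda^-1 != 0 by rewrite invr_eq0.
move: tf => /testfunP[fr fi]; apply/testfunP; split.
  by have := rtest_affine 0 li0 fr; under eq_fun do rewrite addr0.
by have := rtest_affine 0 li0 fi; under eq_fun do rewrite addr0.
Qed.

(** Modulation does not change absolute values, and dilations are bounded on
    weighted spaces. *)
Lemma modulate_nrm tau lambda k : lambda != 0 -> exists2 K : R, 0 <= K &
  forall f, testfun f -> nrm tau (modulate lambda k f) <= K * nrm tau f.
Proof.
move=> l0; have [K K0 HK] := wt_scale tau l0.
pose c := `|lambda| `^ (- 2^-1).
exists (c ^+ 2 * `|lambda| * K).
  by rewrite !mulr_ge0 ?exprn_ge0 ?powR_ge0// ltW.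
move=> f tf.
have [[m1 i1] <-] := L2_abs (testfun_L2 tau (modulate_testfun k l0 tf)).
have [[m2 i2] <-] := L2_abs (testfun_L2 tau tf).
have i1' := intg_affine 0 l0 i1.
rewrite /q2 (rint_affine 0 l0 i1) -(rintZ _ i1') -(rintZ _ i2); apply: rint_le.
- exact: intgZ.
- exact: intgZ.
- move=> x; rewrite addr0 /modulate !cabsM cabs_expi cabs_real mulr1 mulKf//.
  rewrite (ger0_norm (powR_ge0 _ _)) -/c exprMn.
  have := HK x; rewrite -(ler_pM2l (x := `|lambda|)) ?normr_gt0//.
  have S0 : 0 <= c ^+ 2 * cabs (f x) ^+ 2 by rewrite mulr_ge0 ?sqr_ge0.
  move=> /(ler_wpM2l S0) H.
  have -> : `|lambda| * (c ^+ 2 * cabs (f x) ^+ 2 * wt tau (lambda * x)) =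
    c ^+ 2 * cabs (f x) ^+ 2 * (`|lambda| * wt tau (lambda * x)) by ring.
  by apply: le_trans H _; rewrite le_eqVlt; apply/orP; left; apply/eqP; ring.
Qed.

Lemma dilate_modulate_bounded tau lambda k T : lambda != 0 -> test_bounded tau T ->
  test_bounded tau (dilate_modulate lambda k T).
Proof.
move=> l0 [K K0 HK]; have [C C0 HC] := modulate_nrm tau k l0.
exists (K * C); first exact: mulr_ge0.
move=> g tg; rewrite dilate_modulateE -mulrA.
apply: le_trans (HK _ (modulate_testfun k l0 tg)) _.
by rewrite ler_wpM2l// HC.
Qed.

Lemma dilate_modulate_linear lambda k T : lambda != 0 -> test_linear T ->
  test_linear (dilate_modulate lambda k T).
Proof.
move=> l0 TL c f g tf tg; rewrite !dilate_modulateE -TL; [|exact: modulate_testfun..].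
by congr T; apply/funext => y; rewrite /modulate; ring.
Qed.

(** The reason why one entry of the system determines its generator. *)
Lemma dilate_modulateK lambda T : lambda != 0 ->
  dilate_modulate lambda^-1 0 (dilate_modulate lambda 0 T) = T.
Proof.
move=> l0; apply/funext => f; rewrite !dilate_modulateE; congr T; apply/funext => y.
rewrite /modulate !mul0r oppr0 expi0 !mulr1 invrK mulVKf// mulrA -rmorphM.
by rewrite -powRM// -normrM divff// normr1 powR1 mul1r.
Qed.

End Dilation.

(** * Sums over the entries of a system *)

Section Families.
Variable R : realType.
Implicit Types I : choiceType.
Local Open Scope ereal_scope.

Lemma esum_ord (n : nat) (a : 'I_n -> \bar R) : (forall i, 0 <= a i) ->
  \esum_(i in [set: 'I_n]) a i = \sum_(i < n) a i.
Proof.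
move=> a0; rewrite esum_fset//; last exact: finite_finset.
rewrite (fsbigE (index_enum 'I_n)) ?index_enum_uniq//; first by apply: eq_bigl => i; rewrite in_setT.
by move=> i _; rewrite mem_index_enum.
Qed.

Lemma esum_prod I1 I2 (a : I1 * I2 -> \bar R) : (forall i, 0 <= a i) ->
  \esum_(i in [set: I1 * I2]) a i = \esum_(i in [set: I1]) \esum_(j in [set: I2]) a (i, j).
Proof.
move=> a0; rewrite (@esum_esum _ _ _ setT (fun=> setT) (fun i j => a (i, j)))//.
rewrite (_ : setT `*`` _ = setT); last by apply/seteqP; split.
by apply: eq_esum => -[].
Qed.

Lemma esum_sumtype I1 I2 (a : I1 + I2 -> \bar R) : (forall i, 0 <= a i) ->
  \esum_(i in [set: (I1 + I2)%type]) a i =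
  \esum_(i in [set: I1]) a (inl i) + \esum_(i in [set: I2]) a (inr i).
Proof.
move=> a0; rewrite (esumID (range inl))// setTI setTI.
rewrite esum_image; last by move=> x y _ _ [].
have -> : ~` range (@inl I1 I2) = range (@inr I1 I2).
  apply/seteqP; split => [[x|x]|_ [x _ <-] []]//= H; last by exists x.
  by exfalso; apply: H; exists x.
by rewrite esum_image// => x y _ _ [].
Qed.

(** A sum over all entries of a system is the sum, in the order of the frame
    definitions, over scales, generators and translations. *)
Lemma esum_sys r s (a : sysidx r s -> \bar R) : (forall i, 0 <= a i) ->
  \esum_(i in [set: sysidx r s]) a i =
  \sum_(l < r) \esum_(k in [set: int]) a (inl (l, k)) +
  \sum_(0 <= n <oo) \sum_(l < s) \esum_(k in [set: int]) a (inr (l, n, k)).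
Proof.
move=> a0; rewrite esum_sumtype//; congr (_ + _).
  rewrite esum_prod// esum_ord// => i; exact: esum_ge0.
rewrite esum_prod// esum_prod; last by move=> i; exact: esum_ge0.
rewrite esum_ord; last by move=> i; apply: esum_ge0 => *; exact: esum_ge0.
rewrite nneseries_esumT; last by move=> n; apply: sume_ge0 => *; exact: esum_ge0.
by rewrite esum_sum// => *; exact: esum_ge0.
Qed.

Local Close Scope ereal_scope.

(** For nonnegative families this says that the sum is at most M; finite sums
    keep all the estimates inside R. *)
Definition sum_le I (a : I -> R) (M : R) :=
  forall A : seq I, uniq A -> \sum_(i <- A) a i <= M.

Lemma esum_sum_le I (a : I -> R) M : (\esum_(i in [set: I]) (a i)%:E <= M%:E)%E <-> sum_le a M.
Proof.
split=> [H A uA|H].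
  rewrite -lee_fin -sumEFin; apply: le_trans _ H; apply: esum_ge.
  by exists [set` A]; [split => //; exact: finite_seq|rewrite -fsbig_seq].
rewrite ge_ereal_sup// => _ [A [fA _] <-].
by rewrite fsbig_finite//= sumEFin lee_fin; exact: H (finmap.fset_uniq _).
Qed.

Lemma sum_le_fin I (a : I -> R) : (forall i, 0 <= a i) ->
  (\esum_(i in [set: I]) (a i)%:E < +oo)%E ->
  sum_le a (fine (\esum_(i in [set: I]) (a i)%:E)).
Proof.
move=> a0 H; apply/esum_sum_le; rewrite fineK// ge0_fin_numE//.
by apply: esum_ge0 => i _; rewrite lee_fin.
Qed.

Lemma sum_le_lty I (a : I -> R) M : sum_le a M -> (\esum_(i in [set: I]) (a i)%:E < +oo)%E.
Proof. by move/esum_sum_le => H; apply: le_lt_trans H _; rewrite ltry. Qed.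

Lemma sum_le_ge0 I (a : I -> R) M : sum_le a M -> 0 <= M.
Proof. by move=> /(_ [::] isT); rewrite big_nil. Qed.

Lemma sum_le_mono I (a b : I -> R) M : (forall i, a i <= b i) -> sum_le b M -> sum_le a M.
Proof. by move=> ab bM A uA; apply: le_trans (bM A uA); apply: ler_sum. Qed.

Lemma sum_leW I (a : I -> R) M M' : M <= M' -> sum_le a M -> sum_le a M'.
Proof. by move=> MM' aM A uA; apply: le_trans (aM A uA) MM'. Qed.

Lemma sum_le_comp I1 I2 (e : I1 -> I2) (a : I2 -> R) M : injective e ->
  sum_le a M -> sum_le (a \o e) M.
Proof.
move=> ei aM A uA; have := aM (map e A); rewrite big_map; apply.
by rewrite map_inj_uniq.
Qed.

Lemma sum_le_term I (a : I -> R) M i : sum_le a M -> a i <= M.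
Proof. by move=> /(_ [:: i] isT); rewrite big_seq1. Qed.

(** Cauchy-Schwarz for families with reciprocal weights; the weights of orders
    tau and -tau are of this kind. *)
Lemma sum_le_cs I (p q a b : I -> R) (A B S : R) :
  (forall i, 0 < p i) -> (forall i, p i * q i = 1) ->
  (forall i, 0 <= a i) -> (forall i, 0 <= b i) ->
  sum_le (fun i => p i * a i ^+ 2) A -> sum_le (fun i => q i * b i ^+ 2) B ->
  0 <= S -> A * B <= S ^+ 2 -> sum_le (fun i => a i * b i) S.
Proof.
move=> p0 pq a0 b0 sA sB S0 ABS X uX.
have X0 : 0 <= \sum_(i <- X) a i * b i by apply: sumr_ge0 => i _; exact: mulr_ge0.
rewrite -(@ler_pXn2r _ 2)// ?nnegrE//; apply: le_trans _ ABS.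
apply: amgm_cs => //; [exact: sum_le_ge0 sA|exact: sum_le_ge0 sB|] => t t0.
apply: (@le_trans _ _ (\sum_(i <- X) (t * (p i * a i ^+ 2) + t^-1 * (q i * b i ^+ 2)))).
  rewrite mulr_sumr; apply: ler_sum => i _.
  have -> : q i = (p i)^-1 by apply: (mulfI (lt0r_neq0 (p0 i))); rewrite pq divff// lt0r_neq0.
  set w := t * p i; have w0 : 0 < w by exact: mulr_gt0.
  have -> : t * (p i * a i ^+ 2) + t^-1 * ((p i)^-1 * b i ^+ 2) = w^-1 * ((w * a i) ^+ 2 + b i ^+ 2).
    by rewrite /w; field; rewrite !lt0r_neq0.
  have -> : 2 * (a i * b i) = w^-1 * (2 * (w * a i) * b i).
    by rewrite /w; field; rewrite !lt0r_neq0.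
  apply: ler_wpM2l; first by rewrite invr_ge0 ltW.
  rewrite -subr_ge0.
  have -> : (w * a i) ^+ 2 + b i ^+ 2 - 2 * (w * a i) * b i = (w * a i - b i) ^+ 2 by ring.
  exact: sqr_ge0.
by rewrite big_split/= -!mulr_sumr lerD// ler_pM2l ?invr_gt0//; [exact: sA|exact: sB].
Qed.

(** The sum of a family does not depend on the way in which it is written as a
    difference of two summable nonnegative families; as positive parts are not
    additive, the additivity of the sum rests on this. *)
Lemma rsumZ_sub (u P Q : int -> R) M : (forall k, 0 <= P k) -> (forall k, 0 <= Q k) ->
  (forall k, u k = P k - Q k) -> sum_le P M -> sum_le Q M ->
  rsumZ u = fine (\esum_(k in [set: int]) (P k)%:E) - fine (\esum_(k in [set: int]) (Q k)%:E).
Proof.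
move=> P0 Q0 uE PM QM.
have fP (X : int -> R) : (forall k, 0 <= X k) -> sum_le X M ->
    (\esum_(k in [set: int]) (X k)%:E)%E \is a fin_num.
  move=> X0 /sum_le_lty H; rewrite ge0_fin_numE//.
  by apply: esum_ge0 => i _; rewrite lee_fin.
have sP (X : int -> R) : (forall k, 0 <= X k) -> sum_le X M -> summable setT (fun k => (X k)%:E).
  move=> X0 /sum_le_lty H; rewrite /summable (eq_esum (b := fun k => (X k)%:E))// => k _.
  by rewrite /= ger0_norm.
have := esumB (sP _ P0 PM) (sP _ Q0 QM) ltac:(by move=> *; rewrite lee_fin) ltac:(by move=> *; rewrite lee_fin).
have -> : ((fun k => (P k)%:E) \- (fun k => (Q k)%:E))%E = (fun k => (u k)%:E).
  by apply/funext => k; rewrite uE.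
set u1 := esum _ _; set u2 := esum _ _ => H.
have mx (X Y : R) : 0 <= X -> 0 <= Y -> Num.max (X - Y) 0 <= X.
  by move=> X0 Y0; rewrite ge_max X0 andbT gerBl.
have f1 : u1 \is a fin_num.
  rewrite (_ : u1 = \esum_(k in [set: int]) (Num.max (u k) 0)%:E)%E; last first.
    by apply: eq_esum => k _; rewrite ?funeposE ?funenegE EFin_max.
  apply: fP => [k|]; first by rewrite le_max lexx orbT.
  by apply: sum_le_mono PM => k; rewrite uE mx.
have f2 : u2 \is a fin_num.
  rewrite (_ : u2 = \esum_(k in [set: int]) (Num.max (- u k) 0)%:E)%E; last first.
    by apply: eq_esum => k _; rewrite ?funeposE ?funenegE EFin_max.
  apply: fP => [k|]; first by rewrite le_max lexx orbT.
  by apply: sum_le_mono QM => k; rewrite uE opprB mx.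
have -> : rsumZ u = fine u1 - fine u2.
  by congr (fine _ - fine _); apply: eq_esum => k _; rewrite ?funeposE ?funenegE.
move: H; rewrite -(fineK f1) -(fineK f2) -(fineK (fP _ P0 PM)) -(fineK (fP _ Q0 QM)) -!EFinB.
by move=> [<-].
Qed.

Let pos (u : int -> R) k := Num.max (u k) 0.

Let pos_ge0 u k : 0 <= pos u k. Proof. by rewrite /pos le_max lexx orbT. Qed.
Let pos_le u k : pos u k <= `|u k|. Proof. by rewrite /pos ge_max ler_norm normr_ge0. Qed.
Let posN_le u k : pos (fun k => - u k) k <= `|u k|. Proof. by rewrite -normrN; exact: (pos_le (fun k => - u k)). Qed.
Let pos_sub u k : u k = pos u k - pos (fun k => - u k) k.
Proof. by rewrite /pos; case: (leP (u k) 0) => ?; case: (leP (- u k) 0) => ?; lra. Qed.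

Lemma rsumZ_le (u : int -> R) M : sum_le (fun k => `|u k|) M -> `|rsumZ u| <= M.
Proof.
move=> uM; have h1 := sum_le_mono (pos_le u) uM; have h2 := sum_le_mono (posN_le u) uM.
rewrite (@rsumZ_sub _ _ _ M (pos_ge0 u) (pos_ge0 _) (pos_sub u))//.
have b (X : int -> R) : (forall k, 0 <= X k) -> sum_le X M -> 0 <= fine (\esum_(k in [set: int]) (X k)%:E)%E <= M.
  move=> X0 XM; have e0 : (0 <= \esum_(k in [set: int]) (X k)%:E)%E by apply: esum_ge0 => *; rewrite lee_fin.
  rewrite fine_ge0//= -lee_fin fineK; first exact/esum_sum_le.
  by rewrite ge0_fin_numE// (sum_le_lty XM).
have /andP[a1 a2] := b _ (pos_ge0 u) h1; have /andP[b1 b2] := b _ (pos_ge0 _) h2.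
by rewrite ler_norml; lra.
Qed.

Lemma rsumZD (u v : int -> R) M : sum_le (fun k => `|u k|) M -> sum_le (fun k => `|v k|) M ->
  rsumZ (fun k => u k + v k) = rsumZ u + rsumZ v.
Proof.
move=> uM vM; have u1 := sum_le_mono (pos_le u) uM; have u2 := sum_le_mono (posN_le u) uM.
have v1 := sum_le_mono (pos_le v) vM; have v2 := sum_le_mono (posN_le v) vM.
rewrite (@rsumZ_sub u _ _ M (pos_ge0 u) (pos_ge0 _) (pos_sub u))//.
rewrite (@rsumZ_sub v _ _ M (pos_ge0 v) (pos_ge0 _) (pos_sub v))//.
have sD (X Y : int -> R) : sum_le X M -> sum_le Y M -> sum_le (fun k => X k + Y k) (M + M).
  by move=> XM YM A uA; rewrite big_split/= lerD ?XM ?YM.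
rewrite (@rsumZ_sub _ (fun k => pos u k + pos v k)
  (fun k => pos (fun k => - u k) k + pos (fun k => - v k) k) (M + M)); first last.
- exact: sD.
- exact: sD.
- by move=> k; rewrite [in LHS](pos_sub u) [in LHS](pos_sub v); lra.
- by move=> k; rewrite addr_ge0.
- by move=> k; rewrite addr_ge0.
have fP (X : int -> R) : (forall k, 0 <= X k) -> sum_le X M ->
    (\esum_(k in [set: int]) (X k)%:E)%E \is a fin_num.
  move=> X0 /sum_le_lty H; rewrite ge0_fin_numE//.
  by apply: esum_ge0 => i _; rewrite lee_fin.
have eD (X Y : int -> R) : (forall k, 0 <= X k) -> (forall k, 0 <= Y k) ->
    sum_le X M -> sum_le Y M ->
    fine (\esum_(k in [set: int]) (X k + Y k)%:E) =
    fine (\esum_(k in [set: int]) (X k)%:E) + fine (\esum_(k in [set: int]) (Y k)%:E).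
  move=> X0 Y0 XM YM; rewrite -fineD ?fP// -esumD// => k _; rewrite lee_fin//.
rewrite (eD _ _ (pos_ge0 u) (pos_ge0 v) u1 v1) (eD _ _ (pos_ge0 _) (pos_ge0 _) u2 v2).
by rewrite opprD addrACA.
Qed.

Lemma csumZ_le (u : int -> R[i]) M : sum_le (fun k => cabs (u k)) M -> cabs (csumZ u) <= 2 * M.
Proof.
move=> uM.
have hr : `|rsumZ (fun k => re (u k))| <= M.
  by apply: rsumZ_le; apply: sum_le_mono uM => k; exact: re_cabs.
have hi : `|rsumZ (fun k => im (u k))| <= M.
  by apply: rsumZ_le; apply: sum_le_mono uM => k; exact: im_cabs.
apply: le_trans (cabs_le _) _; rewrite /csumZ /=; lra.
Qed.

Lemma csumZD (u v : int -> R[i]) M : sum_le (fun k => cabs (u k)) M ->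
  sum_le (fun k => cabs (v k)) M -> csumZ (fun k => u k + v k) = csumZ u + csumZ v.
Proof.
move=> uM vM; rewrite /csumZ.
under [in X in X +i* _]eq_fun do rewrite reD.
under [in X in _ +i* X]eq_fun do rewrite imD.
have rM (w : int -> R[i]) : sum_le (fun k => cabs (w k)) M -> sum_le (fun k => `|re (w k)|) M.
  by apply: sum_le_mono => k; exact: re_cabs.
have iM (w : int -> R[i]) : sum_le (fun k => cabs (w k)) M -> sum_le (fun k => `|im (w k)|) M.
  by apply: sum_le_mono => k; exact: im_cabs.
rewrite (rsumZD (rM _ uM) (rM _ vM)) (rsumZD (iM _ uM) (iM _ vM)).
by apply: complex_eq; rewrite ?reD ?imD.
Qed.

Section System.
Variables r s : nat.
Notation I := (sysidx r s).

Lemma inl_pair_inj (l : 'I_r) : injective (fun k : int => inl (l, k) : I).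
Proof. by move=> x y []. Qed.

Lemma inr_pair_inj (l : 'I_s) n : injective (fun k : int => inr (l, n, k) : I).
Proof. by move=> x y []. Qed.

Lemma partial_sys_sumD (u v : I -> R[i]) M N : sum_le (fun i => cabs (u i)) M ->
  sum_le (fun i => cabs (v i)) M ->
  partial_sys_sum (fun i => u i + v i) N = partial_sys_sum u N + partial_sys_sum v N.
Proof.
move=> uM vM; rewrite /partial_sys_sum.
have cD (e : int -> I) : injective e -> csumZ (fun k => u (e k) + v (e k)) =
    csumZ (fun k => u (e k)) + csumZ (fun k => v (e k)).
  by move=> ei; apply: (@csumZD _ _ M); [exact: sum_le_comp ei uM|exact: sum_le_comp ei vM].
rewrite addrACA -big_split/= -big_split/=; congr (_ + _); apply: eq_bigr => l _.
  by rewrite (cD _ (@inl_pair_inj l)).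
by rewrite -big_split/=; apply: eq_bigr => j _; rewrite (cD _ (@inr_pair_inj j l)).
Qed.

Lemma cabs_sum (K : Type) (e : seq K) (F : K -> R[i]) : cabs (\sum_(i <- e) F i) <= \sum_(i <- e) cabs (F i).
Proof.
elim: e => [|x e IH]; first by rewrite !big_nil cabs0.
by rewrite !big_cons; apply: le_trans (cabsD _ _) _; rewrite lerD2l.
Qed.

(** The bound is uniform in the number of scales, which is what the density
    argument for the duality identity needs. *)
Lemma partial_sys_sum_le (u : I -> R[i]) M N : sum_le (fun i => cabs (u i)) M ->
  cabs (partial_sys_sum u N) <= 2 * M.
Proof.
move=> uM; pose e (w : int -> R[i]) := (\esum_(k in [set: int]) (cabs (w k))%:E)%E.
have e0 w : (0 <= e w)%E by apply: esum_ge0 => *; rewrite lee_fin cabs_ge0.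
have eb w : sum_le (fun k => cabs (w k)) M -> cabs (csumZ w) <= 2 * fine (e w) /\ e w \is a fin_num.
  move=> wM; split; first by apply: csumZ_le; apply: sum_le_fin (sum_le_lty wM) => k; exact: cabs_ge0.
  by rewrite ge0_fin_numE// (sum_le_lty wM).
pose el (l : 'I_r) := e (fun k => u (inl (l, k))).
pose er n (l : 'I_s) := e (fun k => u (inr (l, n, k))).
have G l := eb (fun k => u (inl (l, k))) (sum_le_comp (@inl_pair_inj l) uM).
have H n l := eb (fun k => u (inr (l, n, k))) (sum_le_comp (@inr_pair_inj l n) uM).
have tot : (\sum_(l < r) el l + \sum_(n < N) \sum_(l < s) er n l <= M%:E)%E.
  have /esum_sum_le := uM; rewrite esum_sys; last by move=> i; rewrite lee_fin cabs_ge0.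
  apply: le_trans; rewrite leeD2l// -(big_mkord xpredT (fun n => \sum_(l < s) er n l)%E).
  apply: nneseries_lim_ge => n _ _; apply: sume_ge0 => l _; exact: e0.
have fin : \sum_(l < r) fine (el l) + \sum_(n < N) \sum_(l < s) fine (er n l) <= M.
  rewrite -lee_fin EFinD -!sumEFin; apply: le_trans tot; apply: leeD; apply: lee_sum => l _.
    by rewrite fineK//; case: (G l).
  by rewrite -sumEFin; apply: lee_sum => j _; rewrite fineK//; case: (H l j).
apply: (@le_trans _ _ (2 * (\sum_(l < r) fine (el l) + \sum_(n < N) \sum_(l < s) fine (er n l)))); last by rewrite ler_pM2l.
rewrite mulrDr !mulr_sumr; apply: le_trans (cabsD _ _) _; apply: lerD; apply: le_trans (cabs_sum _ _) _; apply: ler_sum => l _.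
  by case: (G l).
rewrite mulr_sumr; apply: le_trans (cabs_sum _ _) _; apply: ler_sum => j _.
by case: (H l j).
Qed.

End System.
End Families.

(** * Coefficients, density and lower bounds *)

Section Coefficients.
Variable R : realType.
Implicit Types (tau : R) (F G h : R -> R[i]).

(** The coefficient of F with respect to an entry with transform h, up to the
    factor 1 / (2 pi). *)
Definition coef h F : R[i] := cintegral (fun x => F x * conjc (h x)).

Lemma coef_intg tau h F : L2 tau h -> L2 (- tau) F -> cintg (fun x => F x * conjc (h x)).
Proof. by move=> /L2J[hL _] FL; case: (L2_pair FL hL). Qed.

Lemma coef_le tau h F : L2 tau h -> L2 (- tau) F ->
  cabs (coef h F) ^+ 2 <= 4 * (nrm (- tau) F * nrm tau h).
Proof.
move=> /L2J[hL hn] FL; case: (L2_pair FL hL) => _ /le_trans; apply.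
by rewrite ler_pM2l// ler_wpM2l ?nrm_ge0.
Qed.

Lemma coefB tau h F G : L2 tau h -> L2 (- tau) F -> L2 (- tau) G ->
  coef h (fun x => F x - G x) = coef h F - coef h G.
Proof.
move=> hL FL GL; rewrite /coef -cintB; [|exact: coef_intg hL _..].
by congr cintegral; apply/funext => x; rewrite mulrBl.
Qed.

Lemma coefJ tau h F : L2 tau h -> L2 (- tau) F -> coef F h = conjc (coef h F).
Proof.
move=> hL FL; rewrite /coef -cintJ; last exact: coef_intg hL FL.
by congr cintegral; apply/funext => x; rewrite conjcM conjcK mulrC.
Qed.

(** A bound on the coefficients of test functions passes to all functions of
    the space by density: on finitely many coefficients the pairing with the
    h i is continuous. *)
Lemma coef_bound_dense (I : choiceType) (p : I -> R) (h : I -> R -> R[i]) tau K :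
  (forall i, 0 <= p i) -> (forall i, L2 tau (h i)) -> 0 <= K ->
  (forall f, testfun f -> sum_le (fun i => p i * cabs (coef (h i) f) ^+ 2) (K * nrm (- tau) f)) ->
  forall F, L2 (- tau) F -> sum_le (fun i => p i * cabs (coef (h i) F) ^+ 2) (4 * K * nrm (- tau) F).
Proof.
move=> p0 hL K0 Hf F FL A uA; apply/ler_addgt0Pr => e e0.
pose D := \sum_(i <- A) p i * (4 * nrm tau (h i)).
have D0 : 0 <= D by apply: sumr_ge0 => i _; rewrite !mulr_ge0 ?nrm_ge0.
have q0 : 0 < 4 * K + 2 * D + 1 by rewrite ltr_wpDl// addr_ge0// mulr_ge0.
have [f tf fF] := L2_approx FL (divr_gt0 e0 q0).
set dl := e / _ in fF.
have dl0 : 0 < dl by exact: divr_gt0.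
have fL := testfun_L2 (- tau) tf; have [BL _] := L2B FL fL.
have nf : nrm (- tau) f <= 2 * nrm (- tau) F + 2 * dl.
  have [_] := L2B FL BL; rewrite (_ : (fun x => F x - (F x - f x)) = f); last first.
    by apply/funext => x; rewrite subKr.
  by move: fF; set a := nrm _ _; set b := nrm _ f; set c := nrm _ F => *; lra.
have term i : p i * cabs (coef (h i) F) ^+ 2 <=
    2 * (p i * cabs (coef (h i) f) ^+ 2) + 2 * (p i * (4 * nrm tau (h i)) * dl).
  have -> : coef (h i) F = coef (h i) f + coef (h i) (fun x => F x - f x).
    by rewrite (coefB (hL i) FL fL) addrC subrK.
  set a := coef _ f; set b := coef _ _.
  have hb : cabs b ^+ 2 <= 4 * nrm tau (h i) * dl.
    apply: le_trans (coef_le (hL i) BL) _.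
    by rewrite -mulrA ler_pM2l// mulrC ler_wpM2l ?nrm_ge0.
  have hab : cabs (a + b) ^+ 2 <= 2 * cabs a ^+ 2 + 2 * cabs b ^+ 2.
    apply: le_trans (sqr_sum_le _ _).
    by rewrite lerXn2r ?nnegrE ?addr_ge0 ?cabs_ge0// cabsD.
  apply: (@le_trans _ _ (p i * (2 * cabs a ^+ 2 + 2 * (4 * nrm tau (h i) * dl)))).
    by rewrite ler_wpM2l//; apply: le_trans hab _; rewrite lerD2l ler_pM2l.
  by rewrite le_eqVlt; apply/orP; left; apply/eqP; ring.
apply: (@le_trans _ _ (2 * (K * nrm (- tau) f) + 2 * (D * dl))).
  apply: le_trans (ler_sum _ (fun i _ => term i)) _.
  by rewrite big_split/= -!mulr_sumr -mulr_suml lerD2r ler_pM2l//; exact: Hf tf _ uA.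
have h1 : K * nrm (- tau) f <= K * (2 * nrm (- tau) F + 2 * dl) by rewrite ler_wpM2l.
have h2 : (4 * K + 2 * D + 1) * dl = e by rewrite /dl mulrC divfK// lt0r_neq0.
rewrite -h2; move: h1 dl0; move: (nrm _ F) (nrm _ f) => x y h1 dl0.
have -> : 4 * K * x + (4 * K + 2 * D + 1) * dl = 2 * (K * (2 * x + 2 * dl)) + 2 * (D * dl) + dl by ring.
apply: ler_wpDr; first exact: ltW.
by rewrite lerD2r ler_pM2l.
Qed.

(** Multiplication by the weight is the isometry between the two dual spaces
    under which the pairing becomes the squared norm. *)
Lemma riesz_dual tau F : L2 (- tau) F ->
  [/\ L2 tau (fun x => (wt (- tau) x)%:C * F x),
      nrm tau (fun x => (wt (- tau) x)%:C * F x) = nrm (- tau) F &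
      coef (fun x => (wt (- tau) x)%:C * F x) F = (nrm (- tau) F)%:C].
Proof.
move=> FL; have [[mr ir] [mi ii]] := FL.
have E (a : R -> R) x : (wt (- tau) x * a x) ^+ 2 * wt tau x = a x ^+ 2 * wt (- tau) x.
  have := wtNK tau x; move: (wt tau x) (wt (- tau) x) => u v uv.
  by rewrite -[RHS]mulr1 -uv; ring.
have ER : (fun x => re ((wt (- tau) x)%:C * F x)) = fun x => wt (- tau) x * re (F x).
  by apply/funext => x; rewrite reM /= mul0r subr0.
have EI : (fun x => im ((wt (- tau) x)%:C * F x)) = fun x => wt (- tau) x * im (F x).
  by apply/funext => x; rewrite imM /= mul0r addr0.
split.
- rewrite /L2; cbv beta; rewrite ER EI; split; (split; first by apply: measurable_funM => //; exact: wt_meas).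
    by under eq_fun do rewrite (E (fun x => re (F x))).
  by under eq_fun do rewrite (E (fun x => im (F x))).
- rewrite /nrm; cbv beta; rewrite ER EI.
  have qE (a : R -> R) : q2 tau (fun x => wt (- tau) x * a x) = q2 (- tau) a.
    by rewrite /q2; congr rint; apply/funext => x; exact: E.
  by rewrite (qE (fun x => re (F x))) (qE (fun x => im (F x))).
rewrite /coef /nrm /q2 -rintD//.
have -> : (fun x => F x * conjc ((wt (- tau) x)%:C * F x)) =
    fun x => (re (F x) ^+ 2 * wt (- tau) x + im (F x) ^+ 2 * wt (- tau) x)%:C.
  apply/funext => x; apply: complex_eq; rewrite ?reM ?imM reJ imJ reM imM /=; ring.
rewrite cintE /=; apply: complex_eq => //=.
by rewrite rint0.
Qed.

End Coefficients.

Section DualPair.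
Variable R : realType.
Variables (r s : nat) (tau K1 K2 : R) (p q : sysidx r s -> R).
Variables h ht : sysidx r s -> R -> R[i].
Implicit Types F G : R -> R[i].
Hypotheses (p0 : forall i, 0 < p i) (pq : forall i, p i * q i = 1).
Hypotheses (hL : forall i, L2 tau (h i)) (htL : forall i, L2 (- tau) (ht i)).
Hypotheses (K1_ge0 : 0 <= K1) (K2_ge0 : 0 <= K2).
Hypothesis Bh : forall F, L2 (- tau) F ->
  sum_le (fun i => p i * cabs (coef (h i) F) ^+ 2) (K1 * nrm (- tau) F).
Hypothesis Bht : forall G, L2 tau G ->
  sum_le (fun i => q i * cabs (coef (ht i) G) ^+ 2) (K2 * nrm tau G).

(** The terms of the duality identity. *)
Definition products F G i := coef (h i) F * conjc (coef (ht i) G).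

Lemma products_le F G A B S :
  sum_le (fun i => p i * cabs (coef (h i) F) ^+ 2) A ->
  sum_le (fun i => q i * cabs (coef (ht i) G) ^+ 2) B ->
  0 <= S -> A * B <= S ^+ 2 -> sum_le (fun i => cabs (products F G i)) S.
Proof.
move=> sA sB S0 AB; have := sum_le_cs p0 pq (fun i => cabs_ge0 (coef (h i) F))
  (fun i => cabs_ge0 (coef (ht i) G)) sA sB S0 AB.
by apply: sum_le_mono => i; rewrite /products cabsM cabs_conj.
Qed.

Lemma products_L2 F G : L2 (- tau) F -> L2 tau G ->
  sum_le (fun i => cabs (products F G i))
    (Num.sqrt (K1 * nrm (- tau) F * (K2 * nrm tau G))).
Proof.
move=> FL GL; apply: (products_le (Bh FL) (Bht GL)); first exact: sqrtr_ge0.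
by rewrite sqr_sqrtr// !mulr_ge0 ?nrm_ge0.
Qed.

Lemma productsDl F f G : L2 (- tau) F -> L2 (- tau) f -> L2 tau G ->
  products F G = fun i => products (fun x => F x - f x) G i + products f G i.
Proof.
by move=> FL fL GL; apply/funext => i; rewrite /products (coefB (hL i) FL fL) -mulrDl subrK.
Qed.

Lemma productsDr F G g : L2 (- tau) F -> L2 tau G -> L2 tau g ->
  products F G = fun i => products F (fun x => G x - g x) i + products F g i.
Proof.
move=> FL GL gL; apply/funext => i; rewrite /products.
rewrite (@coefB _ (- tau)) ?opprK//.
by rewrite -mulrDr -conjcD subrK.
Qed.

Let err N F G := partial_sys_sum (products F G) N - (2 * pi)%:C * coef G F.

Let errDl N F f G : L2 (- tau) F -> L2 (- tau) f -> L2 tau G ->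
  err N F G = err N (fun x => F x - f x) G + err N f G.
Proof.
move=> FL fL GL; have [BL _] := L2B FL fL.
rewrite /err {1}(productsDl FL fL GL).
have m1 := products_L2 BL GL; have m2 := products_L2 fL GL.
set M1 := Num.sqrt _ in m1; set M2 := Num.sqrt _ in m2.
rewrite (@partial_sys_sumD _ _ _ _ _ (Num.max M1 M2)); first last.
- by apply: sum_leW m2; rewrite le_max lexx orbT.
- by apply: sum_leW m1; rewrite le_max lexx.
rewrite (coefB GL FL fL) mulrBr [RHS]addrACA; congr (_ + _).
by rewrite -opprD subrK.
Qed.

Let errDr N F G g : L2 (- tau) F -> L2 tau G -> L2 tau g ->
  err N F G = err N F (fun x => G x - g x) + err N F g.
Proof.
move=> FL GL gL; have [BL _] := L2B GL gL.
rewrite /err {1}(productsDr FL GL gL).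
have m1 := products_L2 FL BL; have m2 := products_L2 FL gL.
set M1 := Num.sqrt _ in m1; set M2 := Num.sqrt _ in m2.
rewrite (@partial_sys_sumD _ _ _ _ _ (Num.max M1 M2)); first last.
- by apply: sum_leW m2; rewrite le_max lexx orbT.
- by apply: sum_leW m1; rewrite le_max lexx.
have -> : coef G F = coef (fun x => G x - g x) F + coef g F.
  rewrite -[in LHS](conjcK (coef G F)) -(coefJ GL FL) -(conjcK (coef _ F)) -(coefJ BL FL).
  rewrite -[in RHS](conjcK (coef g F)) -(coefJ gL FL) (@coefB _ (- tau)) ?opprK//.
  by rewrite -conjcD subrK.
by rewrite mulrDr opprD [RHS]addrACA.
Qed.

Let err_le N F G S : L2 (- tau) F -> L2 tau G -> 0 <= S ->
  (K1 * K2 + 4) * (nrm (- tau) F * nrm tau G) <= S ^+ 2 ->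
  cabs (err N F G) <= (2 + 2 * pi) * S.
Proof.
move=> FL GL S0 H; have nn : 0 <= nrm (- tau) F * nrm tau G by rewrite mulr_ge0 ?nrm_ge0.
have h1 : K1 * nrm (- tau) F * (K2 * nrm tau G) <= S ^+ 2.
  apply: le_trans H; rewrite mulrACA [leRHS]mulrDl; apply: ler_wpDr => //.
  by rewrite mulr_ge0.
have h2 : cabs (coef G F) <= S.
  rewrite -(@ler_pXn2r _ 2)// ?nnegrE ?cabs_ge0//; apply: le_trans (coef_le GL FL) _.
  apply: le_trans H; rewrite [leRHS]mulrDl; apply: ler_wpDl => //.
  by rewrite !mulr_ge0 ?nrm_ge0.
have h3 := partial_sys_sum_le N (products_le (Bh FL) (Bht GL) S0 h1).
apply: le_trans (cabsD _ _) _; rewrite cabsN cabsM cabs_real (ger0_norm (ltW (@pi2_gt0 R))) [leRHS]mulrDl.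
by apply: lerD => //; rewrite ler_pM2l ?pi2_gt0.
Qed.

(** The error between a partial sum and the pairing is bounded, uniformly in
    the number of scales, by a multiple of the product of the norms;
    convergence on a dense set therefore implies convergence. *)
Lemma dual_identity_dense :
  (forall f g, testfun f -> testfun g ->
     ccvg_to (partial_sys_sum (products f g)) ((2 * pi)%:C * coef g f)) ->
  forall F G, L2 (- tau) F -> L2 tau G ->
     ccvg_to (partial_sys_sum (products F G)) ((2 * pi)%:C * coef G F).
Proof.
move=> Htest F G FL GL.
suff : cabs (err N F G) @[N --> \oo] --> (0 : R) by [].
apply/cvgrPdist_lt => e e0.
have c0 : 0 < 2 + 2 * pi :> R by rewrite addr_gt0 ?pi2_gt0.
pose S := e / 3 / (2 + 2 * pi).
have S0 : 0 < S by rewrite !divr_gt0.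
have SE : (2 + 2 * pi) * S <= e / 3 by rewrite /S mulrC divfK ?lexx// lt0r_neq0.
have KK : 0 <= K1 * K2 + 4 by rewrite addr_ge0// mulr_ge0.
have den (x : R) : 0 <= x -> 0 < (K1 * K2 + 4) * x + 1 by move=> x0; rewrite ltr_wpDl// mulr_ge0.
have small (x y : R) : 0 <= x -> 0 <= y -> y <= S ^+ 2 / ((K1 * K2 + 4) * x + 1) ->
    (K1 * K2 + 4) * (y * x) <= S ^+ 2.
  move=> x0 y0; rewrite ler_pdivlMr ?den// => H; apply: le_trans _ H.
  by rewrite mulrDr mulr1 mulrCA lerDl.
have S2 : 0 < S ^+ 2 by rewrite exprn_gt0.
have [f tf fF] := L2_approx FL (divr_gt0 S2 (den _ (nrm_ge0 tau G))).
have [g tg gG] := L2_approx GL (divr_gt0 S2 (den _ (nrm_ge0 (- tau) f))).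
have fL := testfun_L2 (- tau) tf; have gL := testfun_L2 tau tg.
have [FfL _] := L2B FL fL; have [GgL _] := L2B GL gL.
have e1 N : cabs (err N (fun x => F x - f x) G) <= e / 3.
  apply: le_trans (err_le N FfL GL (ltW S0) _) SE.
  by apply: (small _ _ (nrm_ge0 _ _) (nrm_ge0 _ _) fF).
have e2 N : cabs (err N f (fun x => G x - g x)) <= e / 3.
  apply: le_trans (err_le N fL GgL (ltW S0) _) SE.
  rewrite [nrm (- tau) f * _]mulrC.
  by apply: (small _ _ (nrm_ge0 _ _) (nrm_ge0 _ _) gG).
have cvfg : cabs (err N f g) @[N --> \oo] --> (0 : R) := Htest f g tf tg.
have /cvgrPdist_lt/(_ (e / 3) ltac:(by rewrite divr_gt0)) := cvfg.
have nE (z : R[i]) : `|0 - cabs z| = cabs z by rewrite sub0r normrN ger0_norm ?cabs_ge0.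
have E3 : e / 3 + (e / 3 + e / 3) = e by field.
apply: filterS => N; rewrite !nE => e3.
rewrite (errDl N FL fL GL) (errDr N fL GL gL) -[ltRHS]E3.
apply: le_lt_trans (cabsD _ _) _; apply: ler_ltD (e1 N) _.
by apply: le_lt_trans (cabsD _ _) _; exact: ler_ltD (e2 N) e3.
Qed.

(** Testing the identity against the Riesz dual of F turns the pairing into
    the squared norm of F, so that the Cauchy-Schwarz inequality for the
    coefficients gives a lower frame bound from an upper one. *)
Lemma dual_lower (u : sysidx r s -> R[i]) (n K X : R) (l : R[i]) :
  0 <= n -> 0 <= K -> 0 <= X ->
  (forall S, 0 <= S -> K * n * X <= S ^+ 2 -> sum_le (fun i => cabs (u i)) S) ->
  ccvg_to (partial_sys_sum u) l -> cabs l = 2 * pi * n -> n <= (K + 1) * X.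
Proof.
move=> n0 K_ge0 X0 H cv le.
pose S := Num.sqrt (K * n * X).
have KnX : 0 <= K * n * X by rewrite !mulr_ge0.
have S0 : 0 <= S by exact: sqrtr_ge0.
have SE : S ^+ 2 = K * n * X by rewrite sqr_sqrtr.
have uS : sum_le (fun i => cabs (u i)) S by apply: H; rewrite ?SE.
have lS : cabs l <= 2 * S.
  rewrite -subr_le0; have cv' : cabs (partial_sys_sum u N - l) @[N --> \oo] --> (0 : R) by [].
  rewrite leNgt; apply/negP => d0.
  have /cvgrPdist_lt/(_ _ d0)[N _ /(_ N (leqnn N))] := cv'.
  rewrite /= sub0r normrN ger0_norm ?cabs_ge0// => lt1.
  have := cabsD (partial_sys_sum u N) (- (partial_sys_sum u N - l)).
  rewrite cabsN opprB addrC subrK; have := partial_sys_sum_le N uS.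
  move: lt1; move: (cabs _) (cabs _) (cabs _) => a b c *; lra.
have [n00|n1] := leP n 0; first by apply: le_trans n00 _; rewrite mulr_ge0// addr_ge0.
have nS : n <= S.
  rewrite -(@ler_pM2l _ 2)//; apply: le_trans _ lS; rewrite le -mulrA ler_pM2l//.
  by rewrite ler_peMl//; apply: le_trans (pi_ge2 _); rewrite ler1n.
have : n * n <= K * X * n.
  rewrite [leRHS]mulrAC -SE expr2; exact: ler_pM.
rewrite ler_pM2r// => /le_trans; apply.
by rewrite mulrDl lerDl mul1r.
Qed.

Lemma dual_lowerl F X : L2 (- tau) F ->
  (forall F G, L2 (- tau) F -> L2 tau G ->
     ccvg_to (partial_sys_sum (products F G)) ((2 * pi)%:C * coef G F)) ->
  sum_le (fun i => p i * cabs (coef (h i) F) ^+ 2) X -> nrm (- tau) F <= (K2 + 1) * X.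
Proof.
move=> FL HD sX; have [GL nG cG] := riesz_dual FL.
have XG := sum_le_ge0 sX.
apply: (dual_lower (nrm_ge0 _ _) K2_ge0 XG _ (HD _ _ FL GL)); last first.
  by rewrite cG cabsM !cabs_real (ger0_norm (ltW (@pi2_gt0 R))) (ger0_norm (nrm_ge0 _ _)).
by move=> S S0 HS; apply: (products_le sX (Bht GL) S0); rewrite nG mulrC.
Qed.

Lemma dual_lowerr G X : L2 tau G ->
  (forall F G, L2 (- tau) F -> L2 tau G ->
     ccvg_to (partial_sys_sum (products F G)) ((2 * pi)%:C * coef G F)) ->
  sum_le (fun i => q i * cabs (coef (ht i) G) ^+ 2) X -> nrm tau G <= (K1 + 1) * X.
Proof.
move=> GL HD sX; have GL' : L2 (- - tau) G by rewrite opprK.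
have [FL nF cF] := riesz_dual GL'; rewrite opprK in FL nF cF.
have XG := sum_le_ge0 sX.
apply: (dual_lower (nrm_ge0 _ _) K1_ge0 XG _ (HD _ _ FL GL)); last first.
  by rewrite (coefJ FL) ?opprK// cF cabsM cabs_conj !cabs_real (ger0_norm (ltW (@pi2_gt0 R))) (ger0_norm (nrm_ge0 _ _)).
by move=> S S0 HS; apply: (products_le (Bh FL) sX S0); rewrite nF.
Qed.

End DualPair.

(** * Wavelet systems on the Fourier side *)

Section SobolevEntries.
Variable R : realType.
Implicit Types (T U : distr R) (tau lambda : R) (f g F G h : R -> R[i]).

(** By the representation theorem a continuous Fourier transform is a function
    of the dual weighted space. *)
Lemma bounded_sobolev tau T : tempered T -> test_bounded (- tau) (fourier_dist T) ->
  sobolev tau T.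
Proof.
move=> tT bT; have [F FL rF] := riesz (tempered_test_linear tT) bT.
rewrite opprK in FL; have rh := hatfun_represents rF.
split => //; first by exists F.
have [hL _] := L2_aeq (represents_cmeas rh) (represents_unique rF rh) FL.
by rewrite /sobolev_sqnorm (L2_sqnorm hL) ltry.
Qed.

(** Entries of a system stay in the Sobolev space of the generators; the
    transform of an entry is obtained from the representation theorem, since
    the chosen representatives are only determined almost everywhere. *)
Lemma dilate_translate_L2 tau lambda k T : lambda != 0 -> sobolev tau T ->
  L2 tau (hatfun (dilate_translate lambda k T)) /\
  represents (hatfun (dilate_translate lambda k T)) (dilate_modulate lambda^-1 k (fourier_dist T)).
Proof.
move=> l0 sT; have [hL rh] := sobolev_L2 sT; have lV0 : lambda^-1 != 0 by rewrite invr_eq0.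
have hL' : L2 (- - tau) (hatfun T) by rewrite opprK.
have [F FL rF] := riesz (dilate_modulate_linear k lV0 (represents_linear rh))
  (dilate_modulate_bounded k lV0 (represents_bounded hL' rh)).
rewrite opprK in FL.
have rF' : represents F (fourier_dist (dilate_translate lambda k T)).
  by case: rF => a b c; split => // g tg; rewrite fourier_dist_dilate// c.
have rH := hatfun_represents rF'.
have [HL _] := L2_aeq (represents_cmeas rH) (represents_unique rF' rH) FL.
split => //; case: rH => a b c; split => // g tg.
by rewrite -c// fourier_dist_dilate.
Qed.

Lemma pairl_coef tau h T f : L2 tau h -> represents h T -> testfun f -> pairl f T = coef h f.
Proof.
move=> hL [_ _ hT] tf; rewrite /pairl hT; last exact: testfunJ.
rewrite -cintJ; first by congr cintegral; apply/funext => x; rewrite conjcM conjcK mulrC.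
have hL' : L2 (- - tau) h by rewrite opprK.
by have [] := L2_pair hL' (testfun_L2 (- tau) (testfunJ tf)).
Qed.

Lemma pairr_coef tau h T g : L2 tau h -> represents h T -> testfun g ->
  pairr T g = conjc (coef h g).
Proof. by move=> hL hT tg; rewrite -(pairl_coef hL hT tg) /pairl conjcK. Qed.

Definition kappa : R := (2 * pi)^-1.

Lemma kappa_gt0 : 0 < kappa. Proof. by rewrite invr_gt0 pi2_gt0. Qed.

(** The factor 1 / (2 pi) of the Sobolev pairing is moved into the argument,
    so that all identities are used for plain coefficients and no sum has to
    be rescaled. *)
Definition scaled F : R -> R[i] := fun x => kappa%:C * F x.

Lemma coefZ tau (c : R[i]) h F : L2 tau h -> L2 (- tau) F ->
  coef h (fun x => c * F x) = c * coef h F.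
Proof.
move=> hL FL; rewrite /coef -cintZ; last exact: coef_intg hL FL.
by congr cintegral; apply/funext => x; rewrite mulrA.
Qed.

Lemma scaled_L2 tau F : L2 tau F ->
  L2 tau (scaled F) /\ nrm tau (scaled F) = kappa ^+ 2 * nrm tau F.
Proof.
move=> FL; have [sL s1] := L2Z kappa%:C FL; split => //.
have [_ s2] := L2Z (2 * pi)%:C sL.
have E : (fun x => (2 * pi)%:C * (kappa%:C * F x)) = F.
  apply/funext => x; rewrite mulrA -rmorphM /kappa divff ?mul1r//.
  by rewrite lt0r_neq0 ?pi2_gt0.
rewrite E cabs_real real_normK ?num_real// in s2; rewrite cabs_real real_normK ?num_real// in s1.
apply/eqP; rewrite eq_le s1 /= -/kappa /kappa exprVn.
by rewrite ler_pdivrMl ?exprn_gt0 ?pi2_gt0.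
Qed.

Lemma sobolev_pair_coef tau T U : L2 (- tau) (hatfun T) -> L2 tau (hatfun U) ->
  sobolev_pair T U = coef (hatfun U) (scaled (hatfun T)).
Proof. by move=> TL UL; rewrite /scaled (coefZ _ UL TL). Qed.

Lemma sobolev_pairC T U tau : L2 (- tau) (hatfun T) -> L2 tau (hatfun U) ->
  sobolev_pair U T = conjc (sobolev_pair T U).
Proof.
move=> TL UL; change ((kappa)%:C * coef (hatfun T) (hatfun U) = conjc ((kappa)%:C * coef (hatfun U) (hatfun T))).
by rewrite (coefJ UL TL) conjcM conjc_real.
Qed.

Lemma sobolev_pair_scaled tau T U : L2 (- tau) (hatfun T) -> L2 tau (hatfun U) ->
  sobolev_pair T U = (2 * pi)%:C * coef (scaled (hatfun U)) (scaled (hatfun T)).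
Proof.
move=> TL UL; have [TL' _] := scaled_L2 TL; have [UL' _] := scaled_L2 UL.
have nn (F : R -> R[i]) : L2 tau F -> L2 (- - tau) F by rewrite opprK.
rewrite (sobolev_pair_coef TL UL) (coefJ TL' (nn _ UL')) [X in coef _ X]/scaled.
rewrite (coefZ _ TL' (nn _ UL)) conjcM conjc_real (coefJ UL TL') conjcK mulrA -rmorphM.
by rewrite /kappa divff ?rmorph1 ?mul1r// lt0r_neq0 ?pi2_gt0.
Qed.

(** Test functions are, up to normalization, Fourier transforms of elements of
    every Sobolev space. *)
Lemma testfun_hatfun tau f : testfun f -> exists T, [/\ sobolev tau T,
   forall h, L2 (- tau) h -> coef h (scaled (hatfun T)) = coef h f &
   nrm tau (hatfun T) <= (2 * pi) ^+ 2 * nrm tau f].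
Proof.
move=> tf; pose f' x := (2 * pi)%:C * f x; have tf' : testfun f' by exact: testfunZ.
have [sT E] := inv_fourier_sobolev tau tf'.
set T := inv_fourier_dist f' in sT E; exists T.
have [TL rT] := sobolev_L2 sT.
have [_ n1] := L2Z (2 * pi)%:C (testfun_L2 tau tf).
have [_ n2] := L2_aeq (represents_cmeas rT) E (testfun_L2 tau tf').
split => // [h hL|]; last first.
  by rewrite n2; apply: le_trans n1 _; rewrite cabs_real real_normK ?num_real.
have mf := testfun_L2 tau tf.
apply: cint_aeq.
- apply: cmeasM; last exact: cmeasJ (L2_cmeas hL).
  exact: L2_cmeas (proj1 (scaled_L2 TL)).
- by apply: cmeasM; [exact: L2_cmeas mf|exact: cmeasJ (L2_cmeas hL)].
apply: (aeS _ E) => x /esym; rewrite /scaled => ->; rewrite /f' [kappa%:C * _]mulrA -rmorphM.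
by rewrite /kappa mulVf ?mul1r// lt0r_neq0 ?pi2_gt0.
Qed.

End SobolevEntries.

Section Systems.
Variables (R : realType) (d : R) (J : int) (r s : nat).
Hypothesis d0 : d != 0.
Notation I := (sysidx r s).
Implicit Types (tau : R) (f g F G : R -> R[i]) (w : I -> R[i]).
Implicit Types (Phi : 'I_r -> distr R) (Psi : 'I_s -> distr R).

Definition scale (i : I) : int :=
  match i with inl _ => J | inr (_, n, _) => J + n%:Z end.

Definition weight tau (i : I) : R := `|d| `^ (- (2 * tau * (scale i)%:~R)).

Lemma weight_gt0 tau i : 0 < weight tau i.
Proof. by rewrite powR_gt0// normr_gt0. Qed.

Lemma weightNK tau i : weight tau i * weight (- tau) i = 1.
Proof.
rewrite /weight -powRD; last by rewrite normr_eq0 d0 implybT.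
by rewrite mulrN mulNr opprK addNr powRr0.
Qed.

Lemma bsqnormE tau w :
  bsqnorm d J tau w = (\esum_(i in [set: I]) (weight tau i * cabs (w i) ^+ 2)%:E)%E.
Proof.
rewrite esum_sys// => i; rewrite lee_fin mulr_ge0 ?sqr_ge0//.
by rewrite ltW// weight_gt0.
Qed.

Lemma bsqnorm_sum_le tau w M :
  (bsqnorm d J tau w <= M%:E)%E <-> sum_le (fun i => weight tau i * cabs (w i) ^+ 2) M.
Proof. by rewrite bsqnormE; exact: esum_sum_le. Qed.

Lemma bsqnorm_ge0 tau w : (0 <= bsqnorm d J tau w)%E.
Proof.
rewrite bsqnormE; apply: esum_ge0 => i _; rewrite lee_fin mulr_ge0 ?sqr_ge0//.
by rewrite ltW// weight_gt0.
Qed.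

(** Squaring is an order isomorphism of the nonnegative extended reals. *)
Lemma bnorm_le tau w (C y : R) : 0 < C -> 0 <= y ->
  (bnorm d J tau w <= C%:E * (y%:E `^ 2^-1))%E <->
  sum_le (fun i => weight tau i * cabs (w i) ^+ 2) (C ^+ 2 * y).
Proof.
move=> C0 y0; rewrite -bsqnorm_sum_le /bnorm; set X := bsqnorm _ _ _ _.
have X0 : (0 <= X)%E by exact: bsqnorm_ge0.
have E : (C%:E * (y%:E `^ 2^-1) = (C ^+ 2 * y)%:E `^ 2^-1)%E.
  rewrite EFinM poweRM ?lee_fin ?sqr_ge0//; congr (_ * _)%E.
  by rewrite poweR_EFin powR12_sqrt ?sqr_ge0// sqrtr_sqr gtr0_norm.
have inI (x : \bar R) : (0 <= x)%E -> x \in `[0%E, +oo%E] by move=> x0; rewrite in_itv/= x0 leey.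
have sq (x : \bar R) : ((x `^ 2^-1) `^ 2 = x `^ 1)%E by rewrite -poweRrM mulVf.
rewrite E; split => H.
  have H2 : (0 <= 2 :> R) by [].
  have := gt0_ler_poweR H2 (inI _ (poweR_ge0 _ _)) (inI _ (poweR_ge0 _ _)) H.
  by rewrite !sq !poweRe1// lee_fin mulr_ge0 ?sqr_ge0.
by apply: gt0_ler_poweR => //; rewrite ?invr_ge0//; apply: inI => //; rewrite lee_fin mulr_ge0 ?sqr_ge0.
Qed.

(** Removes square roots and extended reals from the upper bounds on the
    frequency side. *)
Lemma hat_sobolev_bound tau (w : (R -> R[i]) -> I -> R[i]) (C : R) f : 0 < C -> testfun f ->
  (bnorm d J tau (w f) <= C%:E * hat_sobolev_norm (- tau) f)%E <->
  sum_le (fun i => weight tau i * cabs (w f i) ^+ 2) (C ^+ 2 * (kappa R * nrm (- tau) f)).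
Proof.
move=> C0 tf; rewrite /hat_sobolev_norm (L2_sqnorm (testfun_L2 _ tf)); apply: bnorm_le => //.
by rewrite mulr_ge0 ?nrm_ge0// ltW// kappa_gt0.
Qed.

Lemma expVz (n : int) : (d ^ n)^-1 = d ^ (- n).
Proof. by rewrite invr_expz. Qed.

Lemma WS_hatfun tau Phi Psi : (forall l, sobolev tau (Phi l)) -> (forall l, sobolev tau (Psi l)) ->
  forall i : I, L2 tau (hatfun (WS d J Phi Psi i)) /\
    represents (hatfun (WS d J Phi Psi i))
      (FWS d J (fun l => fourier_dist (Phi l)) (fun l => fourier_dist (Psi l)) i).
Proof.
move=> sPhi sPsi [[l k]|[[l n] k]] /=; rewrite -expVz; apply: dilate_translate_L2 => //.
  by rewrite expfz_neq0.
by rewrite expfz_neq0.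
Qed.

(** A single entry with trivial modulation is a dilate of its generator, and
    dilations are invertible and bounded. *)
Lemma term_test_bounded tau (n : int) (T : distr R) (c K : R) : 0 < c ->
  (forall f, testfun f ->
     c * cabs (pairl f (dilate_modulate (d ^ (- n)) 0 T)) ^+ 2 <= K * nrm tau f) ->
  0 <= K -> test_bounded tau T.
Proof.
move=> c0 H K0; have dn : d ^ (- n) != 0 by rewrite expfz_neq0.
rewrite -(dilate_modulateK T dn); apply: dilate_modulate_bounded; first by rewrite invr_eq0.
exists (K / c); first by rewrite divr_ge0// ltW.
move=> g tg; have := H _ (testfunJ tg).
rewrite /pairl cabs_conj (_ : conjf (conjf g) = g); last first.
  by apply/funext => x; rewrite /conjf conjcK.
rewrite mulrAC ler_pdivlMr// mulrC => /le_trans; apply.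
by rewrite ler_wpM2l//; case: (L2J (testfun_L2 tau tg)).
Qed.

(** The entries with trivial modulation already recover the generators: an
    upper bound makes each of them continuous on test functions, hence
    represented by a function of the dual space. *)
Lemma bound_sobolev tau Phi Psi K : (forall l, tempered (Phi l)) -> (forall l, tempered (Psi l)) ->
  0 <= K ->
  (forall f, testfun f ->
    sum_le (fun i : I => weight tau i * cabs (pairl f
      (FWS d J (fun l => fourier_dist (Phi l)) (fun l => fourier_dist (Psi l)) i)) ^+ 2)
      (K * nrm (- tau) f)) ->
  (forall l, sobolev tau (Phi l)) /\ (forall l, sobolev tau (Psi l)).
Proof.
move=> tPhi tPsi K0 H; split => l; apply: bounded_sobolev => //.
  apply: (@term_test_bounded _ J _ _ K (weight_gt0 tau (inl (l, 0%Z)))) => // f tf.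
  exact: (sum_le_term (inl (l, 0%Z)) (H f tf)).
apply: (@term_test_bounded _ (J + 0%:Z) _ _ K (weight_gt0 tau (inr (l, 0%N, 0%Z)))) => // f tf.
exact: (sum_le_term (inr (l, 0%N, 0%Z)) (H f tf)).
Qed.

(** The Sobolev pairing and the coefficient with respect to the transform of
    an entry differ by the factor 1 / (2 pi), which is absorbed in the
    constants. *)
Lemma stability_intro tau Phi Psi K1 K2 : 0 <= K1 -> 0 <= K2 ->
  (forall l, sobolev tau (Phi l)) -> (forall l, sobolev tau (Psi l)) ->
  (forall F, L2 (- tau) F -> sum_le
     (fun i : I => weight tau i * cabs (coef (hatfun (WS d J Phi Psi i)) F) ^+ 2) (K1 * nrm (- tau) F)) ->
  (forall F X, L2 (- tau) F -> sum_le
     (fun i : I => weight tau i * cabs (coef (hatfun (WS d J Phi Psi i)) F) ^+ 2) X ->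
     nrm (- tau) F <= K2 * X) ->
  stability d J tau Phi Psi.
Proof.
move=> K10 K20 sPhi sPsi HU HL; have HW := WS_hatfun sPhi sPsi.
have kp := kappa_gt0 R.
exists (kappa R / (K2 + 1)), (K1 * kappa R + 1); split.
- by rewrite divr_gt0// ltr_wpDl.
- by rewrite ltr_wpDl// mulr_ge0// ltW.
move=> T /sobolev_L2[TL _]; have [SL Sn] := scaled_L2 TL.
have E : (fun i => sobolev_pair T (WS d J Phi Psi i)) =
    fun i : I => coef (hatfun (WS d J Phi Psi i)) (scaled (hatfun T)).
  by apply/funext => i; have [hL _] := HW i; rewrite (sobolev_pair_coef TL hL).
rewrite E /sobolev_sqnorm (L2_sqnorm TL) -/(kappa R) -!EFinM.
have nn := nrm_ge0 (- tau) (hatfun T).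
have up : (bsqnorm d J tau (fun i : I => coef (hatfun (WS d J Phi Psi i)) (scaled (hatfun T)))
    <= ((K1 * kappa R + 1) * (kappa R * nrm (- tau) (hatfun T)))%:E)%E.
  apply/bsqnorm_sum_le; apply: sum_leW (HU _ SL); rewrite Sn mulrDl mul1r.
  apply: ler_wpDr; first by rewrite mulr_ge0// ltW.
  by rewrite expr2 !mulrA.
split => //; move: up; set X := bsqnorm _ _ _ _ => up.
have X0 : (0 <= X)%E by exact: bsqnorm_ge0.
have Xf : X \is a fin_num by rewrite ge0_fin_numE// (le_lt_trans up)// ltry.
rewrite -(fineK Xf) lee_fin.
have /(HL _ _ SL) : sum_le (fun i : I => weight tau i *
    cabs (coef (hatfun (WS d J Phi Psi i)) (scaled (hatfun T))) ^+ 2) (fine X).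
  by apply/bsqnorm_sum_le; rewrite fineK.
have fX : 0 <= fine X by exact: fine_ge0.
rewrite Sn => lo.
rewrite mulrAC ler_pdivrMr ?ltr_wpDl// [leRHS]mulrC mulrDl mul1r.
apply: le_trans (_ : K2 * fine X <= _); last by rewrite lerDl.
by rewrite mulrA -expr2.
Qed.

(** Test functions are scaled transforms of Sobolev distributions, to which
    stability applies. *)
Lemma stability_bound tau Phi Psi :
  (forall l, sobolev tau (Phi l)) -> (forall l, sobolev tau (Psi l)) ->
  stability d J tau Phi Psi ->
  exists2 K, 0 <= K & forall f, testfun f -> sum_le
    (fun i : I => weight tau i * cabs (coef (hatfun (WS d J Phi Psi i)) f) ^+ 2) (K * nrm (- tau) f).
Proof.
move=> sPhi sPsi [C1 [C2 [C10 C20 H]]]; have HW := WS_hatfun sPhi sPsi.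
have kp := kappa_gt0 R.
exists (C2 * kappa R * (2 * pi) ^+ 2); first by apply: mulr_ge0; [apply: mulr_ge0; exact: ltW|exact: sqr_ge0].
move=> f tf; have [T [sT cT nT]] := testfun_hatfun (- tau) tf.
have [_] := H _ sT; have [TL _] := sobolev_L2 sT.
rewrite /sobolev_sqnorm (L2_sqnorm TL) -/(kappa R) -EFinM => /bsqnorm_sum_le H2 A uA.
rewrite (eq_bigr (fun i => weight tau i * cabs (sobolev_pair T (WS d J Phi Psi i)) ^+ 2)); last first.
  by move=> i _; have [hL _] := HW i; rewrite (sobolev_pair_coef TL hL) cT ?opprK.
apply: le_trans (H2 A uA) _; move: nT; move: ((2 * pi) ^+ 2) => c nT.
by rewrite -!mulrA ler_pM2l// ler_pM2l.
Qed.

End Systems.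

(** * The equivalence *)

Section MainProof.
Variables (R : realType) (d : R) (J : int) (r s : nat) (tau : R).
Hypothesis d0 : d != 0.
Variables (Phi Phit : 'I_r -> distr R) (Psi Psit : 'I_s -> distr R).
Notation I := (sysidx r s).
Notation FPhi := (fun l => fourier_dist (Phi l)).
Notation FPsi := (fun l => fourier_dist (Psi l)).
Notation FPhit := (fun l => fourier_dist (Phit l)).
Notation FPsit := (fun l => fourier_dist (Psit l)).

Let h (i : I) := hatfun (WS d J Phi Psi i).
Let ht (i : I) := hatfun (WS d J Phit Psit i).

Section Generators.
Hypotheses (sPhi : forall l, sobolev tau (Phi l)) (sPsi : forall l, sobolev tau (Psi l)).
Hypotheses (sPhit : forall l, sobolev (- tau) (Phit l)) (sPsit : forall l, sobolev (- tau) (Psit l)).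

Let hL i : L2 tau (h i). Proof. by case: (WS_hatfun J d0 sPhi sPsi i). Qed.
Let htL i : L2 (- tau) (ht i). Proof. by case: (WS_hatfun J d0 sPhit sPsit i). Qed.

Lemma pairl_FWS f i : testfun f -> pairl f (FWS d J FPhi FPsi i) = coef (h i) f.
Proof. by move=> tf; have [hL' rh] := WS_hatfun J d0 sPhi sPsi i; exact: pairl_coef hL' rh tf. Qed.

Lemma products_FWS f g : testfun f -> testfun g ->
  (fun i => pairl f (FWS d J FPhi FPsi i) * pairr (FWS d J FPhit FPsit i) g) = products h ht f g.
Proof.
move=> tf tg; apply/funext => i; rewrite pairl_FWS//; congr (_ * _).
by have [hL' rh] := WS_hatfun J d0 sPhit sPsit i; exact: pairr_coef hL' rh tg.
Qed.

Lemma products_WS T U : L2 (- tau) (hatfun T) -> L2 tau (hatfun U) ->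
  (fun i => sobolev_pair T (WS d J Phi Psi i) * sobolev_pair (WS d J Phit Psit i) U) =
  products h ht (scaled (hatfun T)) (scaled (hatfun U)).
Proof.
move=> TL UL; apply/funext => i; rewrite (sobolev_pair_coef TL (hL i)); congr (_ * _).
have UL' : L2 (- - tau) (hatfun U) by rewrite opprK.
by rewrite (sobolev_pairC UL' (htL i)) (sobolev_pair_coef UL' (htL i)).
Qed.

(** Every pair of test functions is, up to the factor 1 / (2 pi), the pair of
    transforms of some T and U, for which the terms of the two identities
    coincide. *)
Lemma dual_frames_freq :
  (forall T U : distr R, sobolev (- tau) T -> sobolev tau U ->
        let u i := sobolev_pair T (WS d J Phi Psi i) *
                   sobolev_pair (WS d J Phit Psit i) U in
        abs_summable u /\
        ccvg_to (partial_sys_sum u) (sobolev_pair T U)) ->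
  freq_dual_frames d J FPhi FPsi FPhit FPsit.
Proof.
move=> H f g tf tg u; have [T [sT cT _]] := testfun_hatfun (- tau) tf.
have [U [sU cU _]] := testfun_hatfun tau tg.
have [TL _] := sobolev_L2 sT; have [UL _] := sobolev_L2 sU.
have nn F : L2 tau F -> L2 (- - tau) F by rewrite opprK.
have uE : u = fun i => sobolev_pair T (WS d J Phi Psi i) * sobolev_pair (WS d J Phit Psit i) U.
  rewrite (products_WS TL UL) /u products_FWS//; apply/funext => i.
  by rewrite /products (cT _ (nn _ (hL i))) cU.
have [sU' cv] := H T U sT sU; rewrite -uE in sU' cv.
have us : sum_le (fun i => cabs (u i)) (fine (\esum_(i in [set: I]) (cabs (u i))%:E)).
  by apply: sum_le_fin sU' => i; exact: cabs_ge0.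
split.
- move=> l; exact: sum_le_lty (sum_le_comp (@inl_pair_inj r s l) us).
- move=> n l; exact: sum_le_lty (sum_le_comp (@inr_pair_inj r s l n) us).
have [UL' _] := scaled_L2 UL.
rewrite (sobolev_pair_scaled TL UL) (cT _ (nn _ UL')) in cv.
rewrite (_ : cintegral _ = coef (scaled (hatfun U)) f)//.
have fL := testfun_L2 (- tau) tf.
by rewrite -/(coef g f) (coefJ fL (nn _ (testfun_L2 tau tg))) -cU// -(coefJ fL (nn _ UL')).
Qed.

(** The upper bounds and the identity extend from test functions to both
    weighted spaces by density, and the lower bounds follow from the identity. *)
Lemma freq_dual_frames_sobolev K1 K2 : 0 <= K1 -> 0 <= K2 ->
  (forall f, testfun f -> sum_le
     (fun i : I => weight d J tau i * cabs (coef (h i) f) ^+ 2) (K1 * nrm (- tau) f)) ->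
  (forall f, testfun f -> sum_le
     (fun i : I => weight d J (- tau) i * cabs (coef (ht i) f) ^+ 2) (K2 * nrm tau f)) ->
  freq_dual_frames d J FPhi FPsi FPhit FPsit ->
  sobolev_dual_frames d J tau Phi Psi Phit Psit.
Proof.
move=> K10 K20 H1 H2 HF.
have w0 t i : 0 < weight (s := s) (r := r) d J t i by exact: weight_gt0.
have nn F : L2 tau F -> L2 (- - tau) F by rewrite opprK.
have C1 : 0 <= 4 * K1 by rewrite mulr_ge0.
have C2 : 0 <= 4 * K2 by rewrite mulr_ge0.
have B1 := coef_bound_dense (fun i => ltW (w0 tau i)) hL K10 H1.
have H2' f : testfun f -> sum_le
    (fun i : I => weight d J (- tau) i * cabs (coef (ht i) f) ^+ 2) (K2 * nrm (- - tau) f).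
  by rewrite opprK; exact: H2.
have B2 F : L2 tau F -> sum_le
    (fun i : I => weight d J (- tau) i * cabs (coef (ht i) F) ^+ 2) (4 * K2 * nrm tau F).
  by move=> /nn /(coef_bound_dense (fun i => ltW (w0 (- tau) i)) htL K20 H2'); rewrite opprK.
have pq i : weight (s := s) (r := r) d J tau i * weight d J (- tau) i = 1 by exact: weightNK.
have cvt f g : testfun f -> testfun g ->
    ccvg_to (partial_sys_sum (products h ht f g)) ((2 * pi)%:C * coef g f).
  by move=> tf tg; have [_ _] := HF f g tf tg; rewrite products_FWS.
have cvL := dual_identity_dense (w0 tau) pq hL htL C1 C2 B1 B2 cvt.
split => //.
- apply: (stability_intro d0 C1 _ sPhi sPsi B1) => [|F X FL]; last first.
    exact: (dual_lowerl (w0 tau) pq C2 B2 FL cvL).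
  by rewrite addr_ge0.
- apply: (stability_intro d0 C2 _ sPhit sPsit) => [|F FL|F X FL]; last first.
  - rewrite opprK in FL *; exact: (dual_lowerr (w0 tau) pq C1 B1 FL cvL).
  - by rewrite opprK in FL *; exact: B2.
  by rewrite addr_ge0.
move=> T U sT sU u; have [TL _] := sobolev_L2 sT; have [UL _] := sobolev_L2 sU.
have [TL' _] := scaled_L2 TL; have [UL' _] := scaled_L2 UL.
rewrite /u (products_WS TL UL) (sobolev_pair_scaled TL UL); split; last exact: cvL.
exact: sum_le_lty (products_L2 (w0 tau) pq C1 C2 B1 B2 TL' UL').
Qed.

End Generators.

End MainProof.

Theorem theorem7 (R : realType) (tau d : R) (hd : d != 0) (J : int)
  (r s : nat)
  (Phi : 'I_r -> distr R) (Psi : 'I_s -> distr R)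
  (Phit : 'I_r -> distr R) (Psit : 'I_s -> distr R)
  (tempered_Phi : forall l, tempered (Phi l)) (tempered_Psi : forall l, tempered (Psi l))
  (tempered_Phit : forall l, tempered (Phit l)) (tempered_Psit : forall l, tempered (Psit l)) :
  let Phi_hat l := fourier_dist (Phi l) in
  let Psi_hat l := fourier_dist (Psi l) in
  let Phit_hat l := fourier_dist (Phit l) in
  let Psit_hat l := fourier_dist (Psit l) in
  sobolev_dual_frames d J tau Phi Psi Phit Psit <->
  (exists C : R, 0 < C /\
     (forall f : R -> R[i], testfun f ->
        (bnorm d J tau (fun i => pairl f (FWS d J Phi_hat Psi_hat i))
           <= C%:E * hat_sobolev_norm (- tau) f)%E) /\
     (forall f : R -> R[i], testfun f ->
        (bnorm d J (- tau) (fun i => pairl f (FWS d J Phit_hat Psit_hat i))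
           <= C%:E * hat_sobolev_norm tau f)%E)) /\
  freq_dual_frames d J Phi_hat Psi_hat Phit_hat Psit_hat.
Proof.
move=> Phi_hat Psi_hat Phit_hat Psit_hat; have kp := kappa_gt0 R; split.
  move=> [[sPhi sPsi] st [sPhit sPsit] stt H]; split; last first.
    exact: (dual_frames_freq hd sPhi sPsi sPhit sPsit H).
  have [K1 K10 B1] := stability_bound hd sPhi sPsi st.
  have [K2 K20 B2] := stability_bound hd sPhit sPsit stt.
  (* C is chosen such that C^2 / (2 pi) exceeds both K1 and K2 *)
  have C2 : 0 < (K1 + K2 + 1) / kappa R by rewrite divr_gt0// ltr_wpDl// addr_ge0.
  have CE : Num.sqrt ((K1 + K2 + 1) / kappa R) ^+ 2 * kappa R = K1 + K2 + 1.
    by rewrite sqr_sqrtr ?(ltW C2)// divfK// lt0r_neq0.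
  exists (Num.sqrt ((K1 + K2 + 1) / kappa R)); split; first by rewrite sqrtr_gt0.
  split => f tf.
    apply/(hat_sobolev_bound J hd tau (fun f i => pairl f (FWS d J Phi_hat Psi_hat i)));
      rewrite ?sqrtr_gt0// mulrA CE.
    under eq_fun do rewrite (pairl_FWS J hd sPhi sPsi)//.
    apply: sum_leW (B1 f tf); rewrite ler_wpM2r ?nrm_ge0//.
    by rewrite -addrA lerDl addr_ge0.
  rewrite -[tau in hat_sobolev_norm tau]opprK.
  apply/(hat_sobolev_bound J hd (- tau) (fun f i => pairl f (FWS d J Phit_hat Psit_hat i)));
    rewrite ?sqrtr_gt0// mulrA CE.
  under eq_fun do rewrite (pairl_FWS J hd sPhit sPsit)//.
  apply: sum_leW (B2 f tf); rewrite ler_wpM2r ?nrm_ge0//.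
  by rewrite addrAC lerDr addr_ge0.
move=> [[C [C0 [H1 H2]]] HF].
have CK : 0 <= C ^+ 2 * kappa R by rewrite mulr_ge0 ?sqr_ge0// ltW.
have B1 f : testfun f -> sum_le (fun i : sysidx r s => weight d J tau i *
    cabs (pairl f (FWS d J Phi_hat Psi_hat i)) ^+ 2) (C ^+ 2 * kappa R * nrm (- tau) f).
  move=> tf; rewrite -mulrA.
  exact/(hat_sobolev_bound J hd tau (fun f i => pairl f (FWS d J Phi_hat Psi_hat i)) C0 tf)/H1.
have B2 f : testfun f -> sum_le (fun i : sysidx r s => weight d J (- tau) i *
    cabs (pairl f (FWS d J Phit_hat Psit_hat i)) ^+ 2) (C ^+ 2 * kappa R * nrm (- - tau) f).
  move=> tf; rewrite -mulrA.
  apply/(hat_sobolev_bound J hd (- tau) (fun f i => pairl f (FWS d J Phit_hat Psit_hat i)) C0 tf).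
  by rewrite opprK; exact: H2.
have [sPhi sPsi] := bound_sobolev hd tempered_Phi tempered_Psi CK B1.
have [sPhit sPsit] := bound_sobolev hd tempered_Phit tempered_Psit CK B2.
apply: (freq_dual_frames_sobolev hd sPhi sPsi sPhit sPsit CK CK _ _ HF) => f tf.
  by have := B1 f tf; under eq_fun do rewrite (pairl_FWS J hd sPhi sPsi)//.
by have := B2 f tf; rewrite opprK; under eq_fun do rewrite (pairl_FWS J hd sPhit sPsit)//.
Qed.
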